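(* Let $(\bar M^7,\bar g,\phi)$ be a $\mathrm{G}_2$-manifold with characteristic connection $\bar\nabla^c$ and torsion $\bar T$. Let $M^6\subset\bar M^7$ be a hypersurface of type one or three with unit normal $V$ such that $V\lrcorner\bar T=0$, with Weingarten map $W$ and Levi-Civita connection $\nabla$. Let $L$ be the 3-form on $M^6$ defined in the context, $T:=\bar T|_{M^6}+L$, and let $s\in\mathbb{R}$. Then: (1) $(M^6,g=\bar g|_{TM^6},\phi|_{M^6})$ is an $\mathrm{SU}(3)$-manifold with characteristic connection of torsion $T=\bar T|_{M^6}+L$. (2) Any spinor field $\phi^*$ on $\bar M^7$ solving the generalised Killing spinor equation with torsion $\nabla^s_X\phi^*=\frac12W(X)\cdot\phi^*$ on $M^6$ (for all $X\in TM^6$) satisfies $$\bar\nabla^s_X\phi^*=-s\,(X\lrcorner L)\phi^*\qquad\text{for all }X\in TM^6.$$ (3) Conversely, if $\phi^*$ is $\bar\nabla^s$-parallel on $\bar M^7$, then for all $X\in TM^6$ $$\nabla^s_X\phi^*=-s\,\big(X\lrcorner(\bar T-T)\big)\phi^*+\tfrac12W(X)\cdot\phi^*.$$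
   Context: Conventions. Clifford algebras satisfy $X^2=-|X|^2$; a $k$-form $e_{i_1}\wedge\dots\wedge e_{i_k}$ acts on spinors as $e_{i_1}\cdots e_{i_k}$. $\bar\Sigma$ is the real rank-8 spinor bundle of the oriented Riemannian spin manifold $\bar M^7$ (with $e_1\cdots e_7=-\mathrm{Id}$ for positively oriented orthonormal frames), with inner product $(\cdot,\cdot)$ for which vectors act skew-symmetrically; Clifford multiplication of $\bar M^7$ is juxtaposition and $\bar\nabla$ is the Levi-Civita connection and its spinor lift. A $\mathrm{G}_2$-manifold is such $\bar M^7$ with a unit spinor field $\phi$. A characteristic connection is a metric connection with totally skew-symmetric torsion preserving the structure, equivalently the spinor $\phi$: with torsion 3-form $\bar T$, $\bar\nabla^c_XY=\bar\nabla_XY+\frac12\bar T(X,Y,\cdot)^\sharp$ and $\bar\nabla^c_X\phi=\bar\nabla_X\phi+\frac14(X\lrcorner\bar T)\phi=0$; similarly in dimension 6. Hypersurface. $M^6$ has unit normal $V$ and is oriented so that (oriented frame of $M^6$, $V$) is oriented. Its spinor bundle is $\bar\Sigma|_{M^6}$ with Clifford multiplication $X\cdot\phi:=VX\phi$ (so 2-forms on $M^6$ act the same way with both multiplications). The Weingarten map $W$ is the symmetric endomorphism with $\bar\nabla_XY=\nabla_XY+g(W(X),Y)V$; on spinors $\bar\nabla_X\phi=\nabla_X\phi-\frac12W(X)\cdot\phi$. With $j:=e_1\cdots e_6$, the spinor $\phi|_{M^6}$ defines an $\mathrm{SU}(3)$-structure on $M^6$, with almost complex structure $J$ given by $(JX)\cdot\phi=j(X\cdot\phi)$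 and 3-form $\psi_\phi(X,Y,Z)=-(X\cdot Y\cdot Z\cdot\phi,\phi)$. Types: $M^6$ is of type one if $W$ is pointwise a multiple of $\mathrm{Id}$, and of type three if $W$ is (symmetric traceless) anticommuting with $J$. Write $W=\mu\,\mathrm{Id}+W_3$ with $JW_3=-W_3J$, and set $$L(X,Y,Z):=-\mathop{\mathfrak{S}}_{X,Y,Z}\psi_\phi(W_3(X),Y,Z)-\mu\,\psi_\phi(X,Y,Z),$$ where $\mathfrak{S}$ denotes the cyclic sum. The condition $V\lrcorner\bar T=0$ is imposed along $M^6$. The connections $\nabla^s=\nabla+2sT$ and $\bar\nabla^s=\bar\nabla+2s\bar T$ act on spinors by $\nabla^s_X\phi^*=\nabla_X\phi^*+s(X\lrcorner T)\phi^*$ and $\bar\nabla^s_X\phi^*=\bar\nabla_X\phi^*+s(X\lrcorner\bar T)\phi^*$ (so $s=\frac14$ gives the characteristic connections and $s=0$ the Levi-Civita ones). *)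

(* Defs.v *)
From HB Require Import structures.
From mathcomp Require Import all_boot all_order all_algebra.
From mathcomp Require Import all_classical all_reals all_analysis.
Import Order.TTheory GRing.Theory Num.Theory numFieldNormedType.Exports.

Set Implicit Arguments.
Unset Strict Implicit.
Unset Printing Implicit Defensive.

Local Open Scope classical_set_scope.
Local Open Scope ring_scope.

Section Smooth.
Context {R : realType}.

Fixpoint Cdiff (V W : normedModType R) (k : nat) (U : set V) (f : V -> W) :=
  match k with
  | 0 => forall x, U x -> {for x, continuous f}
  | k'.+1 => (forall x, U x -> differentiable f x) /\
             forall v, Cdiff k' U (fun x => 'D_v f x)
  end.

Definition smooth_on (V W : normedModType R) (U : set V) (f : V -> W) :=
  forall k, Cdiff k U f.

(* [cmap] is only meaningful on [cdom], and [cinv] on [cmap @` cdom]. *)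
Record chart (M : topologicalType) (n : nat) := Chart {
  cdom : set M;
  cmap : M -> 'rV[R]_n;
  cinv : 'rV[R]_n -> M }.

Definition cimg (M : topologicalType) (n : nat) (c : chart M n) :=
  cmap c @` cdom c.

Definition is_chart (M : topologicalType) (n : nat) (c : chart M n) :=
  [/\ open (cdom c), open (cimg c),
      forall p, cdom c p -> cinv c (cmap c p) = p,
      forall p, cdom c p -> {for p, continuous (cmap c)}
    & forall x, cimg c x -> {for x, continuous (cinv c)}].

Definition compatible (M : topologicalType) (n : nat) (c d : chart M n) :=
  smooth_on (cmap c @` (cdom c `&` cdom d)) (cmap d \o cinv c).

End Smooth.

(* [chart_at] is a choice of a preferred chart around each point; it is only
   used to represent tangent vectors by their coordinates. *)
Record manifold (R : realType) (n : nat) := Manifold {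
  mspace :> topologicalType;
  atlas : set (@chart R mspace n);
  chart_at : mspace -> @chart R mspace n;
  _ : hausdorff_space mspace;
  _ : @second_countable mspace;
  _ : forall c, atlas c -> is_chart c;
  _ : forall c d, atlas c -> atlas d -> compatible c d;
  _ : forall p, atlas (chart_at p) /\ cdom (chart_at p) p }.

Section Bundles.
Context {R : realType} {n : nat}.
Variable M : manifold R n.

Definition smooth_near (W : normedModType R) (p : M) (f : M -> W) :=
  exists U : set 'rV[R]_n,
    [/\ open U, U (cmap (chart_at p) p), U `<=` cimg (chart_at p)
      & smooth_on U (f \o cinv (chart_at p))].

Definition smooth_fun (p : M) (f : M -> R) := smooth_near p (f : M -> R^o).

(* The tangent space at [p] is R^n, through the coordinates of [chart_at p]:
   [v] stands for the vector acting on functions by [dird p v]. *)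
Definition tangent (_ : M) : lmodType R := 'rV[R]_n.

Definition dird (p : M) (v : tangent p) (f : M -> R) : R :=
  'D_v (f \o cinv (chart_at p)) (cmap (chart_at p) p).

(* A vector field is smooth iff it maps smooth functions to smooth functions;
   its coordinates cannot be used since [chart_at] jumps from point to point. *)
Definition smooth_vf (p : M) (X : forall q : M, tangent q) :=
  forall f : M -> R, smooth_fun p f -> smooth_fun p (fun q => dird (X q) f).

Section Family.
Variable E : M -> lmodType R.
(* [sm p sigma]: the section [sigma] is smooth in a neighbourhood of [p] *)
Variable sm : M -> (forall q, E q) -> Prop.

Definition vector_bundle (k : nat) :=
  forall p : M, exists s : 'I_k -> forall q, E q, \forall q \near p,
    (forall x : E q, exists! a : 'rV[R]_k, x = \sum_i a 0 i *: s i q) /\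
    (forall sigma : forall q, E q, sm q sigma <->
       exists a : 'I_k -> M -> R, (forall i, smooth_fun q (a i)) /\
         \forall r \near q, sigma r = \sum_i a i r *: s i r).

Definition connection := forall p : M, tangent p -> (forall q, E q) -> E p.

Definition is_connection (D : connection) :=
  [/\ forall p s, sm p s -> linear (fun v => D p v s),
      forall p v s t, sm p s -> sm p t ->
        D p v (fun q => s q + t q) = D p v s + D p v t,
      forall p v (f : M -> R) s, smooth_fun p f -> sm p s ->
        D p v (fun q => f q *: s q) = dird v f *: s p + f p *: D p v s
    & forall p X s, smooth_vf p X -> sm p s -> sm p (fun q => D q (X q) s)].

Definition preserves (D : connection) (h : forall q, E q -> E q -> R) :=
  forall p v s t, sm p s -> sm p t ->
    dird v (fun q => h q (s q) (t q)) =
    h p (D p v s) (t p) + h p (s p) (D p v t).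

Definition euclidean (h : forall q, E q -> E q -> R) :=
  [/\ forall p y, scalar (fun x : E p => h p x y),
      forall p x y, h p x y = h p y x,
      forall p x, x != 0 -> 0 < h p x x
    & forall p s t, sm p s -> sm p t ->
        smooth_fun p (fun q => h q (s q) (t q))].

End Family.

Definition metric_tensor := forall p : M, tangent p -> tangent p -> R.

Definition orthonormal (g : metric_tensor) (p : M) (e : 'M[R]_n) :=
  forall i j, g p (row i e) (row j e) = (i == j)%:R.

Definition sharp (g : metric_tensor) (p : M) (a : tangent p -> R) : tangent p :=
  (\row_i a (delta_mx 0 i)) *m
  invmx (\matrix_(i, j) g p (delta_mx 0 i) (delta_mx 0 j)).

Definition form3 := forall p : M, tangent p -> tangent p -> tangent p -> R.

Definition is_form3 (T : form3) :=
  [/\ forall p y z, scalar (fun x : tangent p => T p x y z),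
      forall p x y z, T p x y z = - T p y x z,
      forall p x y z, T p x y z = - T p x z y
    & forall p X Y Z, smooth_vf p X -> smooth_vf p Y -> smooth_vf p Z ->
        smooth_fun p (fun q => T q (X q) (Y q) (Z q))].

(* D_X Y - D_Y X - [X, Y] = T(X, Y, .)^sharp, tested on functions *)
Definition has_torsion (g : metric_tensor) (D : connection tangent) (T : form3)
    :=
  forall p X Y (f : M -> R), smooth_vf p X -> smooth_vf p Y ->
    smooth_fun p f ->
    dird (D p (X p) Y) f - dird (D p (Y p) X) f
    - (dird (X p) (fun q => dird (Y q) f) - dird (Y p) (fun q => dird (X q) f))
    = dird (sharp g (T p (X p) (Y p))) f.

Definition levi_civita (g : metric_tensor) (D : connection tangent) :=
  [/\ is_connection smooth_vf D, preserves smooth_vf D g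
    & has_torsion g D (fun _ _ _ _ => 0)].

(* [pos p e]: the rows of [e] form a positively oriented basis at [p] *)
Definition is_orientation (pos : M -> set 'M[R]_n) :=
  [/\ forall p, exists e, pos p e,
      forall p e, pos p e -> e \in unitmx,
      forall p e f, pos p e -> (pos p f <-> 0 < \det (f *m invmx e))
    & forall p (X : 'I_n -> forall q : M, tangent q),
        (forall i, smooth_vf p (X i)) -> pos p (\matrix_(i < n) X i p) ->
        \forall q \near p, pos q (\matrix_(i < n) X i q)].

Record spin_data := SpinData {
  metric : metric_tensor;
  positive : M -> set 'M[R]_n;
  nabla : connection tangent;
  spinor : M -> lmodType R;
  ssmooth : M -> (forall q, spinor q) -> Prop;
  sprod : forall p, spinor p -> spinor p -> R;
  cmul : forall p, tangent p -> spinor p -> spinor p;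
  snabla : connection spinor }.

Arguments sprod S [p] : rename.
Arguments cmul S [p] : rename.

(* In dimensions 6 and 7 the real Clifford representations on R^8 have
   commutant R.  Hence, over an oriented manifold, an orthogonal bundle of
   Clifford modules of rank 8 is the same thing as a spin structure with its
   real spinor bundle: the pairs formed by an oriented orthonormal frame e and
   an orthonormal frame s of the bundle in which the e_i act by fixed matrices
   form the principal Spin(n)-bundle. *)
Definition is_spinor_bundle (S : spin_data) :=
  [/\ vector_bundle (@ssmooth S) 8,
      euclidean (@ssmooth S) (@sprod S),
      (forall p phi, linear (fun X : tangent p => cmul S X phi)) /\
      (forall p X, linear (@cmul S p X)),
      (forall (p : M) X (phi : spinor S p),
         cmul S X (cmul S X phi) = - metric S X X *: phi) /\
      (forall (p : M) X (phi psi : spinor S p),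
         sprod S (cmul S X phi) psi = - sprod S phi (cmul S X psi))
    & forall p X s, smooth_vf p X -> ssmooth p s ->
        @ssmooth S p (fun q => cmul S (X q) (s q))].

(* For the same reason these conditions determine [snabla] uniquely as the
   connection induced by [nabla] on the spinor bundle. *)
Definition is_spin_lift (S : spin_data) :=
  [/\ is_connection (@ssmooth S) (@snabla S),
      preserves (@ssmooth S) (@snabla S) (@sprod S)
    & forall p v X s, smooth_vf p X -> ssmooth p s ->
        snabla v (fun q => cmul S (X q) (s q)) =
        cmul S (nabla S v X) (s p) + cmul S (X p) (snabla v s)].

Definition spin_manifold (S : spin_data) :=
  [/\ euclidean smooth_vf (metric S), is_orientation (@positive S),
      levi_civita (metric S) (nabla S), is_spinor_bundle S & is_spin_lift S].

Definition spinor_field (S : spin_data) (phi : forall p, spinor S p) :=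
  forall p, ssmooth p phi.

Definition unit_spinor_field (S : spin_data) (phi : forall p, spinor S p) :=
  spinor_field phi /\ forall p, sprod S (phi p) (phi p) = 1.

(* e_1 (e_2 (... (e_n phi))), the e_i being the rows of [e] *)
Definition frame_mul (S : spin_data) (p : M) (e : 'M[R]_n) (phi : spinor S p) :=
  foldr (fun i => cmul S (row i e : tangent p)) phi (enum 'I_n).

(* The volume element and the action of 2-forms do not depend on the chosen
   orthonormal frame. *)
Definition volume_mul (S : spin_data) (p : M) : spinor S p -> spinor S p :=
  frame_mul (get [set e | orthonormal (metric S) p e /\ positive S p e]).

Definition form2_mul (S : spin_data) (p : M) (w : tangent p -> tangent p -> R)
    (phi : spinor S p) : spinor S p :=
  let e := get [set e | orthonormal (metric S) p e] in
  \sum_(i < n) \sum_(j < n | (i < j)%N)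
    w (row i e) (row j e) *:
      cmul S (row i e : tangent p) (cmul S (row j e : tangent p) phi).

(* nabla^s = nabla + 2sT, on vector fields and on spinors *)
Definition nabla_tor (S : spin_data) (T : form3) (s : R) : connection tangent :=
  fun p v Y => nabla S v Y + (2 * s) *: sharp (metric S) (T p v (Y p)).

Definition snabla_tor (S : spin_data) (T : form3) (s : R) :
    connection (spinor S) :=
  fun p v phi => snabla v phi + s *: form2_mul (T p v) (phi p).

Definition characteristic_connection (S : spin_data) (T : form3)
    (phi : forall p, spinor S p) :=
  let nablac := nabla_tor S T 4^-1 in
  [/\ is_form3 T,
      is_connection smooth_vf nablac,
      preserves smooth_vf nablac (metric S),
      has_torsion (metric S) nablac T
    & forall p (v : tangent p), snabla_tor T 4^-1 v phi = 0].

End Bundles.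

Arguments sprod {R n M} S [p] : rename.
Arguments cmul {R n M} S [p] : rename.

Definition G2_manifold (R : realType) (M : manifold R 7) (S : spin_data M)
    (phi : forall p, spinor S p) :=
  [/\ spin_manifold S,
      forall p e (psi : spinor S p), orthonormal (metric S) p e ->
        positive S p e -> frame_mul e psi = - psi
    & unit_spinor_field phi].

Definition SU3_manifold (R : realType) (M : manifold R 6) (S : spin_data M)
    (phi : forall p, spinor S p) :=
  spin_manifold S /\ unit_spinor_field phi.

Section Maps.
Context {R : realType} {m n : nat}.
Variables (M : manifold R m) (N : manifold R n) (iota : M -> N).

Definition tmap (q : M) (v : tangent q) : tangent (iota q) :=
  'D_v (cmap (chart_at (iota q)) \o iota \o cinv (chart_at q))
    (cmap (chart_at q) q).

Definition smooth_map :=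
  continuous iota /\ forall q, smooth_near q (cmap (chart_at (iota q)) \o iota).

Definition embedding :=
  [/\ smooth_map, injective iota, forall q (v : tangent q), tmap v = 0 -> v = 0
    & forall U : set M, open U -> exists2 O : set N, open O & U = iota @^-1` O].

Variables (E : N -> lmodType R) (sm : N -> (forall p, E p) -> Prop).

(* smooth sections of the pullback bundle *)
Definition smooth_along (q : M) (Z : forall r, E (iota r)) :=
  exists k (a : 'I_k -> M -> R) (Y : 'I_k -> forall p, E p),
    [/\ forall i, smooth_fun q (a i),
        forall i, sm (iota q) (Y i)
      & \forall r \near q, Z r = \sum_i a i r *: Y i (iota r)].

Definition pullback_connection (D : connection E)
    (Diota : connection (fun q => E (iota q))) :=
  is_connection smooth_along Diota /\
  forall q (v : tangent q) Y, sm (iota q) Y ->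
    Diota q v (fun r => Y (iota r)) = D (iota q) (tmap v) Y.

End Maps.

(* Endomorphisms of tangent spaces are matrices acting on row vectors. *)
Definition endo (R : realType) (n : nat) (M : manifold R n) (A : M -> 'M[R]_n)
    (q : M) (X : tangent q) : tangent q := X *m A q.

Definition symmetric_endo (R : realType) (n : nat) (M : manifold R n)
    (g : metric_tensor M) (A : M -> 'M[R]_n) :=
  forall (q : M) (X Y : tangent q), g q (endo A X) Y = g q X (endo A Y).

Section Hypersurface.
Context {R : realType} {Mb : manifold R 7} {M : manifold R 6}.
Variables (Sb : spin_data Mb) (iota : M -> Mb).
Variable V : forall q : M, tangent (iota q).

Definition unit_normal :=
  [/\ forall q, smooth_along (@smooth_vf _ _ Mb) q V,
      forall q, metric Sb (V q) (V q) = 1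
    & forall q (v : tangent q), metric Sb (V q) (tmap iota v) = 0].

(* The data induced on the hypersurface, for given Levi-Civita connection and
   spinorial connection of the hypersurface. *)
Definition induced_data (nab : connection (@tangent _ _ M))
    (snab : connection (fun q : M => spinor Sb (iota q))) : spin_data M :=
  {| metric := fun q v w => metric Sb (tmap iota v) (tmap iota w);
     positive := fun q e => positive Sb (iota q)
       (col_mx (\matrix_(i < 6) tmap iota (row i e : tangent q)) (V q)
         : 'M[R]_(6 + 1, 7));
     nabla := nab;
     spinor := fun q => spinor Sb (iota q);
     ssmooth := smooth_along (@ssmooth _ _ _ Sb);
     sprod := fun q => @sprod _ _ _ Sb (iota q);
     cmul := fun q X phi => cmul Sb (V q) (cmul Sb (tmap iota X) phi);
     snabla := snab |}.

Definition weingarten (S : spin_data M) (W : M -> 'M[R]_6) :=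
  symmetric_endo (metric S) W /\
  exists2 nablai, pullback_connection (@smooth_vf _ _ Mb) (nabla Sb) nablai &
    forall q (X : tangent q) Y, smooth_vf q Y ->
      nablai q X (fun r => tmap iota (Y r)) =
      tmap iota (nabla S X Y) + metric S (endo W X) (Y q) *: V q.

Definition restrict3 (T : form3 Mb) : form3 M :=
  fun q X Y Z => T (iota q) (tmap iota X) (tmap iota Y) (tmap iota Z).

End Hypersurface.

Section SU3.
Context {R : realType} {M : manifold R 6}.
Variables (S : spin_data M) (phi : forall q, spinor S q).

Definition complex_structure (J : M -> 'M[R]_6) :=
  forall q (X : tangent q),
    cmul S (endo J X) (phi q) = volume_mul (cmul S X (phi q)).

Definition psi_form : form3 M :=
  fun q X Y Z => - sprod S (cmul S X (cmul S Y (cmul S Z (phi q)))) (phi q).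

Definition type_three (J W3 : M -> 'M[R]_6) :=
  [/\ symmetric_endo (metric S) W3, forall q, \tr (W3 q) = 0
    & forall q, W3 q *m J q = - (J q *m W3 q)].

Definition L_form (mu : M -> R) (W3 : M -> 'M[R]_6) : form3 M :=
  fun q X Y Z =>
    - (psi_form (endo W3 X) Y Z +
       psi_form (endo W3 Y) Z X +
       psi_form (endo W3 Z) X Y)
    - mu q * psi_form X Y Z.

End SU3.

Arguments restrict3 {R Mb M} iota T q X Y Z : rename.

(* Main.v *)
(* The spinorial connection of the hypersurface is compared with the ambient one
   along it.  The two differ by a tensor [A] on the spinor fibres.  Both are
   metric and satisfy the Leibniz rule for the Clifford multiplication, and the
   derivative of the normal is [- W], so [A - 1/2 W.] is skew and commutes with
   the Clifford multiplication; since the commutant of Cl_6 on R^8 is R, it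
   vanishes, which is the spinorial Gauss formula
     Nb_X phi = N_X phi - 1/2 W(X).phi.
   As V _| Tb = 0, the 2-form X _| Tb acts on spinors like its restriction to
   the hypersurface.  Parts (2) and (3) follow at once, and part (1) reduces to
   the pointwise identity (X _| L).phi = - 2 W(X).phi.  The latter comes from
   expanding in the orthonormal basis (phi, V phi, e_1 phi, ..., e_6 phi) of
   the spinor fibre: for symmetric B,
     sum_{jk} psi(X, B e_j, e_k) e_j e_k phi
       = tr(B) X.phi - B(X).phi + (J B J X).phi,
   which is 4 X.phi for B = Id and 0 for B = W_3.
   Smoothness of L needs that of mu = tr(W) / 6 and of W, which is read off
   from the pullback connection in local frames. *)
Require Import Defs.
From mathcomp Require Import all_boot all_order all_algebra.
From mathcomp Require Import fingroup perm ring lra.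
From mathcomp Require Import all_classical all_reals all_analysis.
Import Order.TTheory GRing.Theory Num.Theory numFieldNormedType.Exports.
Set Implicit Arguments.
Unset Strict Implicit.
Unset Printing Implicit Defensive.
Local Open Scope classical_set_scope.
Local Open Scope ring_scope.

(** * Smooth maps between normed spaces *)

Section Calculus.
Context {R : realType}.
Implicit Types V W : normedModType R.

(** A section along the hypersurface is locally a finite sum of restricted ambient sections with
    coefficients on [M]. The normal [V] is only given in this form, so the Leibniz rules must pass
    from restrictions to such sums; [along_leibniz] does this for the metric and for Clifford
    multiplication alike. The difference [A] of the two spinor connections is then tested on the
    derivative of [V X s]: the ambient rule also differentiates [V], the rule of the hypersurface
    does not, and comparing them gives [[A, X.] = W(v) X + g(W(v), X)], which is the commutator of
    [1/2 W(v).] with [X.]. The commutant is computed by hand. Since [e_1 ... e_7 = - Id], the volume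
    element of [M] acts as [V]; an operator commuting with the Clifford multiplication of [M] thus
    commutes with seven anticommuting generators on a fibre of rank 8, where three explicit
    involutions suffice. Tangent vectors are coordinates in preferred charts that jump from point to
    point, so entries of vectors or of [W] carry no smoothness. Smoothness is always read in the
    coordinate fields of one fixed chart. *)

Lemma near_eq_differentiable V W (f g : V -> W) (x : V) :
  (\forall y \near x, f y = g y) -> differentiable f x -> differentiable g x.
Proof.
move=> fg df; have [dfc dfE] := (diff_locallyP _ _).1 df.
have dg : g \o shift x = cst (g x) + 'd f x +o_ 0 id.
  apply/eqaddoP => e e0; move/eqaddoP : dfE => /(_ e e0).
  have fgx := nbhs_singleton fg.
  apply: filter_app; near=> h; rewrite !fctE /= -fgx.
  suff -> : f (h + x) = g (h + x) by [].
  near: h; move: fg; rewrite (near_shift 0) => fg.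
  by apply: filterS fg => h /=; rewrite subr0.
by apply/diff_locallyP; rewrite (diff_unique dfc dg).
Unshelve. all: by end_near. Qed.

Lemma open_setI_preimage (S T : topologicalType) (U : set S) (f : S -> T)
    (O : set T) :
  open U -> (forall x, U x -> {for x, continuous f}) -> open O ->
  open (U `&` f @^-1` O).
Proof.
move=> oU cf oO; rewrite openE => x [Ux Ofx].
apply: filterI; first exact: open_nbhs_nbhs.
by apply: cf => //; apply: open_nbhs_nbhs.
Qed.

Lemma CdiffS V W k (U : set V) (f : V -> W) : Cdiff k.+1 U f -> Cdiff k U f.
Proof.
elim: k f => [|k IH] f [df Df]; first by move=> x Ux; exact/differentiable_continuous/df.
by split => // v; apply: IH; exact: Df.
Qed.

Lemma Cdiff_sub V W k (U U' : set V) (f : V -> W) :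
  U' `<=` U -> Cdiff k U f -> Cdiff k U' f.
Proof.
move=> U'U; elim: k f => [|k IH] f /=; first by move=> cf x /U'U; exact: cf.
by move=> [df Df]; split=> [x /U'U|v]; [exact: df | exact/IH/Df].
Qed.

Lemma Cdiff_ext V W k (U : set V) (f g : V -> W) :
  open U -> {in U, f =1 g} -> Cdiff k U f -> Cdiff k U g.
Proof.
move=> oU; elim: k f g => [|k IH] f g fg /=.
  move=> cf x Ux; have fgx : f x = g x by apply: fg; rewrite inE.
  rewrite /prop_for /continuous_at -fgx; apply: cvg_trans (cf x Ux).
  apply: near_eq_cvg; apply: filterS (open_nbhs_nbhs (conj oU Ux)) => y Uy.
  by apply: fg; rewrite inE.
move=> [df Df].
have nfg x : U x -> \forall y \near x, f y = g y.
  move=> Ux; apply: filterS (open_nbhs_nbhs (conj oU Ux)) => y Uy.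
  by apply: fg; rewrite inE.
split=> [x Ux|v]; first exact: near_eq_differentiable (nfg x Ux) (df x Ux).
apply: (IH ('D_v f)); last exact: Df.
by move=> x; rewrite inE => Ux; exact: near_eq_derive (nfg x Ux).
Qed.

Lemma Cdiff_cst V W k (U : set V) (w : W) : Cdiff k U (cst w).
Proof.
elim: k w => [|k IH] w /=; first by move=> x _; exact: cst_continuous.
split=> [x _|v]; first exact: differentiable_cst.
have -> : (fun x => 'D_v (cst w) x) = cst 0 by apply/funext => x; exact: derive_cst.
exact: IH.
Qed.

Lemma CdiffD V W k (U : set V) (f g : V -> W) :
  open U -> Cdiff k U f -> Cdiff k U g -> Cdiff k U (fun x => f x + g x).
Proof.
move=> oU; elim: k f g => [|k IH] f g /=.
  by move=> cf cg x Ux; apply: continuousD; [exact: cf | exact: cg].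
move=> [df Df] [dg Dg]; split=> [x Ux|v].
  by apply: differentiableD; [exact: df | exact: dg].
apply: (Cdiff_ext oU _ (IH _ _ (Df v) (Dg v))) => x; rewrite inE => Ux.
by rewrite -deriveD//; apply: diff_derivable; [exact: df | exact: dg].
Qed.

Lemma CdiffM V k (U : set V) (f g : V -> R^o) :
  open U -> Cdiff k U f -> Cdiff k U g ->
  Cdiff k U (fun x => f x * g x : R^o).
Proof.
move=> oU; elim: k f g => [|k IH] f g.
  by move=> cf cg x Ux; apply: continuousM; [exact: cf | exact: cg].
move=> Cf Cg; have [df Df] := Cf; have [dg Dg] := Cg; split=> [x Ux|v].
  by apply: differentiableM; [exact: df | exact: dg].
apply: (Cdiff_ext oU _ (CdiffD oU (IH _ _ (CdiffS Cf) (Dg v))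
   (IH _ _ (CdiffS Cg) (Df v)))) => x; rewrite inE => Ux.
by rewrite -deriveM//; apply: diff_derivable; [exact: df | exact: dg].
Qed.

Lemma CdiffV V k (U : set V) (f : V -> R^o) :
  open U -> (forall x, U x -> f x != 0) -> Cdiff k U f ->
  Cdiff k U (fun x => (f x)^-1 : R^o).
Proof.
move=> oU f0; elim: k => [|k IH].
  by move=> cf x Ux; apply: continuousV; [exact: f0 | exact: cf].
move=> Cf; have [df Df] := Cf; split=> [x Ux|v].
  by apply: differentiableV; [exact: df | exact: f0].
have CV := IH (CdiffS Cf).
(* The derivative is [- f^-1 f^-1 f']; the induction hypothesis, applied to [f] one order lower,
   supplies the two factors [f^-1]. *)
have := CdiffM oU (Cdiff_cst _ _ (-1 : R^o)) (CdiffM oU (CdiffM oU CV CV) (Df v)).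
apply: Cdiff_ext => // x; rewrite inE => Ux.
rewrite deriveV; [|exact: f0|exact/diff_derivable/df].
by rewrite /= /GRing.scale /= mulN1r mulNr expr2 invfM.
Qed.

Lemma differentiable_smooth V W (U : set V) (f : V -> W) x :
  smooth_on U f -> U x -> differentiable f x.
Proof. by move=> /(_ 1%N) [df _]; exact: df. Qed.

Lemma smooth_on_derive V W (U : set V) (f : V -> W) v :
  smooth_on U f -> smooth_on U ('D_v f).
Proof. by move=> sf k; have [_] := sf k.+1; exact. Qed.

Lemma derive_chain V W m (f : V -> 'rV[R]_m) (g : 'rV[R]_m -> W) x v :
  differentiable f x -> differentiable g (f x) ->
  'D_v (g \o f) x = 'D_('D_v f x) g (f x).
Proof.
move=> df dg; rewrite (deriveE _ dg) (deriveE _ df) deriveE.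
  by rewrite diff_comp.
exact: differentiable_comp.
Qed.

(** The chain rule split along the coordinates of the middle space: a finite sum of products, the
    shape that [CdiffM] and [Cdiff_sum] can treat in [smooth_on_comp]. *)
Lemma derive_comp V m W (f : V -> 'rV[R]_m) (g : 'rV[R]_m -> W) x v :
  differentiable f x -> differentiable g (f x) ->
  'D_v (g \o f) x = \sum_i 'D_v f x 0 i *: 'D_(delta_mx 0 i) g (f x).
Proof.
move=> df dg; rewrite deriveE; last exact: differentiable_comp.
rewrite diff_comp//= -(deriveE v df) {1}(row_sum_delta ('D_v f x)) linear_sum.
by apply: eq_bigr => i _; rewrite linearZ/= (deriveE _ dg).
Qed.

Lemma derive_entry V m n (f : V -> 'M[R]_(m, n)) x v i j : differentiable f x ->
  'D_v (fun y => f y i j : R) x = 'D_v f x i j.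
Proof.
move=> df; have dc := differentiable_comp df (differentiable_coord (f x) i j).
rewrite [LHS](deriveE v dc) (diff_comp df (differentiable_coord _ i j)) (deriveE v df).
have @c : {linear 'M[R]_(m, n) -> R}.
  by exists (fun N : 'M[R]_(_, _) => N i j); do 2![eexists]; do ?[constructor];
     rewrite ?mxE// => ? *; rewrite ?mxE//; move=> ?; rewrite !mxE.
have := @diff_lin _ _ _ c (f x) (@coord_continuous _ _ _ i j).
exact: (congr1 (fun h => h ('d f x v))).
Qed.

Lemma Cdiff_coord V m n k (U : set V) (f : V -> 'M[R]_(m, n)) i j :
  open U -> Cdiff k U f -> Cdiff k U (fun x => f x i j : R^o).
Proof.
move=> oU; elim: k f => [|k IH] f.
  move=> cf x Ux.
  apply: (@continuous_comp _ _ _ f (fun N : 'M[R]_(m, n) => N i j)); first exact: cf.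
  exact: coord_continuous.
move=> [df Df]; split=> [x Ux|v].
  exact: differentiable_comp (df x Ux) (differentiable_coord (f x) i j).
apply: (Cdiff_ext oU _ (IH _ (Df v))) => x; rewrite inE => Ux.
by rewrite [RHS](derive_entry v i j (df x Ux)).
Qed.

Lemma Cdiff_sum V n k (U : set V) (f : 'I_n -> V -> R^o) :
  open U -> (forall i, Cdiff k U (f i)) -> Cdiff k U (fun x => \sum_i f i x).
Proof.
move=> oU Cf; elim: n f Cf => [|n IH] f Cf.
  apply: Cdiff_ext oU _ (Cdiff_cst k U (0 : R^o)) => x _; by rewrite big_ord0.
have := CdiffD oU (IH (fun i => f (widen_ord (leqnSn n) i)) (fun i => Cf _)) (Cf ord_max).
by apply: Cdiff_ext => // x _; rewrite big_ord_recr.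
Qed.

(** The induction on the order varies [g]: each partial derivative of [g] is smooth again, so the
    induction hypothesis covers its composite with [f]. *)
Lemma smooth_on_comp V m (U : set V) (U' : set 'rV[R]_m) (f : V -> 'rV[R]_m)
    (g : 'rV[R]_m -> R^o) :
  open U -> (forall x, U x -> U' (f x)) -> smooth_on U f -> smooth_on U' g ->
  smooth_on U (g \o f).
Proof.
move=> oU UU' sf sg k; elim: k g sg => [|k IH] g sg.
  move=> x Ux; apply: continuous_comp; first exact: (sf 0).
  exact: (sg 0 _ (UU' x Ux)).
have df x : U x -> differentiable f x by exact: differentiable_smooth.
have dg x : U x -> differentiable g (f x).
  by move=> /UU'; exact: differentiable_smooth.
split=> [x Ux|v]; first exact: differentiable_comp (df x Ux) (dg x Ux).
have H i : Cdiff k U (fun x => 'D_v f x 0 i * ('D_(delta_mx 0 i) g \o f) x : R^o).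
  apply: (CdiffM oU); last exact/IH/smooth_on_derive.
  exact: (Cdiff_coord _ _ oU (smooth_on_derive v sf k)).
apply: (Cdiff_ext oU _ (Cdiff_sum oU H)) => x; rewrite inE => Ux.
by rewrite derive_comp//; [exact: df | exact: dg].
Qed.

End Calculus.

(** * Smooth functions on manifolds *)

Section Manifold.
Context {R : realType} {n : nat} {M : manifold R n}.
Implicit Types (c d : @chart R M n) (p q : M) (f g : M -> R).

Lemma atlas_chart c : atlas c -> is_chart c.
Proof. by case: M c => ? ? ? ? ? H ? ?; exact: H. Qed.

Lemma atlas_compatible c d : atlas c -> atlas d -> compatible c d.
Proof. by case: M c d => ? ? ? ? ? ? H ?; exact: H. Qed.

Lemma chart_at_atlas p : atlas (chart_at p).
Proof. by case: M p => ? ? ? ? ? ? ? H p; case: (H p). Qed.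

Lemma chart_at_dom p : cdom (chart_at p) p.
Proof. by case: M p => ? ? ? ? ? ? ? H p; case: (H p). Qed.

Definition overlap c d := cmap c @` (cdom c `&` cdom d).

Lemma overlapP c d : atlas c -> overlap c d = cimg c `&` cinv c @^-1` cdom d.
Proof.
move=> /atlas_chart [_ _ cK _ _]; apply/seteqP; split=> [_ [p [cp dp] <-]|x].
  by split; [exists p | rewrite /= cK].
by move=> [[p cp <-] /=]; rewrite cK// => dp; exists p.
Qed.

Lemma overlap_open c d : atlas c -> atlas d -> open (overlap c d).
Proof.
move=> ac /atlas_chart [od _ _ _ _]; rewrite overlapP//.
by have [_ oc _ _ cc] := atlas_chart ac; exact: open_setI_preimage.
Qed.

(** Smoothness read in a prescribed chart [c] instead of the preferred one. Statements on a
    neighbourhood need a chart that does not change with the point. *)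
Definition smooth_in c p f := exists U : set 'rV[R]_n,
  [/\ open U, U (cmap c p), U `<=` cimg c
    & smooth_on U (f \o cinv c : 'rV[R]_n -> R^o)].

Lemma nbhs_cinv c p (A : set M) : atlas c -> cdom c p -> nbhs p A ->
  \forall x \near cmap c p, A (cinv c x).
Proof.
move=> /atlas_chart [_ _ cK _ cc] cp nA.
have := cc (cmap c p) (ex_intro2 _ _ p cp erefl).
by rewrite /prop_for /continuous_at cK//; apply.
Qed.

Lemma nbhs_cmap c p (A : set 'rV[R]_n) : atlas c -> cdom c p ->
  nbhs (cmap c p) A -> \forall q \near p, A (cmap c q).
Proof. by move=> /atlas_chart [_ _ _ cc _] cp nA; exact: (cc p cp). Qed.

Lemma nbhs_cdom c p : atlas c -> cdom c p -> \forall q \near p, cdom c q.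
Proof. by move=> /atlas_chart [oc _ _ _ _] cp; exact: open_nbhs_nbhs. Qed.

Lemma nbhs_cimg c p : atlas c -> cdom c p -> nbhs (cmap c p) (cimg c).
Proof.
move=> /atlas_chart [_ oc _ _ _] cp.
by apply: open_nbhs_nbhs; split => //; exists p.
Qed.

Lemma cmapK c p : atlas c -> cdom c p -> cinv c (cmap c p) = p.
Proof. by move=> /atlas_chart [_ _ cK _ _]; exact: cK. Qed.

(** Read in [d], the function is its reading in [c] composed with the transition map, which is
    smooth on the image of the overlap. *)
Lemma smooth_in_chart c d p f : atlas c -> atlas d -> cdom c p -> cdom d p ->
  smooth_in c p f -> smooth_in d p f.
Proof.
move=> ac ad cp dp [U [oU Up Uc sf]].
have sdc := atlas_compatible ad ac.
have od := overlap_open ad ac.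
exists (overlap d c `&` (cmap c \o cinv d) @^-1` U); split.
- by apply: open_setI_preimage => // x ox; exact: (sdc 0 x ox).
- by split; [exists p | rewrite /= cmapK].
- by move=> _ [[q [dq cq] <-] _]; exists q.
have := @smooth_on_comp R _ _ (overlap d c `&` (cmap c \o cinv d) @^-1` U) U
  (cmap c \o cinv d) (f \o cinv c).
move=> H k; have := H _ _ _ _ k.
have oD : open (overlap d c `&` (cmap c \o cinv d) @^-1` U).
  by apply: open_setI_preimage => // x ox; exact: (sdc 0 x ox).
move=> /(_ oD (fun x => @proj2 _ _)) /(_ _ sf) HH.
apply: Cdiff_ext (HH _); [exact: oD| |].
  by move=> _ /set_mem [[q [dq cq] <-] _] /=; rewrite cmapK// cmapK.
by move=> j; apply: (Cdiff_sub _ (sdc j)) => x [].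
Qed.

Lemma smooth_funP c p f : atlas c -> cdom c p ->
  smooth_fun p f <-> smooth_in c p f.
Proof.
move=> ac cp; split; apply: smooth_in_chart => //;
  by [exact: chart_at_atlas | exact: chart_at_dom].
Qed.

(** The open set that works at [p] works at every nearby point, because the chart at [p] may replace
    the chart preferred there. *)
Lemma smooth_fun_near p f : smooth_fun p f -> \forall q \near p, smooth_fun q f.
Proof.
move=> [U [oU Up Uc sf]]; set c := chart_at p.
have ac : atlas c by exact: chart_at_atlas.
have cp : cdom c p by exact: chart_at_dom.
apply: filterS2 (nbhs_cdom ac cp) (nbhs_cmap ac cp (open_nbhs_nbhs (conj oU Up))).
by move=> q cq Uq; apply/(smooth_funP _ ac cq); exists U.
Qed.

Lemma near_eq_smooth_fun p f g :
  (\forall q \near p, f q = g q) -> smooth_fun p f -> smooth_fun p g.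
Proof.
have ac := chart_at_atlas p; have cp := chart_at_dom p.
move=> fg [U [oU Up Uc sf]].
have := nbhs_cinv ac cp fg; rewrite -nbhs_nearE nbhsE => -[B [oB Bp] BE].
exists (U `&` B); split=> //; first exact: openI.
  by move=> x [/Uc].
move=> k; apply: (Cdiff_ext (openI oU oB)); last first.
  by apply: Cdiff_sub (sf k) => x [].
by move=> x /set_mem [_ /BE].
Qed.

Lemma smooth_fun_cst p (a : R) : smooth_fun p (fun _ => a).
Proof.
exists (cimg (chart_at p)); have [_ oc _ _ _] := atlas_chart (chart_at_atlas p).
split=> //; first by exists p => //; exact: chart_at_dom.
by move=> k; exact: Cdiff_cst.
Qed.

Lemma smooth_fun2 (op : R -> R -> R) p f g :
  (forall (U : set 'rV[R]_n) (a b : 'rV[R]_n -> R^o), open U ->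
    smooth_on U a -> smooth_on U b -> smooth_on U (fun x => op (a x) (b x) : R^o)) ->
  smooth_fun p f -> smooth_fun p g -> smooth_fun p (fun q => op (f q) (g q)).
Proof.
move=> H [U [oU Up Uc sf]] [U' [oU' Up' Uc' sg]].
have o : open (U `&` U') by exact: openI.
exists (U `&` U'); split=> //; first by move=> x [/Uc].
by apply: H => // k; [apply: Cdiff_sub (sf k)|apply: Cdiff_sub (sg k)] => x [].
Qed.

Lemma smooth_funD p f g : smooth_fun p f -> smooth_fun p g ->
  smooth_fun p (fun q => f q + g q).
Proof. by apply: smooth_fun2 => U a b oU sa sb k; exact: CdiffD. Qed.

Lemma smooth_funM p f g : smooth_fun p f -> smooth_fun p g ->
  smooth_fun p (fun q => f q * g q).
Proof. by apply: smooth_fun2 => U a b oU sa sb k; exact: CdiffM. Qed.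

Lemma smooth_funN p f : smooth_fun p f -> smooth_fun p (fun q => - f q).
Proof.
move=> /(smooth_funM (smooth_fun_cst p (-1))); apply: near_eq_smooth_fun.
by apply: nearW => q; rewrite mulN1r.
Qed.

Lemma smooth_funB p f g : smooth_fun p f -> smooth_fun p g ->
  smooth_fun p (fun q => f q - g q).
Proof. by move=> sf /smooth_funN; exact: smooth_funD. Qed.

Lemma smooth_fun_sum (I : Type) (r : seq I) (P : pred I) p (F : I -> M -> R) :
  (forall i, smooth_fun p (F i)) -> smooth_fun p (fun q => \sum_(i <- r | P i) F i q).
Proof.
move=> sF; elim: r => [|i r IH].
  by apply: near_eq_smooth_fun (smooth_fun_cst p 0); apply: nearW => q; rewrite big_nil.
case Pi : (P i); last first.
  by apply: near_eq_smooth_fun IH; apply: nearW => q; rewrite big_cons Pi.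
by apply: near_eq_smooth_fun (smooth_funD (sF i) IH); apply: nearW => q; rewrite big_cons Pi.
Qed.

Lemma smooth_fun_prod (I : Type) (r : seq I) (P : pred I) p (F : I -> M -> R) :
  (forall i, smooth_fun p (F i)) -> smooth_fun p (fun q => \prod_(i <- r | P i) F i q).
Proof.
move=> sF; elim: r => [|i r IH].
  by apply: near_eq_smooth_fun (smooth_fun_cst p 1); apply: nearW => q; rewrite big_nil.
case Pi : (P i); last first.
  by apply: near_eq_smooth_fun IH; apply: nearW => q; rewrite big_cons Pi.
by apply: near_eq_smooth_fun (smooth_funM (sF i) IH); apply: nearW => q; rewrite big_cons Pi.
Qed.

Lemma smooth_fun_det k p (A : M -> 'M[R]_k) :
  (forall i j, smooth_fun p (fun q => A q i j)) -> smooth_fun p (fun q => \det (A q)).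
Proof.
move=> sA; apply: smooth_fun_sum => s; apply: smooth_funM; first exact: smooth_fun_cst.
by apply: smooth_fun_prod.
Qed.

Lemma smooth_fun_continuous p f : smooth_fun p f -> {for p, continuous f}.
Proof.
have ac := chart_at_atlas p; have cp := chart_at_dom p.
move=> [U [oU Up Uc sf]] A; rewrite -{1}(cmapK ac cp) => nA.
apply: filterS2 (nbhs_cdom ac cp) (nbhs_cmap ac cp (sf 0 _ Up _ nA)) => q cq /=.
by rewrite cmapK.
Qed.

Lemma smooth_funV p f : smooth_fun p f -> f p != 0 -> smooth_fun p (fun q => (f q)^-1).
Proof.
have ac := chart_at_atlas p; have cp := chart_at_dom p.
move=> [U [oU Up Uc sf]] fp0.
have oD : open (U `&` (f \o cinv (chart_at p)) @^-1` [set x | x != 0]).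
  by apply: open_setI_preimage; [exact: oU | exact: (sf 0) | exact: open_neq].
exists (U `&` (f \o cinv (chart_at p)) @^-1` [set x | x != 0]); split=> //.
- by split=> //=; rewrite cmapK.
- by move=> x [/Uc].
move=> k; apply: CdiffV => //; first by move=> x [].
by apply: Cdiff_sub (sf k) => x [].
Qed.

(** Cramer's rule: cofactors are determinants in the entries of [A], and [\det (A q)] stays nonzero
    near [p] by continuity. *)
Lemma smooth_fun_invmx k p (A : M -> 'M[R]_k) i j :
  (forall i j, smooth_fun p (fun q => A q i j)) -> A p \in unitmx ->
  smooth_fun p (fun q => invmx (A q) i j).
Proof.
move=> sA Ap; have sdet := smooth_fun_det sA.
have det0 : \det (A p) != 0 by rewrite -unitfE -unitmxE.
have sadj : smooth_fun p (fun q => (\adj (A q)) i j).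
  apply: (@near_eq_smooth_fun _ (fun q => (-1) ^+ (j + i) *
     \det (\matrix_(a, b) A q (lift j a) (lift i b)))).
    apply: nearW => q; rewrite mxE /cofactor; congr (_ * \det _).
    by apply/matrixP => a b; rewrite !mxE.
  apply: smooth_funM; first exact: smooth_fun_cst.
  apply: smooth_fun_det => a b; apply: near_eq_smooth_fun (sA (lift j a) (lift i b)).
  by apply: nearW => q; rewrite mxE.
apply: near_eq_smooth_fun (smooth_funM (smooth_funV sdet det0) sadj).
have near0 : \forall q \near p, \det (A q) != 0.
  exact: (smooth_fun_continuous sdet (open_nbhs_nbhs (conj (open_neq (y := 0)) det0))).
apply: filterS near0 => q dq; rewrite /invmx unitmxE unitfE dq.
by rewrite !mxE.
Qed.

End Manifold.

(** * Coordinate fields and smooth vector fields *)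

Section Fields.
Context {R : realType} {n : nat} {M : manifold R n}.
Implicit Types (c d : @chart R M n) (p q : M) (f g : M -> R).

Lemma differentiable_chart c p f : atlas c -> cdom c p -> smooth_fun p f ->
  differentiable (f \o cinv c : 'rV[R]_n -> R) (cmap c p).
Proof.
move=> ac cp /(smooth_funP _ ac cp) [U [oU Up Uc sf]].
exact: differentiable_smooth sf Up.
Qed.

Lemma dird_near_eq p (v : tangent p) f g :
  (\forall q \near p, f q = g q) -> dird v f = dird v g.
Proof.
move=> fg; apply: near_eq_derive.
exact: nbhs_cinv (chart_at_atlas p) (chart_at_dom p) fg.
Qed.

Lemma dird_linear p f : smooth_fun p f -> scalar (fun v : tangent p => dird v f).
Proof.
move=> sf a v w.
have df := differentiable_chart (chart_at_atlas p) (chart_at_dom p) sf.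
by rewrite /dird !deriveE// linearP.
Qed.

Lemma dird_cst p (v : tangent p) (a : R) : dird v (fun _ => a) = 0.
Proof. by rewrite /dird -[_ \o _]/(cst a) derive_cst. Qed.

Lemma dirdD p (v : tangent p) f g : smooth_fun p f -> smooth_fun p g ->
  dird v (fun q => f q + g q) = dird v f + dird v g.
Proof.
move=> sf sg; rewrite /dird -deriveD//; apply: diff_derivable.
  exact: differentiable_chart (chart_at_atlas p) (chart_at_dom p) sf.
exact: differentiable_chart (chart_at_atlas p) (chart_at_dom p) sg.
Qed.

Lemma dirdM p (v : tangent p) f g : smooth_fun p f -> smooth_fun p g ->
  dird v (fun q => f q * g q) = dird v f * g p + f p * dird v g.
Proof.
move=> sf sg.
have ac := chart_at_atlas p; have cp := chart_at_dom p.
have df := differentiable_chart ac cp sf; have dg := differentiable_chart ac cp sg.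
rewrite /dird [LHS](@deriveM _ _ (f \o cinv (chart_at p)) (g \o cinv (chart_at p))).
- by rewrite /= cmapK// /GRing.scale /= addrC [X in X + _ = _]mulrC.
- exact: diff_derivable df.
- exact: diff_derivable dg.
Qed.

Definition chart_coord c (i : 'I_n) : M -> R := fun q => cmap c q 0 i.

(** The field [d/dx_i] of [c]. Its value at [q] is pushed to the chart preferred at [q], because
    that is where tangent vectors at [q] have their coordinates. *)
Definition coord_field c (i : 'I_n) : forall q : M, tangent q := fun q =>
  'D_(delta_mx 0 i) (cmap (chart_at q) \o cinv c) (cmap c q).

Lemma differentiable_transition c d p : atlas c -> atlas d -> cdom c p -> cdom d p ->
  differentiable (cmap d \o cinv c) (cmap c p).
Proof.
move=> ac ad cp dp; apply: differentiable_smooth (atlas_compatible ac ad) _.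
by exists p.
Qed.

Lemma smooth_coord c i p : atlas c -> cdom c p -> smooth_fun p (chart_coord c i).
Proof.
move=> ac cp; apply/(smooth_funP _ ac cp); have [_ oc cK _ _] := atlas_chart ac.
exists (cimg c); split=> //; first by exists p.
have sid : smooth_on (cimg c) (id : 'rV[R]_n -> 'rV[R]_n).
  case=> [|k]; first by move=> x _; exact: cvg_id.
  split=> [x _|v]; first exact: (@ex_diff _ _ _ _ _ id id (is_diff_id x)).
  have -> : (fun x : 'rV[R]_n => 'D_v id x) = cst v by apply/funext => x; exact: derive_id.
  exact: Cdiff_cst.
move=> k; apply: (Cdiff_ext oc) (Cdiff_coord 0 i oc (sid k)) => x /set_mem.
by move=> [q cq <-]; rewrite /chart_coord /= cK.
Qed.

Lemma derive_coord c i p (v : tangent p) : atlas c -> cdom c p ->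
  dird v (chart_coord c i) = 'D_v (cmap c \o cinv (chart_at p)) (cmap (chart_at p) p) 0 i.
Proof.
move=> ac cp; have ap := chart_at_atlas p; have pp := chart_at_dom p.
have df := differentiable_transition ap ac pp cp.
exact: derive_entry.
Qed.

Lemma dird_coord_field c i p f : atlas c -> cdom c p -> smooth_fun p f ->
  dird (coord_field c i p) f = 'D_(delta_mx 0 i) (f \o cinv c) (cmap c p).
Proof.
move=> ac cp sf; have ap := chart_at_atlas p; have pp := chart_at_dom p.
have dt := differentiable_transition ac ap cp pp.
have E : (cmap (chart_at p) \o cinv c) (cmap c p) = cmap (chart_at p) p.
  by rewrite /= cmapK.
have df : differentiable (f \o cinv (chart_at p) : 'rV[R]_n -> R)
    ((cmap (chart_at p) \o cinv c) (cmap c p)).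
  by rewrite E; exact: differentiable_chart.
rewrite /dird /coord_field -E -(derive_chain _ dt df); apply: near_eq_derive.
by apply: filterS (nbhs_cinv ac cp (nbhs_cdom ap pp)) => x /= ?; rewrite cmapK.
Qed.

(** Passing from the preferred chart to [c] and back is the identity near the point; the chain rule
    for its derivative along [v] is the expansion. *)
Lemma tangent_expand c p (v : tangent p) : atlas c -> cdom c p ->
  v = \sum_i dird v (chart_coord c i) *: coord_field c i p.
Proof.
move=> ac cp; have ap := chart_at_atlas p; have pp := chart_at_dom p.
have dt := differentiable_transition ac ap cp pp.
have dt' := differentiable_transition ap ac pp cp.
have E : (cmap c \o cinv (chart_at p)) (cmap (chart_at p) p) = cmap c p.
  by rewrite /= cmapK.
rewrite -{1}(derive_id (cmap (chart_at p) p) v).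
transitivity ('D_v ((cmap (chart_at p) \o cinv c) \o (cmap c \o cinv (chart_at p)))
  (cmap (chart_at p) p)).
  apply: near_eq_derive.
  apply: filterS2 (nbhs_cimg ap pp) (nbhs_cinv ap pp (nbhs_cdom ac cp)).
  by move=> _ [q dq <-] /=; rewrite (cmapK ap dq) => cq; rewrite (cmapK ac cq).
rewrite -E in dt; rewrite (derive_comp v dt' dt); apply: eq_bigr => i _.
by rewrite (derive_coord _ _ ac cp) /coord_field E.
Qed.

Lemma dird_coord_coord_field c i j p : atlas c -> cdom c p ->
  dird (coord_field c i p) (chart_coord c j) = (i == j)%:R.
Proof.
move=> ac cp; rewrite dird_coord_field//; last exact: smooth_coord.
transitivity ('D_(delta_mx 0 i) (fun x : 'rV[R]_n => x 0 j : R) (cmap c p)).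
  apply: near_eq_derive; apply: filterS (nbhs_cimg ac cp).
  by move=> _ [q cq <-]; rewrite /chart_coord /= cmapK.
by rewrite (derive_entry _ _ _ (f := id)) ?derive_id ?mxE ?eqxx ?[j == i]eq_sym//.
Qed.

(** Read in [c], the derivative of [f] along this field is a partial derivative of [f \o cinv c] on
    a whole neighbourhood, hence smooth. *)
Lemma smooth_vf_coord_field c i p : atlas c -> cdom c p -> smooth_vf p (coord_field c i).
Proof.
move=> ac cp f sf; have [U [oU Up Uc sU]] := (smooth_funP _ ac cp).1 sf.
apply/(smooth_funP _ ac cp); exists U; split=> // k.
apply: (Cdiff_ext oU) (smooth_on_derive (delta_mx 0 i) sU k).
move=> x /set_mem Ux; have [q cq qx] := Uc x Ux; rewrite -{}qx in Ux *.
rewrite /= cmapK// dird_coord_field//; apply/(smooth_funP _ ac cq); by exists U.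
Qed.

Lemma near_eq_smooth_vf p (X Y : forall q : M, tangent q) :
  (\forall q \near p, X q = Y q) -> smooth_vf p X -> smooth_vf p Y.
Proof.
move=> XY sX f /sX; apply: near_eq_smooth_fun.
by apply: filterS XY => q ->.
Qed.

Lemma smooth_vf0 p : smooth_vf p (fun=> 0).
Proof.
move=> f _; apply: near_eq_smooth_fun (smooth_fun_cst p 0).
by apply: nearW => q; rewrite [RHS]derive0.
Qed.

Lemma smooth_vfD p (X Y : forall q : M, tangent q) :
  smooth_vf p X -> smooth_vf p Y -> smooth_vf p (fun q => X q + Y q).
Proof.
move=> sX sY f sf; apply: near_eq_smooth_fun (smooth_funD (sX f sf) (sY f sf)).
apply: filterS (smooth_fun_near sf) => q sq.
by have := dird_linear sq 1 (X q) (Y q); rewrite scale1r mul1r => ->.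
Qed.

Lemma smooth_vfZ p (a : M -> R) (X : forall q : M, tangent q) :
  smooth_fun p a -> smooth_vf p X -> smooth_vf p (fun q => a q *: X q).
Proof.
move=> sa sX f sf; apply: near_eq_smooth_fun (smooth_funM sa (sX f sf)).
apply: filterS (smooth_fun_near sf) => q sq.
have := dird_linear sq (a q) (X q) 0; rewrite addr0 => ->.
by rewrite [dird 0 f]derive0 addr0.
Qed.

Lemma smooth_vf_sum m p (a : 'I_m -> M -> R) (X : 'I_m -> forall q : M, tangent q) :
  (forall i, smooth_fun p (a i)) -> (forall i, smooth_vf p (X i)) ->
  smooth_vf p (fun q => \sum_i a i q *: X i q).
Proof.
elim: m a X => [|m IH] a X sa sX.
  by apply: near_eq_smooth_vf (@smooth_vf0 p); apply: nearW => q; rewrite big_ord0.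
have := smooth_vfD (IH (fun i => a (widen_ord (leqnSn m) i))
  (fun i => X (widen_ord (leqnSn m) i)) (fun i => sa _) (fun i => sX _))
  (smooth_vfZ (sa ord_max) (sX ord_max)).
by apply: near_eq_smooth_vf; apply: nearW => q; rewrite big_ord_recr.
Qed.

Lemma smooth_vf_expand p (X : forall q : M, tangent q) : smooth_vf p X ->
  exists2 a : 'I_n -> M -> R, forall i, smooth_fun p (a i) &
  \forall q \near p, X q = \sum_i a i q *: coord_field (chart_at p) i q.
Proof.
have ac := chart_at_atlas p; have cp := chart_at_dom p.
move=> sX; exists (fun i q => dird (X q) (chart_coord (chart_at p) i)).
  by move=> i; apply: sX; exact: smooth_coord.
by apply: filterS (nbhs_cdom ac cp) => q cq; exact: tangent_expand.
Qed.

(** Not immediate from the definition: a test function smooth at a nearby [q] need not be smooth at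
    [p]. The expansion in the coordinate fields of the chart at [p], with coefficients smooth near
    [p], gets around this. *)
Lemma smooth_vf_near p (X : forall q : M, tangent q) : smooth_vf p X ->
  \forall q \near p, smooth_vf q X.
Proof.
have ac := chart_at_atlas p; have cp := chart_at_dom p.
move=> /smooth_vf_expand [a sa Xa].
have na : \forall q \near p, forall i, smooth_fun q (a i).
  by apply: filter_forall => i; exact/smooth_fun_near/sa.
have nX : \forall q \near p, \forall r \near q, X r = \sum_i a i r *: coord_field (chart_at p) i r.
  exact: nbhs_interior.
apply: filterS3 na nX (nbhs_cdom ac cp) => q sq Xq cq.
apply: near_eq_smooth_vf (_ : smooth_vf q (fun r => \sum_i a i r *: coord_field (chart_at p) i r)).
  by apply: filterS Xq => r ->.
by apply: smooth_vf_sum => // i; exact: smooth_vf_coord_field.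
Qed.

End Fields.

(** * Sections, connections and maps *)

Section Sections.
Context {R : realType} {n : nat} {M : manifold R n}.
Variables (E : M -> lmodType R) (sm : M -> (forall q, E q) -> Prop).

(** What the calculus uses of smooth sections: a module over functions, insensitive to changes away
    from the point. Bundles with local frames, sections along a map and real functions are
    instances. *)
Definition section_module := forall p,
  [/\ sm p (fun=> 0),
      forall s t, sm p s -> sm p t -> sm p (fun q => s q + t q),
      forall a s, smooth_fun p a -> sm p s -> sm p (fun q => a q *: s q)
    & forall s t : forall q, E q, (\forall q \near p, s q = t q) -> sm p s -> sm p t].

Lemma section_module_sum p k (a : 'I_k -> M -> R) (s : 'I_k -> forall q, E q) :
  section_module -> (forall i, smooth_fun p (a i)) -> (forall i, sm p (s i)) ->
  sm p (fun q => \sum_i a i q *: s i q).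
Proof.
move=> H; have [s0 sD sZ sE] := H p; elim: k a s => [|k IH] a s sa ss.
  by apply: (sE _ _ _ s0); apply: nearW => q; rewrite big_ord0.
have := sD _ _ (IH (fun i => a (widen_ord (leqnSn k) i))
  (fun i => s (widen_ord (leqnSn k) i)) (fun i => sa _) (fun i => ss _))
  (sZ _ _ (sa ord_max) (ss ord_max)).
by apply: sE; apply: nearW => q; rewrite big_ord_recr.
Qed.

Definition local_frame k (p : M) (s : 'I_k -> forall q, E q) :=
  \forall q \near p,
    (forall x : E q, exists! a : 'rV[R]_k, x = \sum_i a 0 i *: s i q) /\
    (forall sigma : forall q, E q, sm q sigma <->
       exists a : 'I_k -> M -> R, (forall i, smooth_fun q (a i)) /\
         \forall r \near q, sigma r = \sum_i a i r *: s i r).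

Lemma vector_bundle_module k : vector_bundle sm k -> section_module.
Proof.
move=> vb p; have [s /nbhs_singleton [_ H]] := vb p; split.
- apply/H; exists (fun _ _ => 0); split=> [i|]; first exact: smooth_fun_cst.
  by apply: nearW => q; rewrite big1// => i _; rewrite scale0r.
- move=> x y /H [a [sa xa]] /H [b [sb yb]]; apply/H.
  exists (fun i q => a i q + b i q); split=> [i|]; first exact: smooth_funD.
  apply: filterS2 xa yb => q -> ->; rewrite -big_split.
  by apply: eq_bigr => i _; rewrite scalerDl.
- move=> f x sf /H [a [sa xa]]; apply/H.
  exists (fun i q => f q * a i q); split=> [i|]; first exact: smooth_funM.
  apply: filterS xa => q ->; rewrite scaler_sumr.
  by apply: eq_bigr => i _; rewrite scalerA.
- move=> x y xy /H [a [sa xa]]; apply/H; exists a; split=> //.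
  by apply: filterS2 xy xa => q <-.
Qed.

Lemma local_frame_smooth k p (s : 'I_k -> forall q, E q) i :
  local_frame p s -> sm p (s i).
Proof.
move=> /nbhs_singleton [_ H]; apply/H; exists (fun j _ => (i == j)%:R).
split=> [j|]; first exact: smooth_fun_cst.
apply: nearW => q; rewrite (bigD1 i)//= eqxx scale1r big1 ?addr0// => j.
by rewrite eq_sym => /negbTE ->; rewrite scale0r.
Qed.

Section Connection.
Variables (D : connection E) (HD : is_connection sm D) (Hsm : section_module).

Lemma connection_near_eq p (v : tangent p) (s t : forall q, E q) :
  sm p s -> sm p t -> (\forall q \near p, s q = t q) -> D v s = D v t.
Proof.
move=> ss st; case: HD => _ _ HL _; rewrite -nbhs_nearE => st_near.
(* [smooth_fun] is a local condition, so an indicator function replaces the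
   usual bump function. *)
pose f q : R := `[< s q = t q >]%:R.
have sf : smooth_fun p f.
  apply: near_eq_smooth_fun (smooth_fun_cst p 1).
  by apply: filterS st_near => q stq; rewrite /f asboolT.
have f1 : f p = 1 by rewrite /f asboolT//; exact: nbhs_singleton st_near.
have d0 : dird v f = 0.
  rewrite -(dird_cst v 1); apply: dird_near_eq.
  by apply: filterS st_near => q stq; rewrite /f asboolT.
have fst : (fun q => f q *: s q) = (fun q => f q *: t q).
  apply: functional_extensionality_dep => q; rewrite /f.
  by case: asboolP => [->//|_]; rewrite !scale0r.
have := HL p v f s sf ss; rewrite fst HL// d0 f1 !scale0r !add0r !scale1r.
by move=> ->.
Qed.

Lemma connection_sum p (v : tangent p) k (a : 'I_k -> M -> R) (s : 'I_k -> forall q, E q) :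
  (forall i, smooth_fun p (a i)) -> (forall i, sm p (s i)) ->
  D v (fun q => \sum_i a i q *: s i q) =
  \sum_i (dird v (a i) *: s i p + a i p *: D v (s i)).
Proof.
have [s0 sD sZ sE] := Hsm p; have [_ HA HL _] := HD.
elim: k a s => [|k IH] a s sa ss.
  (* The empty sum: the Leibniz rule with the zero function shows that the zero section has
     derivative zero. *)
  rewrite big_ord0; have E0 := HL p v _ _ (smooth_fun_cst p 0) s0.
  rewrite dird_cst !scale0r add0r in E0; rewrite -[RHS]E0.
  congr (D v _); apply: functional_extensionality_dep => q.
  by rewrite big_ord0 scale0r.
rewrite big_ord_recr /= -IH// -HL// -HA.
- congr (D v _); apply: functional_extensionality_dep => q.
  by rewrite big_ord_recr.
- exact: section_module_sum.
- exact: sZ.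
Qed.

End Connection.
End Sections.

(** * The differential of a map and sections along it *)

Section Maps.
Context {R : realType} {m n : nat} {M : manifold R m} {N : manifold R n}.
Variables (iota : M -> N) (Hiota : smooth_map iota).

Lemma near_iota q (A : set N) : nbhs (iota q) A -> \forall r \near q, A (iota r).
Proof. by move=> nA; exact: (Hiota.1 q _ nA). Qed.

Lemma differentiable_map q :
  differentiable (cmap (chart_at (iota q)) \o iota \o cinv (chart_at q))
    (cmap (chart_at q) q).
Proof. by have [U [oU Uq _ sU]] := Hiota.2 q; exact: differentiable_smooth sU Uq. Qed.

Lemma tmap_linear q : linear (@tmap R m n M N iota q).
Proof.
by move=> a v w; rewrite /tmap !(deriveE _ (@differentiable_map q)) linearP.
Qed.

Lemma dird_tmap q (v : tangent q) (f : N -> R) : smooth_fun (iota q) f ->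
  dird (tmap iota v) f = dird v (f \o iota).
Proof.
move=> sf; have aq := chart_at_atlas q; have dq := chart_at_dom q.
have ad := chart_at_atlas (iota q); have dd := chart_at_dom (iota q).
have E : (cmap (chart_at (iota q)) \o iota \o cinv (chart_at q)) (cmap (chart_at q) q)
  = cmap (chart_at (iota q)) (iota q) by rewrite /= cmapK.
have df : differentiable (f \o cinv (chart_at (iota q)) : 'rV[R]_n -> R)
   ((cmap (chart_at (iota q)) \o iota \o cinv (chart_at q)) (cmap (chart_at q) q)).
  by rewrite E; exact: differentiable_chart.
rewrite /dird /tmap -E -(derive_chain v (@differentiable_map q) df).
apply: near_eq_derive.
apply: filterS (nbhs_cinv aq dq (near_iota (nbhs_cdom ad dd))) => x /= dx.
by rewrite cmapK.
Qed.

Lemma smooth_fun_comp q (f : N -> R) :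
  smooth_fun (iota q) f -> smooth_fun q (f \o iota).
Proof.
have aq := chart_at_atlas q; have dq := chart_at_dom q.
have ad := chart_at_atlas (iota q); have dd := chart_at_dom (iota q).
have [U [oU Uq Uc sU]] := Hiota.2 q.
move=> [U' [oU' Uq' Uc' sf]].
have := nbhs_cinv aq dq (near_iota (nbhs_cdom ad dd)).
rewrite -nbhs_nearE nbhsE => - [B [oB Bq] BE].
pose F := (cmap (chart_at (iota q)) \o iota) \o cinv (chart_at q).
have oD : open ((U `&` F @^-1` U') `&` B).
  apply: openI => //; apply: open_setI_preimage => // x Ux; exact: (sU 0).
exists ((U `&` F @^-1` U') `&` B); split=> //.
- by split=> //; split=> //; rewrite /F /= cmapK.
- by move=> x [[/Uc]].
have := @smooth_on_comp R _ _ ((U `&` F @^-1` U') `&` B) U' F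
  (f \o cinv (chart_at (iota q))) oD _ _ sf.
move=> H k; apply: (Cdiff_ext oD) (H _ _ k).
- by move=> x /set_mem [_ /BE] dx; rewrite /F /= cmapK.
- by move=> x [[_ ?] _].
- by move=> j; apply: Cdiff_sub (sU j) => x [[]].
Qed.

Section Along.
Variables (E : N -> lmodType R) (sm : N -> (forall p, E p) -> Prop).
Local Notation along := (@smooth_along R m n M N iota E sm).

Lemma smooth_along_pull q Y : sm (iota q) Y -> along q (fun r => Y (iota r)).
Proof.
move=> sY; exists 1%N, (fun _ _ => 1), (fun _ => Y); split=> //.
  by move=> _; exact: smooth_fun_cst.
by apply: nearW => r; rewrite big_ord1 scale1r.
Qed.

Lemma smooth_along_module : section_module along.
Proof.
move=> q; split.
- exists 0%N, (fun _ _ => 0), (fun _ _ => 0); split; [by case | by case |].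
  by apply: nearW => r; rewrite big_ord0.
- move=> s t [k [a [Y [sa sY sE]]]] [l [b [Z [sb sZ tE]]]].
  exists (k + l)%N,
    (fun i : 'I_(k + l) => match fintype.split i with inl j => a j | inr j => b j end),
    (fun i : 'I_(k + l) => match fintype.split i with inl j => Y j | inr j => Z j end); split.
  + by move=> i; case: (fintype.split i).
  + by move=> i; case: (fintype.split i).
  + apply: filterS2 sE tE => r -> ->; rewrite big_split_ord /=; congr (_ + _).
      by apply: eq_bigr => i _; rewrite -[lshift _ _]/(unsplit (inl i)) unsplitK.
    by apply: eq_bigr => i _; rewrite -[rshift _ _]/(unsplit (inr i)) unsplitK.
- move=> f s sf [k [a [Y [sa sY sE]]]].
  exists k, (fun i q => f q * a i q), Y; split=> //.
    by move=> i; exact: smooth_funM.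
  apply: filterS sE => r ->; rewrite scaler_sumr.
  by apply: eq_bigr => i _; rewrite scalerA.
- move=> s t st [k [a [Y [sa sY sE]]]]; exists k, a, Y; split=> //.
  by apply: filterS2 st sE => r <-.
Qed.

(** Sections along [iota] are generated by restrictions under sums, multiples by functions on [M]
    and local changes. Each closure clause may assume its sections smooth, as the Leibniz rules
    require. *)
Lemma smooth_along_ind q (P : (forall r, E (iota r)) -> Prop) :
  P (fun=> 0) ->
  (forall Z1 Z2, along q Z1 -> along q Z2 -> P Z1 -> P Z2 -> P (fun r => Z1 r + Z2 r)) ->
  (forall a Z, smooth_fun q a -> along q Z -> P Z -> P (fun r => a r *: Z r)) ->
  (forall Z1 Z2, along q Z1 -> along q Z2 -> (\forall r \near q, Z1 r = Z2 r) -> P Z1 -> P Z2) ->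
  (forall Y, sm (iota q) Y -> P (fun r => Y (iota r))) ->
  forall Z, along q Z -> P Z.
Proof.
move=> P0 PD PZ PE PY Z sZ; have [k [a [Y [sa sY ZE]]]] := sZ.
(* Stated for arbitrary reindexed subfamilies, so that smoothness of all partial sums survives the
   induction on [k]. *)
have sS l (i : 'I_l -> 'I_k) : along q (fun r => \sum_j a (i j) r *: Y (i j) (iota r)).
  apply: (section_module_sum (s := fun j r => Y (i j) (iota r)) smooth_along_module) => // j.
  exact: smooth_along_pull.
apply: (PE (fun r => \sum_i a i r *: Y i (iota r))) => //.
  by apply: filterS ZE => r ->.
elim: k a Y sa sY {ZE} sS => [|k IH] a Y sa sY sS.
  rewrite (_ : (fun r => _) = (fun=> 0))//.
  by apply: functional_extensionality_dep => r; rewrite big_ord0.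
rewrite (_ : (fun r => _) = (fun r => \sum_i a (widen_ord (leqnSn k) i) r *:
    Y (widen_ord (leqnSn k) i) (iota r) + a ord_max r *: Y ord_max (iota r))); last first.
  by apply: functional_extensionality_dep => r; rewrite big_ord_recr.
apply: PD.
- exact: (sS _ (widen_ord (leqnSn k))).
- have [_ _ sZ' _] := smooth_along_module q; apply: (sZ' _ (fun r => Y ord_max (iota r))) => //.
  exact: smooth_along_pull.
- by apply: (IH (fun i => a (widen_ord (leqnSn k) i))
    (fun i => Y (widen_ord (leqnSn k) i))) => // l i;
    exact: (sS _ (fun j => widen_ord (leqnSn k) (i j))).
- apply: (PZ _ (fun r => Y ord_max (iota r))) => //; first exact: smooth_along_pull.
  exact: PY.
Qed.

End Along.

(** In the coordinate fields of an ambient chart, the coefficients are [X] applied to the coordinate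
    functions composed with [iota]. *)
Lemma smooth_along_tmap q (X : forall r : M, tangent r) : smooth_vf q X ->
  smooth_along (@smooth_vf R n N) q (fun r => tmap iota (X r)).
Proof.
move=> sX; have ad := chart_at_atlas (iota q); have dd := chart_at_dom (iota q).
exists n, (fun i r => dird (X r) (chart_coord (chart_at (iota q)) i \o iota)),
  (coord_field (chart_at (iota q))); split.
- by move=> i; apply: sX; apply: smooth_fun_comp; exact: smooth_coord.
- by move=> i; exact: smooth_vf_coord_field.
apply: filterS (near_iota (nbhs_cdom ad dd)) => r dr.
rewrite [LHS](tangent_expand _ ad dr); apply: eq_bigr => i _.
by rewrite dird_tmap//; exact: smooth_coord.
Qed.

End Maps.

(** * Clifford algebra on a fibre *)

Section LinearMaps.
Context {R : pzRingType} {U V : lmodType R} (f : U -> V).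
Hypothesis lf : linear f.

Lemma lin0 : f 0 = 0.
Proof. by have := lf (-1) 0 0; rewrite scaler0 addr0 scaleN1r addNr. Qed.

Lemma linD x y : f (x + y) = f x + f y.
Proof. by have := lf 1 x y; rewrite !scale1r. Qed.

Lemma linZ a x : f (a *: x) = a *: f x.
Proof. by have := lf a x 0; rewrite !addr0 lin0 addr0. Qed.

Lemma linN x : f (- x) = - f x.
Proof. by rewrite -scaleN1r linZ scaleN1r. Qed.

Lemma linB x y : f (x - y) = f x - f y.
Proof. by rewrite linD linN. Qed.

Lemma lin_sum (I : Type) (r : seq I) (P : pred I) (x : I -> U) :
  f (\sum_(i <- r | P i) x i) = \sum_(i <- r | P i) f (x i).
Proof. by elim/big_rec2: _ => [|i y z _ <-]; [exact: lin0 | rewrite linD]. Qed.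

End LinearMaps.

Section Inner.
Context {R : realType} {F : lmodType R}.

Definition inner_product (h : F -> F -> R) :=
  [/\ forall y, scalar (h^~ y), forall x y, h x y = h y x
    & forall x, x != 0 -> 0 < h x x].

Definition is_basis k (s : 'I_k -> F) :=
  forall x : F, exists! a : 'rV[R]_k, x = \sum_i a 0 i *: s i.

Variable h : F -> F -> R.
Hypothesis hh : inner_product h.

Lemma innerC x y : h x y = h y x. Proof. by case: hh. Qed.

Lemma inner_linl y : linear (h^~ y : F -> R^o). Proof. by case: hh => H _ _; exact: H. Qed.

Lemma inner_linr y : linear (h y : F -> R^o).
Proof. by move=> a u v; rewrite !(innerC y); exact: inner_linl. Qed.

Lemma inner0l y : h 0 y = 0. Proof. exact: lin0 (inner_linl y). Qed.
Lemma innerDl x y z : h (x + y) z = h x z + h y z. Proof. exact: linD (inner_linl z) _ _. Qed.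
Lemma innerDr x y z : h x (y + z) = h x y + h x z. Proof. exact: linD (inner_linr x) _ _. Qed.
Lemma innerNl x y : h (- x) y = - h x y. Proof. exact: linN (inner_linl y) _. Qed.
Lemma innerNr x y : h x (- y) = - h x y. Proof. exact: linN (inner_linr x) _. Qed.
Lemma innerZl a x y : h (a *: x) y = a * h x y. Proof. exact: linZ (inner_linl y) _ _. Qed.
Lemma innerZr a x y : h x (a *: y) = a * h x y. Proof. exact: linZ (inner_linr x) _ _. Qed.
Lemma inner_suml (I : Type) (r : seq I) (P : pred I) (x : I -> F) y :
  h (\sum_(i <- r | P i) x i) y = \sum_(i <- r | P i) h (x i) y.
Proof. exact: (lin_sum (inner_linl y) r P x). Qed.
Lemma inner_sumr (I : Type) (r : seq I) (P : pred I) (x : I -> F) y :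
  h y (\sum_(i <- r | P i) x i) = \sum_(i <- r | P i) h y (x i).
Proof. exact: (lin_sum (inner_linr y) r P x). Qed.

Lemma inner_eq0 x : h x x = 0 -> x = 0.
Proof.
case: hh => _ _ hpos; case: (eqVneq x 0) => // x0 hx0.
by have := hpos x x0; rewrite hx0 ltxx.
Qed.

Lemma normalize x : x != 0 -> exists2 a : R, a != 0 & h (a *: x) (a *: x) = 1.
Proof.
case: hh => _ _ hpos x0; have hx := hpos x x0.
exists (Num.sqrt (h x x))^-1; first by rewrite invr_eq0 gt_eqF// sqrtr_gt0.
rewrite innerZl innerZr mulrA -invfM -expr2 sqr_sqrtr ?ltW//.
by rewrite mulVf// gt_eqF.
Qed.

Lemma orthonormal_expand k (s b : 'I_k -> F) x :
  is_basis s -> (forall i j, h (b i) (b j) = (i == j)%:R) ->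
  x = \sum_i h x (b i) *: b i.
Proof.
move=> bs ob.
pose crd y : 'rV[R]_k := xget 0 [set a : 'rV[R]_k | y = \sum_i a 0 i *: s i].
have crdE y : y = \sum_i crd y 0 i *: s i.
  by rewrite /crd; case: xgetP => [a _ //|H]; have [a [ya _]] := bs y; case: (H a).
pose C : 'M[R]_k := \matrix_(i, j) crd (b i) 0 j.
pose G : 'M[R]_k := \matrix_(i, j) h (s i) (s j).
(* Orthonormality of [b] in terms of the basis [s]; it makes the square coordinate matrix [C]
   invertible, so the [k] vectors [b] span. *)
have CGC : C *m (G *m C^T) = 1%:M.
  apply/matrixP => i j; rewrite mxE -[RHS]/((1%:M : 'M[R]_k) i j) [RHS]mxE -ob.
  rewrite [b i]crdE [b j in RHS]crdE inner_suml; apply: eq_bigr => u _.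
  rewrite innerZl inner_sumr !mxE; congr (_ * _); apply: eq_bigr => v _.
  by rewrite innerZr !mxE mulrC.
have Cu : C \in unitmx by have [] := mulmx1_unit CGC.
pose y := crd x *m invmx C.
have xE : x = \sum_i y 0 i *: b i.
  have yC : y *m C = crd x by rewrite mulmxKV.
  rewrite [LHS]crdE -yC.
  under [RHS]eq_bigr => i _ do rewrite [b i]crdE scaler_sumr.
  rewrite exchange_big; apply: eq_bigr => j _.
  rewrite mxE scaler_suml; apply: eq_bigr => i _.
  by rewrite [C i j]mxE scalerA.
rewrite {1}xE; apply: eq_bigr => i _; congr (_ *: _).
rewrite {1}xE inner_suml (bigD1 i)//= innerZl ob eqxx mulr1 big1 ?addr0// => j ji.
by rewrite innerZl ob (negbTE ji) mulr0.
Qed.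

(** Expand the first [f i] in the frame [e], move the coefficient to the second slot, and resum
    there the expansion of [e a] in the frame [f]. *)
Lemma trace_indep (G : lmodType R) k (e f : 'I_k -> F) (B : F -> F -> G) :
  (forall i j, h (e i) (e j) = (i == j)%:R) ->
  (forall x, x = \sum_i h x (e i) *: e i) ->
  (forall x, x = \sum_i h x (f i) *: f i) ->
  (forall x, linear (B x)) -> (forall y, linear (B^~ y)) ->
  \sum_i B (f i) (f i) = \sum_i B (e i) (e i).
Proof.
move=> oe ee ef Bl Br.
under eq_bigr => i _ do rewrite {1}[f i]ee (lin_sum (Br (f i))).
rewrite exchange_big; apply: eq_bigr => a _.
under eq_bigr => i _ do rewrite (linZ (Br _)) -(linZ (Bl _)) innerC.
by rewrite -(lin_sum (Bl _)) -ef.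
Qed.

End Inner.

Lemma addrr_eq0 (R : realType) (x : R) : x + x = 0 -> x = 0.
Proof. by move/eqP; rewrite -mulr2n mulrn_eq0 => /eqP. Qed.

(** * Seven Clifford generators on a space of dimension eight *)

Section Clifford7.
Context {R : realType} {F : lmodType R} (h : F -> F -> R) (c : 'I_7 -> F -> F).
Variable s : 'I_8 -> F.
Hypotheses (hh : inner_product h) (bs : is_basis s).
Hypotheses (clin : forall i, linear (c i))
  (cskew : forall i x y, h (c i x) y = - h x (c i y))
  (csq : forall i x, c i (c i x) = - x)
  (cac : forall i j x, i != j -> c i (c j x) = - c j (c i x)).

Lemma skew_diag (f : F -> F) : (forall x y, h (f x) y = - h x (f y)) ->
  forall x, h (f x) x = 0.
Proof.
by move=> fs x; apply: addrr_eq0; rewrite {1}fs (innerC hh) addNr.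
Qed.

(** Skewness makes each [c i u] orthogonal to [u], and anticommutation makes the [c i u] orthogonal
    to each other: these are eight orthonormal vectors in rank 8. *)
Lemma clifford_expand u x : h u u = 1 ->
  x = h x u *: u + \sum_i h x (c i u) *: c i u.
Proof.
move=> u1.
pose b (i : 'I_8) := if unlift ord0 i is Some j then c j u else u.
have ob i j : h (b i) (b j) = (i == j)%:R.
  rewrite /b; case: (unliftP ord0 i) => [k ->|->]; case: (unliftP ord0 j) => [l ->|->].
  - rewrite (inj_eq lift_inj); case: eqVneq => [->|kl].
      by rewrite cskew csq (innerNr hh) opprK.
    apply: addrr_eq0; rewrite {1}cskew cac// (innerNr hh) opprK.
    by rewrite -[h u _]opprK -cskew (innerC hh) addNr.
  - by rewrite eq_sym (negbTE (neq_lift _ _)) skew_diag.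
  - by rewrite (negbTE (neq_lift _ _)) (innerC hh) skew_diag.
  - by rewrite eqxx.
rewrite {1}(orthonormal_expand hh x bs ob) big_ord_recl /b unlift_none.
by congr (_ + _); apply: eq_bigr => i _; rewrite liftK.
Qed.

(** For distinct indices a product of three generators is symmetric and squares to [+1] (a product
    of two squares to [-1]). It commutes with its own generators and anticommutes with the other
    four. *)
Let P (t : 'I_7 * 'I_7 * 'I_7) x := c t.1.1 (c t.1.2 (c t.2 x)).
Let dist (t : 'I_7 * 'I_7 * 'I_7) := [&& t.1.1 != t.1.2, t.1.1 != t.2 & t.1.2 != t.2].

Let PD t x y : P t (x + y) = P t x + P t y. Proof. by rewrite /P !(linD (clin _)). Qed.

Let Pout t l x : l != t.1.1 -> l != t.1.2 -> l != t.2 -> P t (c l x) = - c l (P t x).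
Proof.
move=> l1 l2 l3; rewrite /P (cac _ (i := t.2)) 1?eq_sym// !(linN (clin _)).
rewrite (cac _ (i := t.1.2)) 1?eq_sym// !(linN (clin _)).
by rewrite (cac _ (i := t.1.1)) 1?eq_sym// !opprK.
Qed.

Let Pin t l x : dist t -> l \in [:: t.1.1; t.1.2; t.2] -> P t (c l x) = c l (P t x).
Proof.
case: t => [[i j] k] /and3P[/= ij ik jk]; rewrite /P /= !inE => /or3P[]/eqP->.
- by rewrite (cac _ (i := k)) 1?eq_sym// (linN (clin _)) (cac _ (i := j)) 1?eq_sym// opprK.
- by rewrite (cac x (i := k)) 1?eq_sym// [RHS]cac 1?eq_sym// !(csq, linN (clin _)).
- by rewrite [RHS]cac 1?eq_sym// [c k (c j _)]cac 1?eq_sym// !(csq, linN (clin _)) !opprK.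
Qed.

Let Psq t x : dist t -> P t (P t x) = x.
Proof.
case: t => [[i j] k] dt; have [/= ij ik jk] := and3P dt.
rewrite /P /= [c k (c i _)]cac 1?eq_sym// [c k (c j _)]cac 1?eq_sym// !(linN (clin _)).
by rewrite [c j (c i _)]cac 1?eq_sym// !(csq, linN (clin _), opprK).
Qed.

(** Any two triples share exactly one index. The orderings put it first where [PP] needs it: 0 of
    [P1] lies in [P2], 1 of [P3] lies in [P1], 3 of [P2] lies in [P3]. *)
Let P1 : 'I_7 * 'I_7 * 'I_7 := (inord 0, inord 1, inord 2).
Let P2 : 'I_7 * 'I_7 * 'I_7 := (inord 3, inord 0, inord 4).
Let P3 : 'I_7 * 'I_7 * 'I_7 := (inord 1, inord 3, inord 5).

(** Moving [P t] past the three generators of [P u] costs no sign at the shared index and one sign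
    at each of the two others. *)
Let PP t u x : dist t -> [&& u.1.1 \in [:: t.1.1; t.1.2; t.2],
   u.1.2 \notin [:: t.1.1; t.1.2; t.2] & u.2 \notin [:: t.1.1; t.1.2; t.2]] ->
  P t (P u x) = P u (P t x).
Proof.
move=> dt /and3P[u1]; rewrite !inE !negb_or => /and3P[a1 a2 a3] /and3P[b1 b2 b3].
by rewrite [P u x]/P (Pin _ dt)// Pout// Pout// !(linN (clin _)) opprK.
Qed.

Let Psym t x y : dist t -> h (P t x) y = h x (P t y).
Proof.
case: t => [[i j] k] /and3P[/= ij ik jk]; rewrite /P /= !cskew opprK.
rewrite [c j (c i _)]cac 1?eq_sym// [c k (- _)](linN (clin _)) (innerNr hh) opprK.
rewrite [c k (c i _)]cac 1?eq_sym// [c k (c j _)]cac 1?eq_sym//.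
by rewrite !(linN (clin _)) opprK.
Qed.

Let eig t x := exists2 e : R, e != 0 & P t x = e *: x.

(** The vectors [x + P t x] and [x - P t x] cannot both vanish. A nonzero one is an eigenvector of
    the involution [P t], and it keeps the eigenvalues that [x] has for operators commuting with
    [P t]. *)
Let refine_eigenvector t (ts : seq ('I_7 * 'I_7 * 'I_7)) x : dist t -> x != 0 ->
  (forall u, u \in ts -> (forall y, P t (P u y) = P u (P t y)) /\ eig u x) ->
  exists2 y, y != 0 & forall u, u \in t :: ts -> eig u y.
Proof.
move=> dt x0 H.
have ZP u a y : P u (a *: y) = a *: P u y by rewrite /P !(linZ (clin _)).
have K (e : R) : e * e = 1 -> forall u, u \in t :: ts -> eig u (x + e *: P t x).
  move=> ee u; rewrite inE => /predU1P[->|uts].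
    exists e; first by apply/eqP => e0; move/eqP: ee; rewrite e0 mul0r eq_sym oner_eq0.
    by rewrite PD ZP Psq// scalerDr scalerA ee scale1r addrC.
  have [com [a a0 Pux]] := H u uts; exists a => //.
  by rewrite PD ZP -com Pux ZP scalerDr !scalerA mulrC.
case: (eqVneq (x + 1 *: P t x) 0) => [z0|]; last first.
  by exists (x + 1 *: P t x) => //; apply: K; rewrite mulr1.
exists (x + (-1) *: P t x); last by apply: K; rewrite mulrNN mulr1.
move/eqP: z0; rewrite scale1r addrC addr_eq0 => /eqP ->.
by rewrite scaleN1r opprK -mulr2n -scaler_nat scaler_eq0 negb_or pnatr_eq0.
Qed.

(* The three commuting involutions [e_0 e_1 e_2], [e_3 e_0 e_4] and
   [e_1 e_3 e_5] have a common eigenvector [u].  No index occurs in all three,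
   so [A u], which is an eigenvector with the same eigenvalues, is orthogonal
   to every [e_i u]; by skewness it is orthogonal to [u] too. *)
Lemma commutant_skew (A : F -> F) : linear A ->
  (forall x y, h (A x) y = - h x (A y)) -> (forall i x, A (c i x) = c i (A x)) ->
  forall x, A x = 0.
Proof.
move=> lA sA cA.
have d1 : dist P1 by rewrite /dist /= -!val_eqE /= !inordK.
have d2 : dist P2 by rewrite /dist /= -!val_eqE /= !inordK.
have d3 : dist P3 by rewrite /dist /= -!val_eqE /= !inordK.
have c21 y : P P2 (P P1 y) = P P1 (P P2 y).
  by apply: PP => //; rewrite !inE /= -!val_eqE /= !inordK.
have c13 y : P P1 (P P3 y) = P P3 (P P1 y).
  by apply: PP => //; rewrite !inE /= -!val_eqE /= !inordK.
have c32 y : P P3 (P P2 y) = P P2 (P P3 y).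
  by apply: PP => //; rewrite !inE /= -!val_eqE /= !inordK.
have s0 : s ord0 != 0.
  apply/eqP => s0; have [a [_ au]] := bs 0.
  have a0 : a = 0 by apply: au; rewrite big1// => i _; rewrite mxE scale0r.
  have : a = delta_mx 0 ord0.
    apply: au; rewrite (bigD1 ord0)//= s0 scaler0 big1 ?addr0// => i i0.
    by rewrite mxE (negbTE i0) andbF scale0r.
  by rewrite a0 => /matrixP/(_ 0 ord0); rewrite !mxE !eqxx => /eqP; rewrite eq_sym oner_eq0.
have [x1 x10 E1] := refine_eigenvector (ts := [::]) d1 s0 (fun u h0 => False_ind _ (notF h0)).
have [x2 x20 E2] : exists2 y, y != 0 & forall u, u \in [:: P2; P1] -> eig u y.
  apply: refine_eigenvector d2 x10 _ => u u1; split; last exact: E1.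
  by move: u1; rewrite inE => /eqP -> y; exact: c21.
have [x3 x30 E3] : exists2 y, y != 0 & forall u, u \in [:: P3; P2; P1] -> eig u y.
  apply: refine_eigenvector d3 x20 _ => u u1; split; last exact: E2.
  by move: u1; rewrite !inE => /orP[]/eqP -> y; [exact: c32 | rewrite c13].
have [a a0 uu] := normalize hh x30; set u := a *: x3 in uu.
have Eu t : t \in [:: P3; P2; P1] -> eig t u.
  move=> /E3 [e e0 Pt]; exists e => //.
  have -> : P t u = a *: P t x3 by rewrite /P !(linZ (clin _)).
  by rewrite Pt !scalerA mulrC.
have PA t x : P t (A x) = A (P t x) by rewrite /P !cA.
(* With [e] the eigenvalue, [e * h (A u) (c i u)] is computed in two ways, [P t] being symmetric,
   commuting with [A] and anticommuting with [c i]; the results are opposite. *)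
have orth t i : t \in [:: P3; P2; P1] -> dist t ->
    i \notin [:: t.1.1; t.1.2; t.2] -> h (A u) (c i u) = 0.
  move=> /Eu [e e0 Pt] dt; rewrite !inE !negb_or => /and3P[i1 i2 i3].
  apply: addrr_eq0; apply: (mulfI e0); rewrite mulr0 mulrDr.
  rewrite -{1}(innerZr hh) -(linZ (clin i)) -Pt -[X in _ + X](innerZl hh).
  rewrite -(linZ lA) -Pt -PA Psym// Pout// (innerNr hh).
  have -> : c i (P t u) = - P t (c i u) by rewrite Pout// opprK.
  by rewrite (innerNr hh) opprK addNr.
have Au : A u = 0.
  rewrite (clifford_expand (A u) uu) skew_diag// scale0r add0r big1// => i _.
  suff -> : h (A u) (c i u) = 0 by rewrite scale0r.
  case: (boolP (i \in [:: P1.1.1; P1.1.2; P1.2])) => [|H]; last first.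
    by apply: orth H; rewrite ?inE ?eqxx ?orbT.
  (* An index of [P1] needs another triple that avoids it: 0 is not in [P3], while 1 and 2 are not
     in [P2]. *)
  rewrite !inE => /or3P[]/eqP ->.
  - by apply: (orth P3) => //; rewrite !inE ?eqxx ?orbT//= -!val_eqE /= !inordK.
  - by apply: (orth P2) => //; rewrite !inE ?eqxx ?orbT//= -!val_eqE /= !inordK.
  - by apply: (orth P2) => //; rewrite !inE ?eqxx ?orbT//= -!val_eqE /= !inordK.
(* As [A] commutes with the generators, [A u = 0] forces [A] to vanish on the whole basis [u],
   [c i u]. *)
move=> x; rewrite (clifford_expand x uu) (linD lA) (linZ lA) (lin_sum lA) Au scaler0 add0r.
by rewrite big1// => i _; rewrite (linZ lA) cA Au (lin0 (clin i)) scaler0.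
Qed.

End Clifford7.

(** * Clifford modules and the action of 2-forms *)

Section CliffordModule.
Context {R : realType} {T F : lmodType R}.
Variables (g : T -> T -> R) (h : F -> F -> R) (m : T -> F -> F).

Definition clifford_module :=
  [/\ inner_product g, inner_product h,
      (forall x, linear (m^~ x)) /\ (forall X, linear (m X)),
      (forall X x, m X (m X x) = - g X X *: x)
    & (forall X x y, h (m X x) y = - h x (m X y))].

Hypothesis cm : clifford_module.
Let hg : inner_product g. Proof. by case: cm. Qed.
Let hh : inner_product h. Proof. by case: cm. Qed.
Let ml x : linear (m^~ x). Proof. by case: cm => _ _ []. Qed.
Let mr X : linear (m X). Proof. by case: cm => _ _ []. Qed.

Lemma mul_skew X x y : h (m X x) y = - h x (m X y).
Proof. by case: cm. Qed.

Lemma mul_skew0 X x : h (m X x) x = 0.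
Proof. by apply: (skew_diag hh); exact: mul_skew. Qed.

Lemma mul_anticomm X Y x : m X (m Y x) = - m Y (m X x) - (2 * g X Y) *: x.
Proof.
have [_ _ _ msq _] := cm.
have := msq (X + Y) x; rewrite !(linD (ml _)) !(linD (mr _)) !msq.
rewrite (innerDl hg) !(innerDr hg) (innerC hg Y X) => H.
apply: (addIr (m Y (m X x) + (- g X X *: x + - g Y Y *: x))).
rewrite [RHS]addrACA addNr add0r.
rewrite [- g X X *: x + m X _]addrC -addrA [- g X X *: x + _]addrCA in H.
rewrite H -!scaleNr -!scalerDl.
by congr (_ *: _); rewrite [-2 *: g X Y]mulNr; ring.
Qed.

(** For distinct indices both [w] and the Clifford product change sign under exchange, so each term
    is symmetric; the diagonal vanishes. Unlike the ordered sum, the full double sum is a trace in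
    each index. *)
Lemma form2_skew_sum n (e : 'I_n -> T) (w : T -> T -> R) x :
  (forall i j, g (e i) (e j) = (i == j)%:R) -> (forall X Y, w X Y = - w Y X) ->
  \sum_i \sum_j w (e i) (e j) *: m (e i) (m (e j) x) =
  2 *: \sum_(i < n) \sum_(j < n | (i < j)%N) w (e i) (e j) *: m (e i) (m (e j) x).
Proof.
move=> oe ws; pose a i j := w (e i) (e j) *: m (e i) (m (e j) x).
have w0 X : w X X = 0 by apply: addrr_eq0; rewrite {1}ws addNr.
have aC i j : i != j -> a i j = a j i.
  move=> ij; rewrite /a mul_anticomm oe (negbTE ij) mulr0 scale0r subr0.
  by rewrite ws scaleNr scalerN opprK.
have split i : \sum_j a i j =
    \sum_(j < n | (i < j)%N) a i j + \sum_(j < n | (j < i)%N) a j i.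
  rewrite (bigID (fun j : 'I_n => (i < j)%N)) /=; congr (_ + _).
  rewrite (bigID (fun j : 'I_n => (j < i)%N)) /= [X in _ + X]big1 ?addr0; last first.
    move=> j /andP[]; rewrite -!leqNgt => ij ji.
    by rewrite (_ : j = i) ?/a ?w0 ?scale0r//; apply/val_inj/eqP; rewrite eqn_leq ij.
  apply: eq_big => [j|j /andP[_ ji]]; last by apply: aC; rewrite -val_eqE gtn_eqF.
  by rewrite -leqNgt andb_idl// => /ltnW.
rewrite (eq_bigr _ (fun i _ => split i)) big_split /= [X in _ + X](exchange_big_dep xpredT) //=.
by rewrite -mulr2n -scaler_nat.
Qed.

(** The frame is changed in one index at a time, each change being an instance of [trace_indep]. *)
Lemma form2_frame_indep n (e f : 'I_n -> T) (w : T -> T -> R) x :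
  (forall i j, g (e i) (e j) = (i == j)%:R) ->
  (forall X, X = \sum_i g X (e i) *: e i) ->
  (forall X, X = \sum_i g X (f i) *: f i) ->
  (forall Y, scalar (w^~ Y)) -> (forall X Y, w X Y = - w Y X) ->
  \sum_i \sum_j w (f i) (f j) *: m (f i) (m (f j) x) =
  \sum_i \sum_j w (e i) (e j) *: m (e i) (m (e j) x).
Proof.
move=> oe ee ff wl ws.
have wr X : scalar (w X).
  by move=> a u v; rewrite !(ws X) wl opprD mulrN.
have inner X : \sum_j w X (f j) *: m X (m (f j) x) = \sum_j w X (e j) *: m X (m (e j) x).
  apply: (trace_indep hg (B := fun Y Y' => w X Y *: m X (m Y' x)) oe ee ff) => Y a u v.
    by rewrite (ml x a u v) (mr X) scalerDr !scalerA mulrC.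
  by rewrite wr scalerDl scalerA.
rewrite (eq_bigr _ (fun i _ => inner (f i))).
apply: (trace_indep hg (B := fun X X' => \sum_j w X (e j) *: m X' (m (e j) x)) oe ee ff).
  move=> X a u v; rewrite scaler_sumr -big_split; apply: eq_bigr => j _ /=.
  by rewrite (ml (m (e j) x) a u v) scalerDr !scalerA mulrC.
move=> X a u v; rewrite scaler_sumr -big_split; apply: eq_bigr => j _ /=.
by rewrite wl scalerDl scalerA.
Qed.

(** [psi_form] on a single fibre, so that the SU(3) identities become pure linear algebra. *)
Definition psi_of (phi : F) X Y Z := - h (m X (m Y (m Z phi))) phi.

Lemma psi_of_linear phi Y Z : scalar (fun X => psi_of phi X Y Z).
Proof.
by move=> a u v; rewrite /psi_of (ml (m Y (m Z phi)) a u v) (innerDl hh) (innerZl hh) opprD mulrN.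
Qed.

(** The term by which [X] and [Y] fail to anticommute is a multiple of [h (m Z phi) phi], which is
    zero by skewness. *)
Lemma psi_ofC12 phi X Y Z : psi_of phi X Y Z = - psi_of phi Y X Z.
Proof.
rewrite /psi_of mul_anticomm (innerDl hh) !(innerNl hh) (innerZl hh).
by rewrite mul_skew0 mulr0 oppr0 addr0.
Qed.

Lemma psi_ofC23 phi X Y Z : psi_of phi X Y Z = - psi_of phi X Z Y.
Proof.
rewrite /psi_of (mul_anticomm Y) (linB (mr X)) (linN (mr X)) (linZ (mr X)).
rewrite (innerDl hh) !(innerNl hh) (innerZl hh).
by rewrite mul_skew0 mulr0 oppr0 addr0.
Qed.

Lemma psi_of_linear2 phi X Z : scalar (fun Y => psi_of phi X Y Z).
Proof. by move=> a u v; rewrite !(psi_ofC12 phi X) psi_of_linear opprD -mulrN. Qed.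

Lemma psi_of_linear3 phi X Y : scalar (psi_of phi X Y).
Proof. by move=> a u v; rewrite !(psi_ofC23 phi X Y) psi_of_linear2 opprD -mulrN. Qed.

End CliffordModule.

(** * Algebra of an SU(3)-structure on one fibre *)

Section SU3Algebra.
Context {R : realType} {T F : lmodType R}.
Variables (g : T -> T -> R) (h : F -> F -> R) (m : T -> F -> F).
Hypothesis cm : clifford_module g h m.
Let hg : inner_product g. Proof. by case: cm. Qed.
Let hh : inner_product h. Proof. by case: cm. Qed.
Let ml x : linear (m^~ x). Proof. by case: cm => _ _ []. Qed.
Let mr X : linear (m X). Proof. by case: cm => _ _ []. Qed.
Let mC := mul_anticomm cm.

Variables (s : 'I_8 -> F) (e : 'I_6 -> T) (j : F -> F) (phi : F) (J : T -> T).
Hypotheses (bs : is_basis s) (oe : forall i k, g (e i) (e k) = (i == k)%:R)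
  (ee : forall X, X = \sum_i g X (e i) *: e i)
  (jl : linear j) (js : forall x y, h (j x) y = - h x (j y))
  (jj : forall x, j (j x) = - x) (jm : forall X x, j (m X x) = - m X (j x))
  (phi1 : h phi phi = 1) (Jl : linear J)
  (Jphi : forall X, m (J X) phi = j (m X phi)).

(** [j] anticommutes with the six [e k] and squares to [-1], so it completes them to seven
    generators, with index 0. *)
Let gen (i : 'I_7) := if unlift ord0 i is Some k then m (e k) else j.

Lemma generators :
  [/\ forall i, linear (gen i), forall i x y, h (gen i x) y = - h x (gen i y),
    forall i x, gen i (gen i x) = - x
    & forall i k x, i != k -> gen i (gen k x) = - gen k (gen i x)].
Proof.
have [_ _ _ msq msk] := cm; rewrite /gen; split.
- by move=> i; case: (unlift _ _) => [k|]; [exact: mr | exact: jl].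
- by move=> i x y; case: (unlift _ _) => [k|]; [exact: msk | exact: js].
- move=> i x; case: (unlift _ _) => [k|]; last exact: jj.
  by rewrite msq oe eqxx scaleN1r.
- move=> i k x; case: (unliftP ord0 i) => [a ->|->]; case: (unliftP ord0 k) => [b ->|->] ik.
  + rewrite mC oe (inj_eq lift_inj) in ik *.
    by rewrite (negbTE ik) mulr0 scale0r subr0.
  + by rewrite jm opprK.
  + by rewrite jm.
  + by rewrite eqxx in ik.
Qed.

Lemma spinor_expand x :
  x = h x phi *: phi + (h x (j phi) *: j phi + \sum_k h x (m (e k) phi) *: m (e k) phi).
Proof.
have [gl gs gsq gac] := generators.
rewrite {1}(clifford_expand hh bs gs gsq gac x phi1) big_ord_recl /gen unlift_none.
by congr (_ + (_ + _)); apply: eq_bigr => i _; rewrite liftK.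
Qed.

Lemma commutant_trivial (A : F -> F) : linear A ->
  (forall x y, h (A x) y = - h x (A y)) -> (forall X x, A (m X x) = m X (A x)) ->
  (forall x, A (j x) = j (A x)) -> forall x, A x = 0.
Proof.
have [gl gs gsq gac] := generators.
move=> lA sA cA cj; apply: (commutant_skew hh bs gl gs gsq gac lA sA) => i x.
by rewrite /gen; case: (unlift _ _) => [k|]; [exact: cA | exact: cj].
Qed.

Lemma mul_phi_inner X Y : h (m X phi) (m Y phi) = g X Y.
Proof.
have := congr1 (fun x => h x phi) (mC X Y phi).
rewrite (innerDl hh) !(innerNl hh) (innerZl hh) phi1 mulr1.
rewrite (mul_skew cm X) (mul_skew cm Y (m X phi)).
by rewrite (innerC hh (m Y phi)) => H; lra.
Qed.

(** [X |-> m X phi] is isometric and carries [J] to [j], whose square is [-1]. *)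
Lemma JJ X : J (J X) = - X.
Proof.
apply/eqP; rewrite -addr_eq0; apply/eqP/(inner_eq0 hg).
rewrite -mul_phi_inner (linD (ml _)) !Jphi jj addNr.
exact: inner0l.
Qed.

Lemma J_skew X Y : g (J X) Y = - g X (J Y).
Proof. by rewrite -!mul_phi_inner !Jphi js. Qed.

Local Notation psi := (psi_of h m phi).

(** Up to sign the [psi X Y (e k)] are the components of [m Y (m X phi)] along [m (e k) phi]. The
    right side is what the components along [phi] and [j phi] leave over. *)
Lemma sum_psi1 X Y : \sum_k psi X Y (e k) *: m (e k) phi =
  - m Y (m X phi) - g X Y *: phi + h (m Y (m X phi)) (j phi) *: j phi.
Proof.
have E k : psi X Y (e k) = - h (m Y (m X phi)) (m (e k) phi).
  by rewrite /psi_of (mul_skew cm X) (mul_skew cm Y) opprK (innerC hh).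
under eq_bigr do rewrite E scaleNr; rewrite sumrN.
have := spinor_expand (m Y (m X phi)).
rewrite [h _ phi](mul_skew cm) mul_phi_inner addrA; set S := \sum_k _ => H.
have -> : S = m Y (m X phi) - (- g X Y *: phi + h (m Y (m X phi)) (j phi) *: j phi).
  by rewrite {1}H [RHS]addrC addKr.
by rewrite opprB addrC addrA scaleNr.
Qed.

Section SymmetricEndo.
Variable B : T -> T.
Hypothesis (Bs : forall X Y, g (B X) Y = g X (B Y)).

Lemma symmetric_trace (G : lmodType R) (K : T -> T -> G) :
  (forall X, linear (K X)) -> (forall Y, linear (K^~ Y)) ->
  \sum_i K (e i) (B (e i)) = \sum_i K (B (e i)) (e i).
Proof.
move=> Kl Kr.
under eq_bigr => i _ do rewrite [B _]ee (lin_sum (Kl (e i))).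
under [RHS]eq_bigr => i _ do rewrite [B _]ee (lin_sum (Kr (e i))).
rewrite exchange_big; apply: eq_bigr => i _; apply: eq_bigr => k _.
by rewrite (linZ (Kl _)) (linZ (Kr _)) Bs (innerC hg).
Qed.

(** By symmetry of [B] the two factors may be exchanged; by anticommutation the exchange costs a
    sign and twice the trace. *)
Lemma sum_mul_symmetric y :
  \sum_i m (e i) (m (B (e i)) y) = - (\sum_i g (B (e i)) (e i)) *: y.
Proof.
have sw : \sum_i m (e i) (m (B (e i)) y) = \sum_i m (B (e i)) (m (e i) y).
  by apply: (symmetric_trace (K := fun X Y => m X (m Y y))) => X a u v;
     rewrite ?(ml y a u v) ?(ml (m X y) a u v) ?(mr X).
have : \sum_i m (e i) (m (B (e i)) y) = - \sum_i m (B (e i)) (m (e i) y)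
     - \sum_i (2 * g (B (e i)) (e i)) *: y.
  rewrite -sumrN -sumrB; apply: eq_bigr => i _; rewrite mC (innerC hg (e i)).
  by [].
rewrite -sw -scaler_suml -mulr_sumr; set u := \sum_i _; set G := \sum_i _ => H.
have H2 : 2 *: u = 2 *: (- G *: y).
  by rewrite scaler_nat mulr2n {1}H addrAC addNr add0r scalerA mulrN scaleNr.
have := congr1 (fun z => 2^-1 *: z) H2.
by rewrite !scalerA mulrA mulVf ?pnatr_eq0// mul1r scale1r.
Qed.

(** Multiply [sum_psi1], taken at [Y = B (e i)], by [e i] and sum. The first term gives the trace by
    [sum_mul_symmetric]; the two others resum to [B X] and, through [j], to [J (B (J X))]. *)
Lemma sum_psi2 X :
  \sum_i \sum_k psi X (B (e i)) (e k) *: m (e i) (m (e k) phi) =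
  (\sum_i g (B (e i)) (e i)) *: m X phi - m (B X) phi + m (J (B (J X))) phi.
Proof.
have E i : \sum_k psi X (B (e i)) (e k) *: m (e i) (m (e k) phi) =
    - m (e i) (m (B (e i)) (m X phi)) - g (B X) (e i) *: m (e i) phi
    - g (B (J X)) (e i) *: m (e i) (j phi).
  under eq_bigr do rewrite -(linZ (mr _)).
  rewrite -(lin_sum (mr _)) sum_psi1 (linD (mr _)) (linB (mr _)) (linN (mr _)) !(linZ (mr _)) Bs.
  congr (_ - _ + _); rewrite -scaleNr; congr (_ *: _).
  rewrite (mul_skew cm) -[m _ (j phi)]opprK -jm (innerNr hh) opprK -[LHS]opprK.
  by rewrite -js -Jphi mul_phi_inner Bs.
rewrite (eq_bigr _ (fun i _ => E i)) !big_split /= !sumrN sum_mul_symmetric scaleNr opprK.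
congr (_ - _ + _).
  under eq_bigr do rewrite -(linZ (ml phi)).
  by rewrite -(lin_sum (ml phi)) -ee.
under eq_bigr do rewrite -(linZ (ml (j phi))).
by rewrite -(lin_sum (ml (j phi))) -ee -jm Jphi.
Qed.

(** After renaming the indices the two signs, from [psi] and from the Clifford product, cancel. The
    diagonal corrections add up to a multiple of the sum [t0], which pairs the symmetric [B] with a
    skew form. *)
Lemma sum_psi3 X :
  \sum_i \sum_k psi X (e i) (B (e k)) *: m (e i) (m (e k) phi) =
  \sum_i \sum_k psi X (B (e i)) (e k) *: m (e i) (m (e k) phi).
Proof.
have t0 : \sum_i psi X (B (e i)) (e i) = 0.
  apply: addrr_eq0; rewrite -{1}(symmetric_trace (G := R^o) (K := psi X)).
  - by rewrite -big_split big1// => i _; rewrite /= (psi_ofC23 cm) addNr.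
  - by move=> Y; exact: (psi_of_linear3 cm).
  - by move=> Y; exact: (psi_of_linear2 cm).
have E i k : psi X (e i) (B (e k)) *: m (e i) (m (e k) phi) =
   psi X (B (e k)) (e i) *: m (e k) (m (e i) phi) +
   (i == k)%:R *: (2 * psi X (B (e i)) (e i)) *: phi.
  rewrite (psi_ofC23 cm); case: (eqVneq i k) => [<-|ik].
    have [_ _ _ msq _] := cm; rewrite msq oe eqxx -[true%:R]/1%:R; move: (psi _ _ _) => p.
    by rewrite scale1r !scalerA -scalerDl; congr (_ *: _); rewrite mulr1n; ring.
  move: (psi _ _ (e i)) (psi _ _ _) => p p'.
  rewrite mC oe (negbTE ik) mulr0 !scale0r subr0 addr0 scaleNr scalerN opprK.
  by [].
under eq_bigr => i _ do under eq_bigr => k _ do rewrite E.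
under eq_bigr do rewrite big_split /=; rewrite big_split /=.
rewrite exchange_big [X in _ + X](_ : _ = 0) ?addr0//.
under eq_bigr => i _.
  rewrite (bigD1 i)//= eqxx scale1r big1 ?addr0; last first.
    by move=> k ki; rewrite eq_sym (negbTE ki) scale0r scale0r.
  over.
by rewrite -scaler_suml -mulr_sumr t0 mulr0 scale0r.
Qed.

End SymmetricEndo.

(** [4 = 6 - 1 - 1]: the trace of the identity, [- X], and [J (J X) = - X]. *)
Lemma sum_psi X :
  \sum_i \sum_k psi X (e i) (e k) *: m (e i) (m (e k) phi) = 4 *: m X phi.
Proof.
rewrite (sum_psi2 (B := id))//; under eq_bigr do rewrite oe eqxx.
rewrite big_const_ord iter_addr_0 JJ (linN (ml _)) -addrA -mulr2n -[_ *+ 2]scaler_nat.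
rewrite -scaleN1r scalerA -scalerDl; congr (_ *: _).
by rewrite mulr1n; ring.
Qed.

Variable W3 : T -> T.
Hypotheses (W3l : linear W3) (W3s : forall X Y, g (W3 X) Y = g X (W3 Y))
  (W3J : forall X, W3 (J X) = - J (W3 X)).

(** The vectors [J (e i)] form another orthonormal frame, and the trace computed in it is the
    opposite because [W3] anticommutes with [J]. *)
Lemma trace_anticomm : \sum_i g (W3 (e i)) (e i) = 0.
Proof.
apply: addrr_eq0.
have ef X : X = \sum_i g X (J (e i)) *: J (e i).
  rewrite -[LHS]opprK -(JJ X) {1}[J X]ee (lin_sum Jl) -sumrN; apply: eq_bigr => i _.
  by rewrite (linZ Jl) J_skew scaleNr opprK.
rewrite -{1}(trace_indep hg (G := R^o) (B := fun X Y => g (W3 X) Y) oe ee ef).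
- rewrite -big_split big1// => i _ /=.
  by rewrite W3J (innerNl hg) J_skew JJ (innerNr hg) opprK addNr.
- by move=> X; exact: (inner_linr hg).
- by move=> Y a u v; rewrite W3l; exact: (inner_linl hg).
Qed.

(** Of the three cyclic terms only the one with [W3] on [X] survives: with [W3] in another slot,
    [sum_psi2] yields [- W3 X + J (W3 (J X)) = 0]. The surviving term and the one with [mu] each
    contribute [- 4]. *)
Lemma sum_torsion mu X :
  \sum_i \sum_k (- (psi (W3 X) (e i) (e k) + psi (W3 (e i)) (e k) X + psi (W3 (e k)) X (e i))
     - mu * psi X (e i) (e k)) *: m (e i) (m (e k) phi) =
  - 4 *: m (mu *: X + W3 X) phi.
Proof.
have psi2 : \sum_i \sum_k psi X (W3 (e i)) (e k) *: m (e i) (m (e k) phi) = 0.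
  rewrite (sum_psi2 W3s) trace_anticomm scale0r sub0r W3J (linN Jl) JJ opprK.
  by rewrite addNr.
have E i k : (- (psi (W3 X) (e i) (e k) + psi (W3 (e i)) (e k) X + psi (W3 (e k)) X (e i))
     - mu * psi X (e i) (e k)) *: m (e i) (m (e k) phi) =
  - (psi (W3 X) (e i) (e k) *: m (e i) (m (e k) phi))
  - (psi X (W3 (e i)) (e k) *: m (e i) (m (e k) phi))
  - (psi X (e i) (W3 (e k)) *: m (e i) (m (e k) phi))
  - (mu *: (psi X (e i) (e k) *: m (e i) (m (e k) phi))).
  rewrite (psi_ofC23 cm phi (W3 (e i))) (psi_ofC12 cm phi (W3 (e i)) X) opprK.
  rewrite (psi_ofC12 cm phi (W3 (e k))) (psi_ofC23 cm phi X (W3 (e k))) opprK.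
  by rewrite scalerBl scaleNr !scalerDl !opprD scalerA.
under eq_bigr => i _ do under eq_bigr => k _ do rewrite E.
under eq_bigr do rewrite !big_split /= !sumrN; rewrite !big_split /= !sumrN.
rewrite (sum_psi3 W3s) psi2 sum_psi oppr0 !addr0.
under [X in _ - X]eq_bigr do rewrite -scaler_sumr; rewrite -scaler_sumr sum_psi.
rewrite (linD (ml _)) (linZ (ml _)) scaleNr scalerDr opprD addrC.
by rewrite !scalerA [mu * 4]mulrC.
Qed.

End SU3Algebra.

(** * Metrics and spinor bundles *)

Section Gram.
Context {R : realType} {n : nat}.
Variable h : 'rV[R]_n -> 'rV[R]_n -> R.
Hypothesis hh : inner_product h.

Definition gram : 'M[R]_n := \matrix_(i, j) h (delta_mx 0 i) (delta_mx 0 j).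

Lemma gramE k l (A : 'M[R]_(k, n)) (B : 'M[R]_(l, n)) :
  A *m gram *m B^T = \matrix_(i, j) h (row i A) (row j B).
Proof.
apply/matrixP => i j; rewrite !mxE [row j B]row_sum_delta (inner_sumr hh).
apply: eq_bigr => v _; rewrite (innerZr hh) !mxE mulrC; congr (_ * _).
rewrite [row i A]row_sum_delta (inner_suml hh); apply: eq_bigr => u _.
by rewrite (innerZl hh) !mxE.
Qed.

Lemma gram_form x y : h x y = (x *m gram *m y^T) 0 0.
Proof. by rewrite gramE mxE !row_id. Qed.

Lemma gram_unit : gram \in unitmx.
Proof.
rewrite -row_free_unit -kermx_eq0 -nz_row_eq0; apply/eqP.
have := nz_row_sub (kermx gram); set v := nz_row _ => /sub_kermxP vG.
by apply: (inner_eq0 hh); rewrite gram_form vG mul0mx mxE.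
Qed.

Lemma is_basis_delta : is_basis (fun i : 'I_n => delta_mx 0 i : 'rV[R]_n).
Proof.
move=> x; exists x; split; first exact: row_sum_delta.
by move=> y ->; rewrite -row_sum_delta.
Qed.

(** The next vector is a normalised element of the kernel of the pairings with the previous ones,
    nonzero because there are fewer than [n] of them. *)
Lemma gram_schmidt k : (k <= n)%N ->
  exists b : 'I_k -> 'rV[R]_n, forall i j, h (b i) (b j) = (i == j)%:R.
Proof.
elim: k => [|k IH] kn; first by exists (fun=> 0) => -[].
have [b ob] := IH (ltnW kn).
pose A : 'M[R]_(k, n) := \matrix_i b i.
have : kermx (gram *m A^T) != 0.
  rewrite -mxrank_eq0 mxrank_ker subn_eq0 -ltnNge.
  by apply: leq_ltn_trans kn; apply: leq_trans (mxrankM_maxr _ _) _; rewrite mxrank_tr rank_leq_row.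
rewrite -nz_row_eq0; have := nz_row_sub (kermx (gram *m A^T)).
set v := nz_row _ => /sub_kermxP vA v0.
have [a _ aa] := normalize hh v0.
have vb i : h (b i) (a *: v) = 0.
  rewrite (innerZr hh) (innerC hh) (_ : h v (b i) = 0) ?mulr0//.
  have := congr1 (fun N : 'M[R]_(1, k) => N 0 i) vA; rewrite mulmxA gramE mxE [RHS]mxE.
  by rewrite row_id rowK.
exists (fun i => if unlift ord0 i is Some j then b j else a *: v) => i j.
case: (unliftP ord0 i) => [i' ->|->]; case: (unliftP ord0 j) => [j' ->|->].
- by rewrite (inj_eq lift_inj) ob.
- by rewrite eq_sym (negbTE (neq_lift _ _)) vb.
- by rewrite (negbTE (neq_lift _ _)) (innerC hh) vb.
- by rewrite eqxx aa.
Qed.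

End Gram.

Section Metric.
Context {R : realType} {n : nat} {M : manifold R n}.
Variable g : metric_tensor M.
Hypothesis eg : euclidean (@smooth_vf R n M) g.
Implicit Types (c : @chart R M n).

Lemma euclidean_inner p : inner_product (@g p).
Proof. by case: eg => h1 h2 h3 _; split=> *; [exact: h1 | exact: h2 | exact: h3]. Qed.
Local Notation hg := (euclidean_inner _).

Lemma exists_orthonormal p : exists e, Defs.orthonormal g p e.
Proof.
have [b ob] := gram_schmidt (euclidean_inner p) (leqnn n).
by exists (\matrix_i b i) => i j; rewrite !rowK.
Qed.

Lemma orthonormal_row_expand p e (X : tangent p) : Defs.orthonormal g p e ->
  X = \sum_i g X (row i e : tangent p) *: (row i e : tangent p).
Proof.
move=> oe.
exact: (@orthonormal_expand R (tangent p) (@g p) (euclidean_inner p) n _ _ X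
   (@is_basis_delta R n) oe).
Qed.

Lemma orthonormal_unit p e : Defs.orthonormal g p e -> e \in unitmx.
Proof.
move=> oe; have := gramE (euclidean_inner p) e e.
rewrite (_ : \matrix_(i, j) _ = 1%:M) -?mulmxA.
  by case/mulmx1_unit.
by apply/matrixP => i j; rewrite [LHS]mxE [RHS]mxE; exact: oe.
Qed.

Lemma sharpE p (a : tangent p -> R) : scalar a -> forall Y, g (sharp g a) Y = a Y.
Proof.
move=> sa Y; rewrite (gram_form (euclidean_inner p)) /sharp -/(gram (@g p)).
rewrite mulmxKV ?(gram_unit (euclidean_inner p))//.
rewrite mxE [Y in RHS]row_sum_delta.
rewrite (lin_sum (f := a : tangent p -> R^o) sa).
apply: eq_bigr => i _.
rewrite (linZ (f := a : tangent p -> R^o) sa) !mxE mulrC.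
by [].
Qed.

Lemma metric_separates p (X Y : tangent p) : (forall Z, g X Z = g Y Z) -> X = Y.
Proof.
move=> XY; apply/eqP; rewrite -subr_eq0; apply/eqP/(inner_eq0 (euclidean_inner p)).
by rewrite (innerDl (euclidean_inner p)) (innerNl (euclidean_inner p)) XY subrr.
Qed.

(** Unlike [gram (@g q)], whose entries refer to the chart preferred at [q], this Gram matrix has
    entries smooth in [q]. *)
Definition field_gram (c : chart M n) (q : M) : 'M[R]_n :=
  \matrix_(i, j) g (coord_field c i q) (coord_field c j q).

(** The coordinate functions are dual to the coordinate fields: differentiating [chart_coord c j]
    along a vanishing combination isolates its coefficient [j]. *)
Lemma coord_field_unit c p : atlas c -> cdom c p ->
  (\matrix_i (coord_field c i p : 'rV[R]_n)) \in unitmx.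
Proof.
move=> ac cp; rewrite -row_free_unit -kermx_eq0 -nz_row_eq0; apply/eqP.
have := nz_row_sub (kermx (\matrix_i (coord_field c i p : 'rV[R]_n))).
set v := nz_row _ => /sub_kermxP; rewrite mulmx_sum_row => vE.
apply/rowP => j; rewrite mxE.
have sj := smooth_coord j ac cp.
have := congr1 (fun w : tangent p => dird w (chart_coord c j)) vE.
have lj := dird_linear sj.
rewrite [X in _ = X](derive0) => <-.
rewrite (lin_sum (f := fun w : tangent p => dird w (chart_coord c j) : R^o) lj).
rewrite (bigD1 j)//= big1 ?addr0 => [|i ij].
  rewrite (linZ (f := fun w : tangent p => dird w (chart_coord c j) : R^o) lj) rowK.
  by rewrite dird_coord_coord_field// eqxx; exact/esym/mulr1.
rewrite (linZ (f := fun w : tangent p => dird w (chart_coord c j) : R^o) lj) rowK.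
by rewrite dird_coord_coord_field// (negbTE ij); exact: mulr0.
Qed.

Lemma field_gramE c p : field_gram c p =
  (\matrix_i (coord_field c i p : 'rV[R]_n)) *m gram (@g p) *m
  (\matrix_i (coord_field c i p : 'rV[R]_n))^T.
Proof.
rewrite (gramE (euclidean_inner p)); apply/matrixP => i j.
by rewrite [LHS]mxE [RHS]mxE !rowK.
Qed.

Lemma field_gram_unit c p : atlas c -> cdom c p -> field_gram c p \in unitmx.
Proof.
move=> ac cp; rewrite field_gramE !unitmx_mul unitmx_tr coord_field_unit//.
by rewrite (gram_unit (euclidean_inner p)).
Qed.

Lemma smooth_field_gram c p i j : atlas c -> cdom c p ->
  smooth_fun p (fun q => field_gram c q i j).
Proof.
move=> ac cp; have [_ _ _ sg] := eg.
have := sg p (coord_field c i) (coord_field c j)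
  (smooth_vf_coord_field i ac cp) (smooth_vf_coord_field j ac cp).
by apply: near_eq_smooth_fun; apply: nearW => q; rewrite [RHS]mxE.
Qed.

(** The coefficients of [Z] in the coordinate fields are its pairings with these fields times the
    inverse Gram matrix, all smooth. *)
Lemma smooth_vf_of_pairing p (Z : forall q : M, tangent q) :
  (forall Y, smooth_vf p Y -> smooth_fun p (fun q => g (Z q) (Y q))) -> smooth_vf p Z.
Proof.
have ac := chart_at_atlas p; have cp := chart_at_dom p; set c := chart_at p in ac cp *.
move=> H.
pose z i q := \sum_j g (Z q) (coord_field c j q) * invmx (field_gram c q) j i.
have sz i : smooth_fun p (z i).
  apply: smooth_fun_sum => j; apply: smooth_funM; first exact/H/smooth_vf_coord_field.
  by apply: smooth_fun_invmx; [move=> *; exact: smooth_field_gram | exact: field_gram_unit].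
have := smooth_vf_sum sz (fun i => smooth_vf_coord_field i ac cp).
apply: near_eq_smooth_vf; apply: filterS (nbhs_cdom ac cp) => q cq.
rewrite [RHS](tangent_expand _ ac cq); apply: eq_bigr => i _; congr (_ *: _).
pose b : 'rV[R]_n := \row_j g (Z q) (coord_field c j q).
pose d : 'rV[R]_n := \row_j dird (Z q) (chart_coord c j).
have bd : b = d *m field_gram c q.
  apply/rowP => j; rewrite [LHS]mxE [RHS]mxE [Z q in LHS](tangent_expand _ ac cq).
  rewrite (inner_suml (euclidean_inner q)); apply: eq_bigr => k _.
  by rewrite (innerZl (euclidean_inner q)) !mxE.
have -> : z i q = (b *m invmx (field_gram c q)) 0 i.
  by rewrite [RHS]mxE; apply: eq_bigr => j _; rewrite [b 0 j]mxE.
by rewrite bd mulmxK ?field_gram_unit// mxE.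
Qed.

(** The entries of [A q] refer to the chart preferred at [q]. The trace is invariant under
    conjugation by the matrix of the coordinate fields, in which it is made of smooth pairings and
    the inverse Gram matrix. *)
Lemma smooth_trace p (A : M -> 'M[R]_n) :
  (forall X Y, smooth_vf p X -> smooth_vf p Y ->
    smooth_fun p (fun q => g (endo A (X q)) (Y q))) ->
  smooth_fun p (fun q => \tr (A q)).
Proof.
have ac := chart_at_atlas p; have cp := chart_at_dom p; set c := chart_at p in ac cp *.
move=> H.
apply: (@near_eq_smooth_fun _ _ _ _ (fun q => \sum_i \sum_j
  g (endo A (coord_field c i q)) (coord_field c j q) * invmx (field_gram c q) j i)); last first.
  apply: smooth_fun_sum => i; apply: smooth_fun_sum => j; apply: smooth_funM.
    by apply: H; exact: smooth_vf_coord_field.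
  by apply: smooth_fun_invmx; [move=> *; exact: smooth_field_gram | exact: field_gram_unit].
apply: filterS (nbhs_cdom ac cp) => q cq.
pose E : 'M[R]_n := \matrix_i (coord_field c i q : 'rV[R]_n).
have Eu : E \in unitmx by exact: coord_field_unit.
transitivity (\tr ((E *m A q) *m gram (@g q) *m E^T *m invmx (field_gram c q))).
  apply: eq_bigr => i _; rewrite [RHS]mxE; apply: eq_bigr => j _; congr (_ * _).
  rewrite (gramE (euclidean_inner q)) mxE row_mul !rowK.
  by [].
have -> : E *m A q *m gram (@g q) *m E^T = (E *m A q *m invmx E) *m field_gram c q.
  by rewrite field_gramE -/E !mulmxA mulmxKV.
by rewrite mulmxK ?field_gram_unit// mxtrace_mulC mulmxA mulVmx// mul1mx.
Qed.

End Metric.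

Section SpinData.
Context {R : realType} {n : nat} {M : manifold R n}.
Variable S : spin_data M.
Hypotheses (eg : euclidean (@smooth_vf R n M) (metric S)) (sb : is_spinor_bundle S).

Lemma spinor_clifford p : clifford_module (@metric R n M S p) (@sprod R n M S p) (@cmul R n M S p).
Proof.
have [_ [h1 h2 h3 _] [m1 m2] [sq sk] _] := sb; split.
- exact: euclidean_inner.
- by split=> *; [exact: h1 | exact: h2 | exact: h3].
- by split=> *; [exact: m1 | exact: m2].
- by move=> *; exact: sq.
- by move=> *; exact: sk.
Qed.

Lemma spinor_basis p : exists s : 'I_8 -> spinor S p, is_basis s.
Proof.
have [vb _ _ _ _] := sb; have [s /nbhs_singleton [bs _]] := vb p.
by exists (fun i => s i p).
Qed.

(** [form2_mul] chooses an orthonormal frame by [get]; frame independence allows an adapted frame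
    instead. *)
Lemma form2_mulE p e (w : tangent p -> tangent p -> R) (x : spinor S p) :
  Defs.orthonormal (metric S) p e ->
  (forall Y, scalar (w^~ Y)) -> (forall X Y, w X Y = - w Y X) ->
  form2_mul w x = 2^-1 *: \sum_i \sum_j w (row i e) (row j e) *:
     cmul S (row i e : tangent p) (cmul S (row j e : tangent p) x).
Proof.
move=> oe wl ws; rewrite /form2_mul.
set e0 := get _; have o0 : Defs.orthonormal (metric S) p e0.
  exact: (getPex (exists_orthonormal eg p)).
have cm := spinor_clifford p.
rewrite -(form2_frame_indep cm x oe (fun X => @orthonormal_row_expand _ _ _ _ eg p e X oe)
  (fun X => @orthonormal_row_expand _ _ _ _ eg p e0 X o0) wl ws).
rewrite (form2_skew_sum cm x o0 ws) scalerA mulVf ?pnatr_eq0// scale1r.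
by [].
Qed.

Lemma form2_mul_linear p a (w w' : tangent p -> tangent p -> R) (x : spinor S p) :
  form2_mul (fun Y Z => a * w Y Z + w' Y Z) x = a *: form2_mul w x + form2_mul w' x.
Proof.
rewrite /form2_mul scaler_sumr -big_split; apply: eq_bigr => i _ /=.
rewrite scaler_sumr -big_split; apply: eq_bigr => j _ /=.
by rewrite scalerDl scalerA.
Qed.

End SpinData.

Section AlongLinear.
Context {R : realType} {m n : nat} {M : manifold R m} {N : manifold R n}.
Variables (iota : M -> N) (E : N -> lmodType R) (sm : N -> (forall p, E p) -> Prop).
Variables (G : M -> lmodType R) (smG : M -> (forall q, G q) -> Prop).
Hypothesis HG : section_module smG.

(** A fibrewise linear operation is determined by its effect on restrictions. Linearity near [q]
    suffices for coordinate functions, which are smooth only on the domain of their chart. *)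
Lemma smooth_along_near_linear q (Phi : forall r, E (iota r) -> G r) Z :
  (\forall r \near q, linear (Phi r)) ->
  (forall Y, sm (iota q) Y -> smG q (fun r => Phi r (Y (iota r)))) ->
  smooth_along sm q Z -> smG q (fun r => Phi r (Z r)).
Proof.
move=> lP HP [k [a [Y [sa sY ZE]]]]; have [_ _ _ sE] := HG q.
apply: (sE (fun r => \sum_i a i r *: Phi r (Y i (iota r)))).
  apply: filterS2 lP ZE => r lP ->; rewrite (lin_sum lP); apply: eq_bigr => i _.
  by rewrite (linZ lP).
by apply: (section_module_sum (s := fun i r => Phi r (Y i (iota r)))) => // i; exact: HP.
Qed.

Lemma smooth_along_linear q (Phi : forall r, E (iota r) -> G r) Z :
  (forall r, linear (Phi r)) ->
  (forall Y, sm (iota q) Y -> smG q (fun r => Phi r (Y (iota r)))) ->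
  smooth_along sm q Z -> smG q (fun r => Phi r (Z r)).
Proof. by move=> lP; apply: smooth_along_near_linear; exact: nearW. Qed.

End AlongLinear.

Lemma smooth_fun_module (R : realType) n (M : manifold R n) :
  section_module (E := fun _ => R^o) (@smooth_fun R n M).
Proof.
move=> p; split.
- exact: smooth_fun_cst.
- exact: smooth_funD.
- exact: smooth_funM.
- exact: near_eq_smooth_fun.
Qed.

(** * The structure induced on a hypersurface *)

Section AlongProducts.
Context {R : realType} {m n : nat} {M : manifold R m} {N : manifold R n}.
Variables (iota : M -> N) (Hiota : smooth_map iota).

Lemma smooth_along_inner (E : N -> lmodType R) sm h q Z1 Z2 :
  @euclidean R n N E sm h -> smooth_along (iota := iota) sm q Z1 ->
  smooth_along sm q Z2 -> smooth_fun q (fun r => h (iota r) (Z1 r) (Z2 r)).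
Proof.
move=> [h1 h2 h3 hs] s1 s2.
have hh p : inner_product (h p) by split=> *; [exact: h1 | exact: h2 | exact: h3].
apply: (smooth_along_linear (@smooth_fun_module R m M)
  (Phi := fun r z => h (iota r) z (Z2 r) : R^o)) s1 => [r|Y sY].
  exact: inner_linl (hh _) _.
apply: (smooth_along_linear (@smooth_fun_module R m M)
  (Phi := fun r z => h (iota r) (Y (iota r)) z : R^o)) s2 => [r|Y' sY'].
  exact: inner_linr (hh _) _.
by apply: (smooth_fun_comp Hiota (f := fun p => h p (Y p) (Y' p))); exact: hs.
Qed.

Lemma smooth_along_cmul (S : spin_data N) q X Z : is_spinor_bundle S ->
  smooth_along (iota := iota) (@smooth_vf R n N) q X ->
  smooth_along (iota := iota) (@ssmooth R n N S) q Z ->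
  smooth_along (@ssmooth R n N S) q (fun r => cmul S (X r) (Z r)).
Proof.
move=> [_ _ [m1 m2] _ sm] sX sZ.
apply: (smooth_along_linear (@smooth_along_module R m n M N iota _ (@ssmooth R n N S))
  (Phi := fun r x => cmul S x (Z r))) sX => [r|Y sY]; first exact: m1.
apply: (smooth_along_linear (@smooth_along_module R m n M N iota _ (@ssmooth R n N S))
  (Phi := fun r x => cmul S (Y (iota r)) x)) sZ => [r|Y' sY']; first exact: m2.
by apply: (@smooth_along_pull R m n M N iota _ _ q (fun p => cmul S (Y p) (Y' p))); exact: sm.
Qed.

Lemma smooth_along_form3 (T : form3 N) q X Y Z : is_form3 T ->
  smooth_along (iota := iota) (@smooth_vf R n N) q X ->
  smooth_along (iota := iota) (@smooth_vf R n N) q Y ->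
  smooth_along (iota := iota) (@smooth_vf R n N) q Z ->
  smooth_fun q (fun r => T (iota r) (X r) (Y r) (Z r)).
Proof.
move=> [t1 t12 t23 ts] sX sY sZ.
have t2 p x z : scalar (fun y : tangent p => T p x y z).
  by move=> a u v; rewrite !(t12 p x) t1 opprD mulrN.
have t3 p x y : scalar (fun z : tangent p => T p x y z).
  by move=> a u v; rewrite !(t23 p x y) t2 opprD mulrN.
apply: (smooth_along_linear (@smooth_fun_module R m M)
  (Phi := fun r x => T (iota r) x (Y r) (Z r) : R^o)) sX => [r|X' sX']; first exact: t1.
apply: (smooth_along_linear (@smooth_fun_module R m M)
  (Phi := fun r y => T (iota r) (X' (iota r)) y (Z r) : R^o)) sY => [r|Y' sY']; first exact: t2.
apply: (smooth_along_linear (@smooth_fun_module R m M)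
  (Phi := fun r z => T (iota r) (X' (iota r)) (Y' (iota r)) z : R^o)) sZ => [r|Z' sZ'].
  exact: t3.
by apply: (smooth_fun_comp Hiota (f := fun p => T p (X' p) (Y' p) (Z' p))); exact: ts.
Qed.

Lemma smooth_along_coord q Z i : smooth_along (iota := iota) (@smooth_vf R n N) q Z ->
  smooth_fun q (fun r => dird (Z r) (chart_coord (chart_at (iota q)) i)).
Proof.
have ad := chart_at_atlas (iota q); have dd := chart_at_dom (iota q).
apply: (smooth_along_near_linear (@smooth_fun_module R m M)
  (Phi := fun r z => dird z (chart_coord (chart_at (iota q)) i) : R^o)) => [|Y sY].
  apply: filterS (near_iota Hiota (nbhs_cdom ad dd)) => r dr.
  by apply: dird_linear; exact: smooth_coord.
apply: (smooth_fun_comp Hiota (f := fun p => dird (Y p) (chart_coord (chart_at (iota q)) i))).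
by apply: sY; exact: smooth_coord.
Qed.

Lemma pullback_vector_bundle (E : N -> lmodType R) sm k :
  @vector_bundle R n N E sm k ->
  vector_bundle (smooth_along (iota := iota) sm) k.
Proof.
move=> vb q; have [s fs] := vb (iota q).
exists (fun i r => s i (iota r)).
have fs' : local_frame sm (iota q) s by exact: fs.
have := near_iota Hiota (nbhs_interior fs); apply: filterS => r fr.
have fr' : local_frame sm (iota r) s by exact: fr.
have [bs _] := nbhs_singleton fr; split=> // sigma; split; last first.
  move=> [a [sa sE]]; exists k, a, s; split=> // i; exact: (local_frame_smooth i fr').
move=> [l [a [Y [sa sY YE]]]].
(* Each ambient section [Y i] is expanded in the ambient frame; composing its coefficients with
   [iota] gives those of [sigma]. *)
have /choice [b bP] : forall i, exists b : 'I_k -> N -> R,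
    (forall j, smooth_fun (iota r) (b j)) /\
    \forall p \near iota r, Y i p = \sum_j b j p *: s j p.
  by move=> i; have [_ H] := nbhs_singleton fr; apply/H.
exists (fun j r' => \sum_i a i r' * b i j (iota r')); split.
  move=> j; apply: smooth_fun_sum => i; apply: smooth_funM => //.
  by apply: smooth_fun_comp => //; exact: (bP i).1.
have nY : \forall r' \near r, forall i, Y i (iota r') = \sum_j b i j (iota r') *: s j (iota r').
  by apply: filter_forall => i; exact: (near_iota Hiota (bP i).2).
apply: filterS2 YE nY => r' -> YE'.
under eq_bigr => i _ do rewrite YE' scaler_sumr.
rewrite exchange_big; apply: eq_bigr => j _; rewrite scaler_suml.
by apply: eq_bigr => i _; rewrite scalerA.
Qed.

End AlongProducts.

Section Hypersurface.
Context {R : realType} {Mb : manifold R 7} {M : manifold R 6}.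
Variables (Sb : spin_data Mb) (iota : M -> Mb) (V : forall q : M, tangent (iota q)).
Variables (nab : connection (@tangent R 6 M))
  (snab : connection (fun q : M => spinor Sb (iota q))).
Hypotheses (HSb : spin_manifold Sb) (Hiota : embedding iota) (HV : unit_normal Sb V).
Let S := induced_data V nab snab.

Let eb : euclidean (@smooth_vf R 7 Mb) (metric Sb). Proof. by case: HSb. Qed.
Let bb : is_spinor_bundle Sb. Proof. by case: HSb. Qed.
Let ms : smooth_map iota. Proof. by case: Hiota. Qed.
Let tl q : linear (@tmap R 6 7 M Mb iota q). Proof. exact: tmap_linear. Qed.
Let gb p : inner_product (@metric R 7 Mb Sb p). Proof. exact: euclidean_inner eb p. Qed.
Let cb p := spinor_clifford eb bb p.

Lemma normal_unit q : metric Sb (V q) (V q) = 1. Proof. by case: HV. Qed.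

Lemma normal_tangent q (v : tangent q) : metric Sb (V q) (tmap iota v) = 0.
Proof. by case: HV. Qed.

Lemma induced_inner q : inner_product (@metric R 6 M S q).
Proof.
split.
- by move=> y a u v; rewrite /= tl; case: (gb (iota q)) => H _ _; exact: H.
- by move=> x y; rewrite /= (innerC (gb _)).
- move=> x x0; case: (gb (iota q)) => _ _; apply; apply: contraNneq x0 => tx.
  by apply/eqP; case: Hiota => _ _ inj _; exact: inj.
Qed.

Lemma induced_euclidean : euclidean (@smooth_vf R 6 M) (metric S).
Proof.
split=> [p|p|p|p X Y sX sY].
- by case: (induced_inner p).
- by case: (induced_inner p).
- by case: (induced_inner p).
- by apply: (smooth_along_inner ms eb); exact: smooth_along_tmap.
Qed.

Lemma normal_anticomm q (X : tangent q) x :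
  cmul Sb (V q) (cmul Sb (tmap iota X) x) = - cmul Sb (tmap iota X) (cmul Sb (V q) x).
Proof. by rewrite (mul_anticomm (cb _)) normal_tangent mulr0 scale0r subr0. Qed.

Lemma normal_sq q x : cmul Sb (V q) (cmul Sb (V q) x) = - x.
Proof. by case: (cb (iota q)) => _ _ _ msq _; rewrite msq normal_unit scaleN1r. Qed.

(** [V X V Y = - X V V Y = X Y], as [V] anticommutes with tangent vectors and squares to [-1]. *)
Lemma induced_mul2 q (X Y : tangent q) x :
  cmul S X (cmul S Y x) = cmul Sb (tmap iota X) (cmul Sb (tmap iota Y) x).
Proof.
have [_ _ [_ mr] _ _] := cb (iota q).
by rewrite /= normal_anticomm normal_sq (linN (mr _)) opprK.
Qed.

Lemma induced_bundle : is_spinor_bundle S.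
Proof.
have [vb es _ _ _] := bb.
split.
- exact: pullback_vector_bundle.
- have [e1 e2 e3 _] := es; split.
  + by move=> p; exact: e1.
  + by move=> p; exact: e2.
  + by move=> p; exact: e3.
  + by move=> p s t ss st; exact: (smooth_along_inner ms es ss st).
- split=> [q x a u v|q X a u v] /=; have [_ _ [ml mr] _ _] := cb (iota q).
    by rewrite tl (ml _ a) (mr _ a).
  by rewrite (mr _ a) (mr _ a).
- split=> [q X x|q X x y].
    by rewrite induced_mul2; case: (cb (iota q)) => _ _ _ msq _; rewrite msq.
  have [_ hh _ _ _] := cb (iota q).
  by rewrite /= !(mul_skew (cb _)) opprK normal_anticomm (innerNr hh) opprK.
- move=> q X x sX sx; apply: (smooth_along_cmul (X := V)) => //; first by case: HV.
  by apply: smooth_along_cmul => //; exact: smooth_along_tmap.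
Qed.

Definition normal_frame (q : M) (e : 'M[R]_6) : 'M[R]_7 :=
  col_mx (\matrix_(i < 6) tmap iota (row i e : tangent q)) (V q) : 'M[R]_(6 + 1, 7).

Lemma normal_frame_l q e (i : 'I_6) :
  row (lshift 1 i : 'I_7) (normal_frame q e) = tmap iota (row i e : tangent q).
Proof. by rewrite /normal_frame (@rowKu _ 6 1 7) rowK. Qed.

Lemma normal_frame_r q e (i : 'I_1) : row (rshift 6 i : 'I_7) (normal_frame q e) = V q.
Proof. by rewrite /normal_frame (@rowKd _ 6 1 7) ord1 row_id. Qed.

Lemma normal_frame_orthonormal q e : Defs.orthonormal (metric S) q e ->
  Defs.orthonormal (metric Sb) (iota q) (normal_frame q e).
Proof.
move=> oe i j.
rewrite -(splitK (m := 6) (n := 1) i) -(splitK (m := 6) (n := 1) j).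
case: (fintype.split (i : 'I_(6 + 1))) => i'; case: (fintype.split (j : 'I_(6 + 1))) => j' /=.
- by rewrite !normal_frame_l (inj_eq (@lshift_inj 6 1)); exact: oe.
- rewrite normal_frame_l normal_frame_r (innerC (gb _)) normal_tangent.
  by rewrite -[RHS]/((lshift 1 i' == rshift 6 j')%:R) eq_lrshift.
- rewrite normal_frame_l normal_frame_r normal_tangent.
  by rewrite -[RHS]/((rshift 6 i' == lshift 1 j')%:R) eq_rlshift.
- by rewrite !normal_frame_r normal_unit !ord1 eqxx.
Qed.

Lemma normal_frame_mul q (e f : 'M[R]_6) : normal_frame q (f *m e) =
  (block_mx f 0 0 1%:M : 'M[R]_(6 + 1)) *m normal_frame q e.
Proof.
have fE : (\matrix_(i < 6) tmap iota (row i (f *m e) : tangent q) : 'M[R]_(6, 7)) =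
    f *m \matrix_(i < 6) tmap iota (row i e : tangent q).
  apply/row_matrixP => i.
  rewrite row_mul rowK row_mul mulmx_sum_row (mulmx_sum_row (row i f)) (lin_sum (@tl q)).
  by apply: eq_bigr => k _; rewrite (linZ (@tl q)) rowK.
by rewrite /normal_frame fE (@mul_block_col _ 6 1 6 1 7) !mul0mx addr0 add0r mul1mx.
Qed.

Lemma normal_frame_unit q e : (normal_frame q e \in unitmx) = (e \in unitmx).
Proof.
have [e0 o0] := exists_orthonormal induced_euclidean q.
have u0 := orthonormal_unit induced_euclidean o0.
have U0 := orthonormal_unit eb (normal_frame_orthonormal o0).
rewrite -{1}(mulmxKV u0 e) normal_frame_mul unitmx_mul U0 andbT.
rewrite unitmxE (@det_ublock _ 6 1) det1 mulr1 -unitmxE.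
by rewrite unitmx_mul unitmx_inv u0 andbT.
Qed.

(** Adjoining [V] to both frames makes the change of basis block diagonal with last block 1. *)
Lemma normal_frame_det q e f : e \in unitmx ->
  \det (normal_frame q f *m invmx (normal_frame q e)) = \det (f *m invmx e).
Proof.
move=> ue; rewrite -{1}(mulmxKV ue f) normal_frame_mul mulmxK ?normal_frame_unit//.
by rewrite (@det_ublock _ 6 1) det1 mulr1.
Qed.

Lemma exists_oriented q :
  exists e, Defs.orthonormal (metric S) q e /\ positive S q e.
Proof.
have [_ [p1 p2 p3 _] _ _ _] := HSb.
have [e oe] := exists_orthonormal induced_euclidean q; have [b pb] := p1 (iota q).
have ue := orthonormal_unit induced_euclidean oe.
have d0 : \det (normal_frame q e *m invmx b) != 0.
  rewrite -unitfE -unitmxE unitmx_mul unitmx_inv (p2 _ _ pb) andbT.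
  by rewrite normal_frame_unit.
have [dpos|dneg] := ltP 0 (\det (normal_frame q e *m invmx b)).
  by exists e; split=> //; apply/(p3 _ _ _ pb).
(* Exchanging two tangent vectors reverses the orientation and keeps the frame orthonormal. *)
pose s : 'S_6 := tperm ord0 (lift ord0 ord0).
exists (perm_mx s *m e); split.
  have rE i : row i (perm_mx s *m e) = row (s i) e.
    by rewrite -row_permE; apply/rowP => k; rewrite !mxE.
  by move=> i j; rewrite !rE oe (inj_eq perm_inj).
apply/(p3 _ _ _ pb); rewrite -/(normal_frame q (perm_mx s *m e)) normal_frame_mul.
rewrite -mulmxA det_mulmx (@det_ublock _ 6 1) det1 mulr1 det_perm odd_tperm.
by rewrite neq_lift expr1 mulN1r oppr_gt0 lt_neqAle d0.
Qed.

Lemma induced_orientation : is_orientation (positive S).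
Proof.
have [_ [p1 p2 p3 p4] _ _ _] := HSb; split.
- by move=> q; have [e [_ pe]] := exists_oriented q; exists e.
- by move=> q e /p2 ue; rewrite -(normal_frame_unit q).
- move=> q e f pe; have ue : e \in unitmx by rewrite -(normal_frame_unit q); exact: p2 pe.
  by rewrite -(normal_frame_det q f ue); exact: (p3 (iota q) (normal_frame q e)).
move=> q X sX pX.
set c := chart_at (iota q).
have ac : atlas c by exact: chart_at_atlas.
have cq : cdom c (iota q) by exact: chart_at_dom.
pose Xm r : 'M[R]_6 := \matrix_(i < 6) (X i r : 'rV[R]_6).
pose K p : 'M[R]_7 := \matrix_(i < 7) (coord_field c i p : 'rV[R]_7).
pose B := normal_frame q (Xm q) *m invmx (K (iota q)).
(* Ambient fields with constant coefficients in the coordinate fields, equal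
   at [q] to the given frame. *)
pose Y (i : 'I_7) p : tangent p := \sum_j B i j *: coord_field c j p.
have YE p : (\matrix_(i < 7) (Y i p : 'rV[R]_7)) = B *m K p.
  apply/row_matrixP => i; rewrite rowK row_mul mulmx_sum_row.
  by apply: eq_bigr => j _; rewrite [row i B _ _]mxE /K rowK.
have uK : K (iota q) \in unitmx by exact: coord_field_unit.
have sY i : smooth_vf (iota q) (Y i).
  by apply: smooth_vf_sum => j; [exact: smooth_fun_cst | exact: smooth_vf_coord_field].
have pY : positive Sb (iota q) (\matrix_(i < 7) (Y i (iota q) : 'rV[R]_7)).
  by rewrite YE /B mulmxKV.
have nY := near_iota ms (p4 (iota q) Y sY pY).
pose Z (i : 'I_7) r : tangent (iota r) := row i (normal_frame r (Xm r)).
have sZ i : smooth_along (iota := iota) (@smooth_vf R 7 Mb) q (Z i).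
  have [_ _ _ sE] := @smooth_along_module R 6 7 M Mb iota _ (@smooth_vf R 7 Mb) q.
  rewrite -(splitK (m := 6) (n := 1) i).
  case: (fintype.split (i : 'I_(6 + 1))) => i' /=.
    by apply: sE (smooth_along_tmap ms (sX i')); apply: nearW => r; rewrite /Z normal_frame_l rowK.
  have [sV _ _] := HV.
  by apply: sE (sV q); apply: nearW => r; rewrite /Z normal_frame_r.
pose A r : 'M[R]_7 := \matrix_(i, j) dird (Z i r) (chart_coord c j).
have AE r : cdom c (iota r) -> normal_frame r (Xm r) = A r *m K (iota r).
  move=> cr; apply/row_matrixP => i; rewrite row_mul mulmx_sum_row.
  rewrite -/(Z i r) [LHS](tangent_expand _ ac cr).
  by apply: eq_bigr => j _; rewrite [row i _ _ _]mxE [A r _ _]mxE /K rowK.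
have sA i j : smooth_fun q (fun r => A r i j).
  by apply: near_eq_smooth_fun (smooth_along_coord ms j (sZ i)); apply: nearW => r; rewrite mxE.
have AB : A q = B by rewrite /B AE// mulmxK.
have sd := smooth_fun_det sA.
have uB : B \in unitmx.
  by rewrite unitmx_mul unitmx_inv uK andbT; exact: p2 pX.
(* The determinant of the moving frame relative to [Y]: smooth, equal to 1 at [q], hence positive
   nearby, where [Y] is still positively oriented. *)
have sr : smooth_fun q (fun r => \det (A r) * \det (invmx B)).
  by apply: smooth_funM => //; exact: smooth_fun_cst.
have near_pos : \forall r \near q, 0 < \det (A r) * \det (invmx B).
  apply: (smooth_fun_continuous sr (open_nbhs_nbhs (conj (open_gt (y := 0)) _))).
  by rewrite /= AB -det_mulmx mulmxV// det1.
apply: filterS3 nY near_pos (near_iota ms (nbhs_cdom ac cq)) => r pYr dr cr.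
apply/(p3 _ _ _ pYr); rewrite -/(normal_frame r (Xm r)) YE AE//.
have uKr : K (iota r) \in unitmx by exact: coord_field_unit.
suff -> : invmx (B *m K (iota r)) = invmx (K (iota r)) *m invmx B.
  by rewrite mulmxA mulmxK// det_mulmx.
have uBK : B *m K (iota r) \in unitmx by rewrite unitmx_mul uB.
rewrite -[RHS](mulmxK uBK) mulmxA -[_ *m invmx B *m B]mulmxA.
by rewrite mulVmx// mulmx1 mulVmx// mul1mx.
Qed.

Hypothesis Hvol : forall p e (psi : spinor Sb p), Defs.orthonormal (metric Sb) p e ->
  positive Sb p e -> frame_mul e psi = - psi.

(** On [V x] the rule [e_1 ... e_7 = - Id] reads [e_1 ... e_6 V V x = - V x], that is
    [e_1 ... e_6 x = V x]. The six induced products pair up into ambient ones by [VV]. *)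
Lemma induced_volume q (x : spinor S q) : volume_mul x = cmul Sb (V q) x.
Proof.
rewrite /volume_mul; set e := get _.
have [oe pe] : Defs.orthonormal (metric S) q e /\ positive S q e.
  exact: (getPex (exists_oriented q)).
have [_ _ [_ mr] _ _] := cb (iota q).
have := Hvol (cmul Sb (V q) x) (normal_frame_orthonormal oe) pe.
rewrite /frame_mul enum_ordSr foldr_rcons foldr_map.
rewrite (_ : row ord_max _ = row (rshift 6 (ord0 : 'I_1) : 'I_7) (normal_frame q e)); last first.
  by congr row; exact/val_inj.
have rE (i : 'I_6) : row (widen_ord (leqnSn 6) i : 'I_7) (normal_frame q e) =
    tmap iota (row i e : tangent q).
  by rewrite -normal_frame_l; congr row; exact/val_inj.
have foldN l y : foldr (fun i : 'I_6 => cmul Sb (row (widen_ord (leqnSn 6) i : 'I_7)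
    (normal_frame q e) : tangent (iota q))) (- y) l =
  - foldr (fun i : 'I_6 => cmul Sb (row (widen_ord (leqnSn 6) i : 'I_7)
    (normal_frame q e) : tangent (iota q))) y l.
  by elim: l => //= i l ->; rewrite (linN (mr _)).
have VV (X Y : tangent q) y : cmul Sb (V q) (cmul Sb (tmap iota X)
    (cmul Sb (V q) (cmul Sb (tmap iota Y) y))) =
    cmul Sb (tmap iota X) (cmul Sb (tmap iota Y) y) by exact: induced_mul2.
rewrite normal_frame_r normal_sq foldN => /oppr_inj <-.
by rewrite !enum_ordSl enum_ord0 /= !VV !rE.
Qed.

End Hypersurface.

(** * The spinorial Gauss formula *)

Section Derivations.
Context {R : realType} {m : nat} {M : manifold R m}.
Variables (q : M) (v : tangent q).

(** The common features of a connection in a fixed direction, of [dird], and of the corrected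
    operator [D] in [spinor_gauss_at]. *)
Definition derivation (G : M -> lmodType R) (smG : M -> (forall r, G r) -> Prop)
    (D : (forall r, G r) -> G q) :=
  [/\ forall s t, smG q s -> smG q t -> D (fun r => s r + t r) = D s + D t,
      forall f s, smooth_fun q f -> smG q s ->
        D (fun r => f r *: s r) = dird v f *: s q + f q *: D s
    & forall s t, smG q s -> smG q t -> (\forall r \near q, s r = t r) -> D s = D t].

Lemma connection_derivation G smG (D : @connection R m M G) :
  is_connection smG D -> section_module smG -> derivation smG (D q v).
Proof.
move=> HD HS; have [_ DD DL _] := HD; split.
- by move=> s t ss st; exact: DD.
- by move=> f s sf ss; exact: DL.
- by move=> s t ss st; exact: (connection_near_eq HD).
Qed.

Lemma derivation0 G smG D : @section_module R m M G smG -> derivation smG D ->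
  D (fun=> 0) = 0.
Proof.
move=> HS [_ DL _]; have [s0 _ _ _] := HS q.
have := DL _ _ (smooth_fun_cst q 0) s0; rewrite dird_cst !scale0r addr0 => E0.
by rewrite -[RHS]E0; congr D; apply: functional_extensionality_dep => r; rewrite scaler0.
Qed.

Lemma dird_derivation :
  derivation (G := fun _ => R^o) (@smooth_fun R m M) (fun f => dird v f).
Proof.
split.
- by move=> s t ss st; exact: dirdD.
- by move=> f s sf ss; exact: dirdM.
- by move=> s t _ _; exact: dird_near_eq.
Qed.

Section Leibniz.
Context {n : nat} {N : manifold R n}.
Variables (iota : M -> N) (E1 E2 : N -> lmodType R) (G : M -> lmodType R).
Variables (sm1 : N -> (forall p, E1 p) -> Prop) (sm2 : N -> (forall p, E2 p) -> Prop)
  (smG : M -> (forall r, G r) -> Prop).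
Variables (B : forall r, E1 (iota r) -> E2 (iota r) -> G r).
Local Notation along1 := (smooth_along (iota := iota) sm1).
Local Notation along2 := (smooth_along (iota := iota) sm2).
Variables (D1 : (forall r, E1 (iota r)) -> E1 (iota q))
  (D2 : (forall r, E2 (iota r)) -> E2 (iota q)) (DG : (forall r, G r) -> G q).
Hypotheses (Bl : forall r y, linear (fun x => B (r := r) x y))
  (Br : forall r x, linear (B (r := r) x)) (HG : section_module smG)
  (d1 : derivation along1 D1) (d2 : derivation along2 D2) (dG : derivation smG DG)
  (sB : forall X Y, along1 q X -> along2 q Y -> smG q (fun r => B (X r) (Y r)))
  (base : forall X Y, sm1 (iota q) X -> sm2 (iota q) Y ->
    DG (fun r => B (X (iota r)) (Y (iota r))) =
    B (D1 (fun r => X (iota r))) (Y (iota q)) + B (X (iota q)) (D2 (fun r => Y (iota r)))).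

(** Both sides are additive, local and Leibniz in [X] and in [Y]; [smooth_along_ind], run on each
    variable, leaves only the restrictions, where [base] applies. *)
Lemma along_leibniz X Y : along1 q X -> along2 q Y ->
  DG (fun r => B (X r) (Y r)) = B (D1 X) (Y q) + B (X q) (D2 Y).
Proof.
have m1 := @smooth_along_module R m n M N iota E1 sm1.
have m2 := @smooth_along_module R m n M N iota E2 sm2.
have [D1D D1L D1E] := d1; have [D2D D2L D2E] := d2; have [DGD DGL DGE] := dG.
move=> sX; move: Y; move: X sX; apply: smooth_along_ind.
- move=> Y sY; rewrite (derivation0 m1 d1) !(lin0 (Bl _)) addr0.
  rewrite -[RHS](derivation0 HG dG); congr DG.
  by apply: functional_extensionality_dep => r; rewrite (lin0 (Bl _)).
- move=> X1 X2 s1 s2 P1 P2 Y sY.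
  transitivity (DG (fun r => B (X1 r) (Y r) + B (X2 r) (Y r))).
    by congr DG; apply: functional_extensionality_dep => r; rewrite (linD (Bl _)).
  rewrite DGD ?P1 ?P2 ?D1D//; [|exact: sB|exact: sB].
  by rewrite !(linD (Bl _)) addrACA.
- move=> a X sa sX P Y sY.
  transitivity (DG (fun r => a r *: B (X r) (Y r))).
    by congr DG; apply: functional_extensionality_dep => r; rewrite (linZ (Bl _)).
  rewrite DGL ?P ?D1L//; last exact: sB.
  by rewrite !(linD (Bl _)) !(linZ (Bl _)) scalerDr addrA.
- move=> X1 X2 s1 s2 X12 P Y sY.
  rewrite -(nbhs_singleton X12) -(D1E _ _ s1 s2 X12) -P//.
  apply: DGE; [exact: sB|exact: sB|].
  by apply: filterS X12 => r ->.
move=> X sX; have aX := @smooth_along_pull R m n M N iota _ sm1 q X sX.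
apply: smooth_along_ind.
- rewrite (derivation0 m2 d2) !(lin0 (Br _)) addr0.
  rewrite -[RHS](derivation0 HG dG); congr DG.
  by apply: functional_extensionality_dep => r; rewrite (lin0 (Br _)).
- move=> Y1 Y2 s1 s2 P1 P2.
  transitivity (DG (fun r => B (X (iota r)) (Y1 r) + B (X (iota r)) (Y2 r))).
    by congr DG; apply: functional_extensionality_dep => r; rewrite (linD (Br _)).
  rewrite DGD ?P1 ?P2 ?D2D//; [|exact: sB|exact: sB].
  by rewrite !(linD (Br _)) addrACA.
- move=> a Y sa sY P.
  transitivity (DG (fun r => a r *: B (X (iota r)) (Y r))).
    by congr DG; apply: functional_extensionality_dep => r; rewrite (linZ (Br _)).
  rewrite DGL ?P ?D2L//; last exact: sB.
  by rewrite !(linD (Br _)) !(linZ (Br _)) scalerDr addrCA.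
- move=> Y1 Y2 s1 s2 Y12 P.
  rewrite -(nbhs_singleton Y12) -(D2E _ _ s1 s2 Y12) -P//.
  apply: DGE; [exact: sB|exact: sB|].
  by apply: filterS Y12 => r ->.
- by move=> Y sY; exact: base.
Qed.

End Leibniz.
End Derivations.

Lemma extend_vf (R : realType) n (M : manifold R n) p (v : @tangent R n M p) :
  exists2 X, smooth_vf p X & X p = v.
Proof.
have ac := chart_at_atlas p; have cp := chart_at_dom p.
exists (fun q => \sum_i dird v (chart_coord (chart_at p) i) *: coord_field (chart_at p) i q).
  by apply: smooth_vf_sum => i; [exact: smooth_fun_cst | exact: smooth_vf_coord_field].
exact/esym/tangent_expand.
Qed.

Section Tensor.
Context {R : realType} {m n : nat} {M : manifold R m} {N : manifold R n}.
Variables (iota : M -> N) (Hiota : smooth_map iota).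
Variables (E : N -> lmodType R) (sm : N -> (forall p, E p) -> Prop) (k : nat).
Hypothesis vb : vector_bundle sm k.

Lemma extend_section p (x : E p) : exists2 s, sm p s & s p = x.
Proof.
have [s fs] := vb p; have fs' : local_frame sm p s by exact: fs.
have [bs _] := nbhs_singleton fs; have [a [xa _]] := bs x.
exists (fun q => \sum_i a 0 i *: s i q) => //.
apply: (section_module_sum (a := fun i _ => a 0 i)).
- exact: vector_bundle_module vb.
- by move=> i; exact: smooth_fun_cst.
- by move=> i; exact: local_frame_smooth i fs'.
Qed.

(** In a local frame the derivatives of the coefficients agree on both sides by [dird_tmap]; only
    the values of the coefficients at [q] remain. *)
Lemma connection_difference (D : @connection R n N E)
    (Di : @connection R m M (fun q => E (iota q))) q (v : tangent q) :
  is_connection sm D -> is_connection (smooth_along (iota := iota) sm) Di ->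
  exists2 A : E (iota q) -> E (iota q), linear A &
    forall s, sm (iota q) s ->
      Di q v (fun r => s (iota r)) = D (iota q) (tmap iota v) s + A (s (iota q)).
Proof.
move=> HD HDi; have [s fs] := vb (iota q).
have fs' : local_frame sm (iota q) s by exact: fs.
have [bs sP] := nbhs_singleton fs.
have m1 := vector_bundle_module vb.
have m2 := @smooth_along_module R m n M N iota E sm.
pose crd x : 'rV[R]_k := xget 0 [set a : 'rV[R]_k | x = \sum_i a 0 i *: s i (iota q)].
have crdE x : x = \sum_i crd x 0 i *: s i (iota q).
  by rewrite /crd; case: xgetP => [a _ //|H]; have [a [xa _]] := bs x; case: (H a).
have crdU x (a : 'rV[R]_k) : x = \sum_i a 0 i *: s i (iota q) -> crd x = a.
  by move=> xa; have [b [_ bU]] := bs x; rewrite -(bU _ xa) -(bU _ (crdE x)).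
pose B i := Di q v (fun r => s i (iota r)) - D (iota q) (tmap iota v) (s i).
exists (fun x => \sum_i crd x 0 i *: B i).
  move=> a x y; rewrite (crdU _ (a *: crd x + crd y)).
    rewrite scaler_sumr -big_split; apply: eq_bigr => i _ /=.
    by rewrite !mxE scalerDl scalerA.
  rewrite [x in LHS]crdE [y in LHS]crdE scaler_sumr -big_split; apply: eq_bigr => i _ /=.
  by rewrite !mxE scalerDl scalerA.
move=> t st; have [a [sa ta]] := (sP t).1 st.
have ss i : sm (iota q) (s i) by exact: local_frame_smooth i fs'.
have as_ i : smooth_along (iota := iota) sm q (fun r => s i (iota r)).
  exact: smooth_along_pull.
have aS i : smooth_fun q (a i \o iota) by exact: smooth_fun_comp.
have -> : D (iota q) (tmap iota v) t =
    D (iota q) (tmap iota v) (fun p => \sum_i a i p *: s i p).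
  by apply: (connection_near_eq HD) => //; exact: section_module_sum.
have -> : Di q v (fun r => t (iota r)) =
    Di q v (fun r => \sum_i (a i \o iota) r *: s i (iota r)).
  apply: (connection_near_eq HDi).
  - exact: smooth_along_pull.
  - exact: (section_module_sum (s := fun i r => s i (iota r)) m2 aS as_).
  - exact: (near_iota Hiota ta).
rewrite (connection_sum HDi m2 v (s := fun i r => s i (iota r)) aS as_).
rewrite (connection_sum HD m1 _ sa ss) -big_split; apply: eq_bigr => i _ /=.
rewrite dird_tmap// (crdU (t (iota q)) (\row_i a i (iota q))); last first.
  rewrite (nbhs_singleton ta); apply: eq_bigr => j _; rewrite mxE.
  by [].
by rewrite mxE -addrA -scalerDr /B addrCA subrr addr0.
Qed.

End Tensor.

(** Bookkeeping for [key] in [spinor_gauss_at]: [n] is the term with the derivative of the tangent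
    field, [d] the one with [D], [a] and [g] come from [W], [x] and [y] from [A]. *)
Lemma zmod_cancel (U : zmodType) (a n g d x y : U) :
  - a + (n - g + d) + x = n + (d + y) -> x - y = a + g.
Proof.
move=> H; apply/eqP; rewrite subr_eq; apply/eqP.
apply: (addrI (- a + (n - g + d))); rewrite H !addrA.
by rewrite [RHS](ACl (2*4*7*(1*5)*(3*6)))/= !addNr !addr0.
Qed.

Section Gauss.
Context {R : realType} {Mb : manifold R 7} {M : manifold R 6}.
Variables (Sb : spin_data Mb) (iota : M -> Mb) (V : forall q : M, tangent (iota q)).
Variables (nab : connection (@tangent R 6 M))
  (snab : connection (fun q : M => spinor Sb (iota q))).
Hypotheses (HSb : spin_manifold Sb) (Hiota : embedding iota) (HV : unit_normal Sb V).
Let S := induced_data V nab snab.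
Hypotheses (Hsnab : is_spin_lift S)
  (Hvol : forall p e (psi : spinor Sb p), Defs.orthonormal (metric Sb) p e ->
    positive Sb p e -> frame_mul e psi = - psi).
Variable W : M -> 'M[R]_6.

Let eb : euclidean (@smooth_vf R 7 Mb) (metric Sb). Proof. by case: HSb. Qed.
Let bb : is_spinor_bundle Sb. Proof. by case: HSb. Qed.
Let ms : smooth_map iota. Proof. by case: Hiota. Qed.
Let tl q : linear (@tmap R 6 7 M Mb iota q). Proof. exact: tmap_linear. Qed.
Let gb p : inner_product (@metric R 7 Mb Sb p). Proof. exact: euclidean_inner eb p. Qed.
Let cb p := spinor_clifford eb bb p.
Let hb p : inner_product (@sprod R 7 Mb Sb p). Proof. by case: (cb p). Qed.
Let ml p x : linear (fun X => @cmul R 7 Mb Sb p X x). Proof. by case: (cb p) => _ _ []. Qed.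
Let mr p X : linear (@cmul R 7 Mb Sb p X). Proof. by case: (cb p) => _ _ []. Qed.
Let msq p X x : @cmul R 7 Mb Sb p X (cmul Sb X x) = - metric Sb X X *: x.
Proof. by case: (cb p). Qed.
Let eS : euclidean (@smooth_vf R 6 M) (metric S). Proof. exact: induced_euclidean. Qed.
Let bS : is_spinor_bundle S. Proof. exact: induced_bundle. Qed.
Let cS q := spinor_clifford eS bS q.
Let mS := @smooth_along_module R 6 7 M Mb iota _ (@ssmooth R 7 Mb Sb).
Let mT := @smooth_along_module R 6 7 M Mb iota _ (@smooth_vf R 7 Mb).

(** [V] acts as the volume element, a product of Clifford multiplications of the hypersurface. *)
Lemma volume_commute q (A : spinor Sb (iota q) -> spinor Sb (iota q)) :
  (forall (X : tangent q) x, A (cmul S X x) = cmul S X (A x)) ->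
  forall x, A (cmul Sb (V q) x) = cmul Sb (V q) (A x).
Proof.
move=> cA x.
rewrite -!(induced_volume (nab := nab) (snab := snab) HSb Hiota HV Hvol).
rewrite /volume_mul /frame_mul; elim: (enum _) => [//|i l IH].
exact: etrans (cA _ _) (congr1 _ IH).
Qed.

Section AtPoint.
Variable nablai : connection (fun q : M => tangent (iota q)).
Hypotheses (Wsym : symmetric_endo (metric S) W)
  (Hni : pullback_connection (@smooth_vf _ _ Mb) (nabla Sb) nablai)
  (Wn : forall q (X : tangent q) Y, smooth_vf q Y ->
      @nablai q X (fun r => tmap iota (Y r)) =
      tmap iota (nabla S X Y) + metric S (endo W X) (Y q) *: V q).
Variables (q : M) (v : tangent q).

Let dT : derivation v (smooth_along (iota := iota) (@smooth_vf R 7 Mb)) (@nablai q v).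
Proof. by apply: connection_derivation; [case: Hni | exact: mT]. Qed.

Lemma pullback_metric X Y :
  smooth_along (iota := iota) (@smooth_vf R 7 Mb) q X ->
  smooth_along (iota := iota) (@smooth_vf R 7 Mb) q Y ->
  dird v (fun r => metric Sb (X r) (Y r)) =
  metric Sb (@nablai q v X) (Y q) + metric Sb (X q) (@nablai q v Y).
Proof.
move=> sX sY.
apply: (along_leibniz (E1 := @tangent R 7 Mb) (E2 := @tangent R 7 Mb) (G := fun _ => R^o)
  (B := fun r x y => metric Sb x y : R^o) _ _ (@smooth_fun_module R 6 M) dT dT
  (dird_derivation v)) sX sY.
- by move=> r y; exact: inner_linl (gb _) _.
- by move=> r y; exact: inner_linr (gb _) _.
- by move=> X' Y' sX' sY'; exact: (smooth_along_inner ms eb).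
move=> X' Y' sX' sY'; have [_ pn] := Hni; rewrite !pn//.
have [_ _ [_ pres _] _ _] := HSb.
rewrite -(pres _ (tmap iota v) X' Y' sX' sY') (dird_tmap ms)//.
by have [_ _ _ H] := eb; exact: H.
Qed.

(** Differentiating [g(V, Y) = 0] gives the tangential part, differentiating [g(V, V) = 1] shows
    that there is no normal part. *)
Lemma nabla_normal : @nablai q v V = - tmap iota (endo W v).
Proof.
have [sV V1 VT] := HV.
have [e oe] := exists_orthonormal eS q.
have on := normal_frame_orthonormal (V := V) HSb HV oe.
apply/eqP; rewrite -addr_eq0; apply/eqP.
have tT X : metric Sb (@nablai q v V + tmap iota (endo W v)) (tmap iota (X : tangent q)) = 0.
  have [Y sY YX] := extend_vf X.
  have := pullback_metric (sV q) (smooth_along_tmap ms sY).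
  rewrite Wn// (innerDr (gb _)) (innerZr (gb _)) V1 mulr1 VT add0r YX.
  rewrite (_ : (fun r => _) = (fun _ => 0)); last by apply/funext => r; rewrite VT.
  by rewrite dird_cst (innerDl (gb _)) => <-.
have tV : metric Sb (@nablai q v V + tmap iota (endo W v)) (V q) = 0.
  rewrite (innerDl (gb _)) (innerC (gb _) (tmap _ _)) VT addr0.
  have := pullback_metric (sV q) (sV q).
  rewrite (_ : (fun r => _) = (fun _ => 1)); last by apply/funext => r; rewrite V1.
  by rewrite dird_cst (innerC (gb _) (V q)) => /esym; exact: addrr_eq0.
rewrite (orthonormal_row_expand eb (@nablai q v V + tmap iota (endo W v)) on).
rewrite big1// => i _; rewrite -(splitK (m := 6) (n := 1) i).
case: (fintype.split (i : 'I_(6 + 1))) => i' /=.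
  by rewrite normal_frame_l tT scale0r.
by rewrite normal_frame_r tV scale0r.
Qed.

Lemma spinor_gauss_at s : ssmooth (iota q) s ->
  @snab q v (fun r => s (iota r)) =
  @snabla R 7 Mb Sb (iota q) (tmap iota v) s + 2^-1 *: cmul S (endo W v) (s (iota q)).
Proof.
have [vb _ _ _ _] := bb; have [_ _ _ _ [HD Hpres HLift]] := HSb.
have [HDi Hipres HiLift] := Hsnab.
have [A lA AE] := connection_difference ms vb (Di := snab) v HD HDi.
have skA x y : sprod Sb (A x) y = - sprod Sb x (A y).
  have [s1 ss1 <-] := extend_section vb x; have [s2 ss2 <-] := extend_section vb y.
  have as1 := @smooth_along_pull R 6 7 M Mb iota _ _ q s1 ss1.
  have as2 := @smooth_along_pull R 6 7 M Mb iota _ _ q s2 ss2.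
  have : dird v (fun r => sprod Sb (s1 (iota r)) (s2 (iota r))) =
      sprod Sb (@snab q v (fun r => s1 (iota r))) (s2 (iota q)) +
      sprod Sb (s1 (iota q)) (@snab q v (fun r => s2 (iota r))).
    exact: (Hipres q v _ _ as1 as2).
  rewrite !AE// (innerDl (hb _)) (innerDr (hb _)).
  rewrite addrACA -Hpres// (dird_tmap ms); last by have [_ [_ _ _ H] _ _ _] := bb; exact: H.
  move=> /(congr1 (fun z => z - @dird R 6 M q v ((fun p => sprod Sb (s1 p) (s2 p)) \o iota))).
  by rewrite [LHS]subrr addrAC subrr add0r => /esym/eqP; rewrite addr_eq0 => /eqP.
(* [D] extends the ambient derivative to sections along [iota], in particular to products with
   [V]. *)
pose D Z := @snab q v Z - A (Z q).
have dS : derivation v (smooth_along (iota := iota) (@ssmooth R 7 Mb Sb)) (@snab q v).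
  exact: connection_derivation HDi mS.
have dD : derivation v (smooth_along (iota := iota) (@ssmooth R 7 Mb Sb)) D.
  have [DD DL DE] := dS; rewrite /D; split.
  - by move=> s1 s2 ss1 ss2; rewrite DD// (linD lA) opprD addrACA.
  - by move=> f s1 sf ss1; rewrite DL// (linZ lA) scalerBr addrA.
  - by move=> s1 s2 ss1 ss2 s12; rewrite (DE _ _ ss1 ss2 s12) (nbhs_singleton s12).
have Dpull s1 : ssmooth (iota q) s1 ->
    D (fun r => s1 (iota r)) = @snabla R 7 Mb Sb (iota q) (tmap iota v) s1.
  by move=> ss1; rewrite /D AE// addrK.
have clif X Z : smooth_along (iota := iota) (@smooth_vf R 7 Mb) q X ->
    smooth_along (iota := iota) (@ssmooth R 7 Mb Sb) q Z ->
    D (fun r => cmul Sb (X r) (Z r)) = cmul Sb (@nablai q v X) (Z q) + cmul Sb (X q) (D Z).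
  apply: (along_leibniz (E1 := @tangent R 7 Mb) (E2 := spinor Sb)
    (B := fun r x y => cmul Sb x y) _ _ mS dT dD dD).
  - by move=> r y; exact: ml.
  - by move=> r y; exact: mr.
  - by move=> X' Y' sX' sY'; exact: (smooth_along_cmul bb).
  move=> X' Y' sX' sY'; have [_ pn] := Hni.
  rewrite (Dpull (fun p => cmul Sb (X' p) (Y' p))); last first.
    by have [_ _ _ _ H] := bb; exact: H.
  by rewrite Dpull// pn// HLift.
(* The section [V Y s] is differentiated twice: as [Y . s] by the lift property of the hypersurface,
   and factor by factor by [clif], where [nabla_normal] brings in [W]. *)
have key (X : tangent q) x : A (cmul S X x) - cmul S X (A x) =
    cmul Sb (tmap iota (endo W v)) (cmul Sb (tmap iota X) x) + metric S (endo W v) X *: x.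
  have [Y sY YX] := extend_vf X; have [s1 ss1 s1x] := extend_section vb x.
  have as1 := @smooth_along_pull R 6 7 M Mb iota _ _ q s1 ss1.
  have aY := smooth_along_tmap ms sY; have [sV _ _] := HV.
  have : @snab q v (fun r => cmul Sb (V r) (cmul Sb (tmap iota (Y r)) (s1 (iota r)))) =
      cmul S (@nab q v Y) (s1 (iota q)) + cmul S (Y q) (@snab q v (fun r => s1 (iota r))).
    exact: (HiLift q v Y (fun r => s1 (iota r)) sY as1).
  have snE Z : @snab q v Z = D Z + A (Z q) by rewrite /D subrK.
  rewrite !snE clif//; last exact: (smooth_along_cmul bb).
  rewrite clif// nabla_normal Wn// YX s1x.
  rewrite (linN (ml _)) (linD (ml _) (tmap _ _)) (linZ (ml _)).
  rewrite !(linD (mr (V q))) (linZ (mr (V q))) (normal_sq HSb HV) scalerN.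
  rewrite [cmul S X (D _ + A x)]/= (linD (mr (tmap iota X))) (linD (mr (V q))).
  exact: zmod_cancel.
pose A' x := A x - 2^-1 *: cmul S (endo W v) x.
have lA' : linear A'.
  have [_ _ [_ mrS] _ _] := cS q.
  by move=> a x y; rewrite /A' lA mrS !(scalerDr, scalerN) !scalerA [2^-1 * a]mulrC opprD addrACA.
have skA' x y : sprod S (A' x) y = - sprod S x (A' y).
  have hS : inner_product (@sprod R 6 M S q) by case: (cS q).
  rewrite /A' (innerDl hS) (innerDr hS) (innerNl hS) (innerNr hS) (innerZl hS) (innerZr hS).
  rewrite (mul_skew (cS q)) mulrN !opprD !opprK; congr (_ + _).
  exact: skA.
(* In ambient products, half the commutator of [W(v)] and [X] is [W(v) X + g(W(v), X)], the right
   side of [key]. *)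
have comA' (X : tangent q) x : A' (cmul S X x) = cmul S X (A' x).
  have [_ _ [_ mrS] _ _] := cS q.
  apply/eqP; rewrite -subr_eq0 /A' (linB (mrS X)) (linZ (mrS X)) opprD addrACA key opprK.
  rewrite (induced_mul2 HSb HV) (induced_mul2 HSb HV).
  rewrite (mul_anticomm (cb (iota q)) (tmap iota X)) (innerC (gb _)).
  set a := cmul Sb _ _; rewrite -[metric Sb _ _]/(metric S (endo W v) X).
  rewrite scalerDr !scalerN scalerA mulrA mulVf ?pnatr_eq0// mul1r addrA.
  have {1}-> : a = 2^-1 *: a + 2^-1 *: a.
    by rewrite -mulr2n -scaler_nat scalerA mulfV ?pnatr_eq0// scale1r.
  by rewrite !addrA (ACl ((1*4)*(2*5)*(3*6)))/= !subrr !addr0.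
suff A'0 : A' (s (iota q)) = 0.
  move=> ss; rewrite AE//; congr (_ + _); apply/eqP; rewrite -subr_eq0; exact/eqP.
have [e oe] := exists_orthonormal eS q.
have [b bs] := spinor_basis bb (iota q).
have VS := volume_commute comA'.
apply: (commutant_trivial (cS q) bs oe (j := fun x => cmul Sb (V q) x)) => //.
- exact: mr.
- by move=> x y; exact: (mul_skew (cb _)).
- by move=> x; exact: normal_sq.
- move=> X x; transitivity (cmul Sb (V q) (cmul Sb (V q) (cmul Sb (tmap iota X) x))) => //.
  by rewrite (normal_anticomm HSb HV X x) (linN (mr _)).
Qed.

End AtPoint.

Lemma spinor_gauss (HW : weingarten Sb V S W) q (v : tangent q) s :
  ssmooth (iota q) s -> @snab q v (fun r => s (iota r)) =
  @snabla R 7 Mb Sb (iota q) (tmap iota v) s + 2^-1 *: cmul S (endo W v) (s (iota q)).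
Proof. by have [_ [nablai Hni Wn]] := HW; exact: (spinor_gauss_at Hni Wn). Qed.

End Gauss.

(** * The characteristic connection *)

Lemma torsion_scalar_identity (A : comPzRingType) (x y b a t : A) :
  x - y - b = 0 -> x + a * t - (y + a * - t) - b = 2 * a * t.
Proof.
by move=> H; transitivity ((x - y - b) + 2 * a * t); [ring | rewrite H add0r].
Qed.

Section TorsionConnection.
Context {R : realType} {n : nat} {M : manifold R n}.
Variables (g : metric_tensor M) (nab : connection (@tangent R n M)) (T : form3 M).
Hypotheses (eg : euclidean (@smooth_vf R n M) g) (HT : is_form3 T).
Let hg p : inner_product (@g p). Proof. exact: euclidean_inner eg p. Qed.

Lemma form3_linear1 p y z : scalar (fun x => @T p x y z).
Proof. by case: HT. Qed.

Lemma form3_linear2 p x z : scalar (fun y => @T p x y z).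
Proof.
by have [t1 t12 _ _] := HT; move=> a u v; rewrite !(t12 p x) t1 opprD mulrN.
Qed.

Lemma form3_linear3 p x y : scalar (@T p x y).
Proof.
by have [_ _ t23 _] := HT; move=> a u v; rewrite !(t23 p x y) form3_linear2 opprD mulrN.
Qed.

Lemma sharp_form3 p x y z : g (sharp g (@T p x y)) z = @T p x y z.
Proof. exact: (sharpE eg (@form3_linear3 p x y)). Qed.

Lemma sharp_linear1 p y : linear (fun x => sharp g (@T p x y)).
Proof.
move=> a u v; apply: (metric_separates eg) => z.
by rewrite (innerDl (hg p)) (innerZl (hg p)) !sharp_form3 form3_linear1.
Qed.

Lemma sharp_linear2 p x : linear (fun y => sharp g (@T p x y)).
Proof.
move=> a u v; apply: (metric_separates eg) => z.
by rewrite (innerDl (hg p)) (innerZl (hg p)) !sharp_form3 form3_linear2.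
Qed.

Lemma sharpC p x y : sharp g (@T p x y) = - sharp g (@T p y x).
Proof.
apply: (metric_separates eg) => z; rewrite (innerNl (hg p)) !sharp_form3.
by case: HT.
Qed.

(** [nabla_tor S T s] is the case [a = 2 * s] of this connection for [nabla S]. *)
Definition add_torsion (a : R) : connection (@tangent R n M) :=
  fun p v Y => @nab p v Y + a *: sharp g (@T p v (Y p)).

Lemma add_torsion_connection a : is_connection (@smooth_vf R n M) nab ->
  is_connection (@smooth_vf R n M) (add_torsion a).
Proof.
move=> [n1 n2 n3 n4]; rewrite /add_torsion; split.
- move=> p s ss b u v; rewrite (n1 p s ss) (linD (sharp_linear1 _)) (linZ (sharp_linear1 _)).
  by rewrite !scalerDr !scalerA [a * b]mulrC addrACA.
- move=> p v s t ss st; rewrite n2// (linD (sharp_linear2 _)) scalerDr.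
  by rewrite addrACA.
- move=> p v f s sf ss; rewrite n3// (linZ (sharp_linear2 _)) scalerDr addrA.
  by rewrite !scalerA mulrC.
- move=> p X s sX ss; apply: smooth_vfD; first exact: n4.
  apply: (smooth_vfZ (a := fun=> a)); first exact: smooth_fun_cst.
  apply: (smooth_vf_of_pairing eg) => Y sY.
  have [_ _ _ ts] := HT; apply: near_eq_smooth_fun (ts p X s Y sX ss sY).
  by apply: nearW => q; rewrite sharp_form3.
Qed.

(** The added endomorphism is skew because [T] is skew in its last two arguments. *)
Lemma add_torsion_metric a : preserves (@smooth_vf R n M) nab g ->
  preserves (@smooth_vf R n M) (add_torsion a) g.
Proof.
move=> H p v s t ss st; rewrite H// /add_torsion.
rewrite (innerDl (hg p)) (innerDr (hg p)) (innerZl (hg p)) (innerZr (hg p)).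
rewrite (innerC (hg p) (s p) (sharp _ _)) !sharp_form3.
have [_ _ t23 _] := HT; rewrite (t23 p v (t p)); ring.
Qed.

Lemma sharp0 p : sharp g (fun _ : @tangent R n M p => 0) = 0.
Proof.
apply: (metric_separates eg) => z; rewrite (inner0l (hg p)).
by rewrite (sharpE eg)// => b u v; rewrite mulr0 addr0.
Qed.

(** The terms added at [X, Y] and at [Y, X] are opposite, which doubles the coefficient; [a = 1/2]
    gives torsion exactly [T]. *)
Lemma add_torsion_torsion a : has_torsion g nab (fun _ _ _ _ => 0) ->
  forall p X Y (f : M -> R), smooth_vf p X -> smooth_vf p Y -> smooth_fun p f ->
    dird (@add_torsion a p (X p) Y) f - dird (@add_torsion a p (Y p) X) f
    - (dird (X p) (fun q => dird (Y q) f) - dird (Y p) (fun q => dird (X q) f))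
    = dird ((2 * a) *: sharp g (@T p (X p) (Y p))) f.
Proof.
move=> H p X Y f sX sY sf; have ld := dird_linear sf.
have dD u v : dird (u + v : tangent p) f = dird u f + dird v f.
  exact: (linD (f := fun w => dird w f : R^o) ld).
have dZ b u : dird (b *: u : tangent p) f = b * dird u f.
  exact: (linZ (f := fun w => dird w f : R^o) ld).
have dN u : dird (- u : tangent p) f = - dird u f.
  exact: (linN (f := fun w => dird w f : R^o) ld).
have := H p X Y f sX sY sf; rewrite sharp0 [dird 0 f]derive0.
rewrite /add_torsion (sharpC (Y p)) !dD !dZ !dN.
exact: torsion_scalar_identity.
Qed.

End TorsionConnection.

Section SU3Torsion.
Context {R : realType} {M : manifold R 6} (S : spin_data M).
Variables (phi : forall q, spinor S q).
Hypotheses (eg : euclidean (@smooth_vf R 6 M) (metric S)) (sb : is_spinor_bundle S)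
  (sphi : spinor_field phi).
Let cS q := spinor_clifford eg sb q.

Lemma psi_form_smooth p X Y Z : smooth_vf p X -> smooth_vf p Y -> smooth_vf p Z ->
  smooth_fun p (fun q => psi_form phi (X q) (Y q) (Z q)).
Proof.
move=> sX sY sZ; apply: smooth_funN.
have [_ [_ _ _ hs] _ _ ms] := sb.
apply: (hs p (fun q => cmul S (X q) (cmul S (Y q) (cmul S (Z q) (phi q)))) phi) => //.
apply: (ms p X (fun q => cmul S (Y q) (cmul S (Z q) (phi q)))) => //.
apply: (ms p Y (fun q => cmul S (Z q) (phi q))) => //.
exact: ms.
Qed.

Lemma smooth_vf_endo p (A : M -> 'M[R]_6) X :
  (forall X Y, smooth_vf p X -> smooth_vf p Y ->
    smooth_fun p (fun q => metric S (endo A (X q)) (Y q))) ->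
  smooth_vf p X -> smooth_vf p (fun q => endo A (X q)).
Proof. by move=> H sX; apply: (smooth_vf_of_pairing eg) => Y sY; exact: H. Qed.

Lemma endo_linear (A : M -> 'M[R]_6) q : linear (endo A (q := q)).
Proof. by move=> a u v; rewrite /endo mulmxDl -scalemxAl. Qed.

Variables (mu : M -> R) (W W3 : M -> 'M[R]_6).
Hypotheses (HWdec : forall q, W q = (mu q)%:M + W3 q)
  (Wsmooth : forall p X Y, smooth_vf p X -> smooth_vf p Y ->
    smooth_fun p (fun q => metric S (endo W (X q)) (Y q)))
  (W3tr : forall q, \tr (W3 q) = 0).

Lemma endo_decomp q (X : tangent q) : endo W X = mu q *: X + endo W3 X.
Proof. by rewrite /endo HWdec mulmxDr mul_mx_scalar. Qed.

Lemma mu_smooth p : smooth_fun p mu.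
Proof.
have sW := smooth_trace eg (@Wsmooth p).
apply: near_eq_smooth_fun (smooth_funM sW (smooth_fun_cst p 6^-1)).
apply: nearW => q; rewrite HWdec mxtraceD W3tr addr0 mxtrace_scalar.
by rewrite -[mu q *+ 6]mulr_natr mulfK// pnatr_eq0.
Qed.

Lemma W3_smooth p X : smooth_vf p X -> smooth_vf p (fun q => endo W3 (X q)).
Proof.
move=> sX; have sWX := smooth_vf_endo (@Wsmooth p) sX.
have := smooth_vfD sWX (smooth_vfZ (smooth_funN (@mu_smooth p)) sX).
apply: near_eq_smooth_vf; apply: nearW => q.
by rewrite endo_decomp scaleNr addrAC subrr add0r.
Qed.

Let L := L_form phi mu W3.

(** A swap of two arguments permutes the cyclic terms up to sign, so the cyclic sum is skew although
    its single terms need not be. *)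
Lemma L_form3 : is_form3 L.
Proof.
have p1 q Y Z : scalar (fun X : tangent q => psi_form phi X Y Z).
  exact: (psi_of_linear (cS q)).
have p12 q (X Y Z : tangent q) : psi_form phi X Y Z = - psi_form phi Y X Z.
  exact: (psi_ofC12 (cS q)).
have p23 q (X Y Z : tangent q) : psi_form phi X Y Z = - psi_form phi X Z Y.
  exact: (psi_ofC23 (cS q)).
have p2 q X Z : scalar (fun Y : tangent q => psi_form phi X Y Z).
  exact: (psi_of_linear2 (cS q)).
have p3 q X Y : scalar (fun Z : tangent q => psi_form phi X Y Z).
  exact: (psi_of_linear3 (cS q)).
rewrite /L /L_form; split.
- move=> q y z a u v; rewrite (endo_linear W3 a) !p1 p2 p3; ring.
- move=> q x y z; rewrite (p12 q x y z) (p23 q (endo W3 x) y z) (p23 q (endo W3 y) z x).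
  by rewrite (p23 q (endo W3 z) x y); ring.
- move=> q x y z; rewrite (p23 q x y z) (p23 q (endo W3 x) y z) (p23 q (endo W3 y) z x).
  by rewrite (p23 q (endo W3 z) x y); ring.
- move=> q X Y Z sX sY sZ; apply: smooth_funB.
    apply: smooth_funN; apply: smooth_funD; first apply: smooth_funD.
    + exact: (psi_form_smooth (W3_smooth sX) sY sZ).
    + exact: (psi_form_smooth (W3_smooth sY) sZ sX).
    + exact: (psi_form_smooth (W3_smooth sZ) sX sY).
  by apply: smooth_funM; [exact: mu_smooth | exact: psi_form_smooth].
Qed.

End SU3Torsion.

Lemma is_form3D (R : realType) n (M : manifold R n) (T1 T2 : form3 M) :
  is_form3 T1 -> is_form3 T2 -> is_form3 (fun q X Y Z => T1 q X Y Z + T2 q X Y Z).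
Proof.
move=> [r1 r12 r23 rs] [l1 l12 l23 ls]; split.
- by move=> q y z a u v; rewrite r1 l1 mulrDr addrACA.
- by move=> q x y z; rewrite r12 l12 opprD.
- by move=> q x y z; rewrite r23 l23 opprD.
- by move=> q X Y Z sX sY sZ; apply: smooth_funD; [exact: rs | exact: ls].
Qed.

Section InducedTorsion.
Context {R : realType} {Mb : manifold R 7} {M : manifold R 6}.
Variables (Sb : spin_data Mb) (iota : M -> Mb) (V : forall q : M, tangent (iota q)).
Variables (nab : connection (@tangent R 6 M))
  (snab : connection (fun q : M => spinor Sb (iota q))).
Hypotheses (HSb : spin_manifold Sb) (Hiota : embedding iota) (HV : unit_normal Sb V).
Let S := induced_data V nab snab.
Let eb : euclidean (@smooth_vf R 7 Mb) (metric Sb). Proof. by case: HSb. Qed.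
Let bb : is_spinor_bundle Sb. Proof. by case: HSb. Qed.
Let ms : smooth_map iota. Proof. by case: Hiota. Qed.
Let eS : euclidean (@smooth_vf R 6 M) (metric S). Proof. exact: induced_euclidean. Qed.
Let bS : is_spinor_bundle S. Proof. exact: induced_bundle. Qed.

Lemma restrict_form3 Tb : is_form3 Tb -> is_form3 (restrict3 iota Tb).
Proof.
move=> HT; have [t1 t12 t23 _] := HT; rewrite /restrict3; split.
- by move=> q y z a u v; rewrite (@tmap_linear _ _ _ _ _ iota ms q a) t1.
- by move=> q x y z; exact: t12.
- by move=> q x y z; exact: t23.
- by move=> q X Y Z sX sY sZ; apply: (smooth_along_form3 ms) => //; exact: smooth_along_tmap.
Qed.

(** The function is the normal component of the pulled-back derivative of [Y] along [X]. The Gauss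
    formula is used at all points near [q], whence [smooth_vf_near]. *)
Lemma weingarten_smooth W q X Y : weingarten Sb V S W -> smooth_vf q X -> smooth_vf q Y ->
  smooth_fun q (fun r => metric S (endo W (X r)) (Y r)).
Proof.
move=> [_ [nablai [[_ _ _ n4] _] Wn]] sX sY; have [sV V1 VT] := HV.
have gb p := euclidean_inner eb p.
have := smooth_along_inner ms eb (n4 q X _ sX (smooth_along_tmap ms sY)) (sV q).
apply: near_eq_smooth_fun; apply: filterS (smooth_vf_near sY) => r sYr.
rewrite Wn// (innerDl (gb _)) (innerZl (gb _)) V1 mulr1 (innerC (gb _)) VT add0r.
by [].
Qed.

(** In the adapted frame [e], [V] all terms with a normal index vanish, and on tangent pairs both
    Clifford products agree by [induced_mul2]. *)
Lemma form2_mul_restrict q (w : tangent (iota q) -> tangent (iota q) -> R)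
    (x : spinor Sb (iota q)) :
  (forall Y, scalar (w^~ Y)) -> (forall X Y, w X Y = - w Y X) ->
  (forall Y, w (V q) Y = 0) ->
  form2_mul (S := Sb) w x =
  form2_mul (S := S) (fun Y Z : tangent q => w (tmap iota Y) (tmap iota Z)) (x : spinor S q).
Proof.
move=> wl ws wV; have [e oe] := exists_orthonormal eS q.
have on := normal_frame_orthonormal HSb HV oe.
rewrite (form2_mulE eb bb x on wl ws) (form2_mulE eS bS _ oe); last first.
- by move=> X Y; exact: ws.
- by move=> Y a u v; rewrite (@tmap_linear _ _ _ _ _ iota ms q a) wl.
congr (_ *: _).
rewrite (@big_split_ord _ _ _ 6 1) /= big_ord1 [X in _ + X]big1 ?addr0; last first.
  by move=> i _; rewrite normal_frame_r wV scale0r.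
apply: eq_bigr => i _; rewrite (@big_split_ord _ _ _ 6 1) /= big_ord1.
rewrite normal_frame_r ws wV oppr0 scale0r addr0.
apply: eq_bigr => j _; rewrite !normal_frame_l.
by rewrite -(induced_mul2 (nab := nab) (snab := snab) HSb HV).
Qed.

End InducedTorsion.

Theorem theorem7p4 (R : realType)
  (Mb : manifold R 7) (Sb : spin_data Mb) (phi : forall p, spinor Sb p)
  (Tb : form3 Mb)
  (HG2 : G2_manifold phi) (HTb : characteristic_connection Tb phi)
  (M : manifold R 6) (iota : M -> Mb) (Hiota : embedding iota)
  (V : forall q : M, tangent (iota q)) (HV : unit_normal Sb V)
  (nab : connection (@tangent R 6 M))
  (snab : connection (fun q : M => spinor Sb (iota q)))
  (S := induced_data V nab snab)
  (Hnab : levi_civita (metric S) nab) (Hsnab : is_spin_lift S)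
  (W : M -> 'M[R]_6) (HW : weingarten Sb V S W)
  (HVT : forall (q : M) (Y Z : tangent (iota q)), Tb (iota q) (V q) Y Z = 0)
  (phiM := (fun q => phi (iota q)) : forall q, spinor S q)
  (J : M -> 'M[R]_6) (HJ : complex_structure phiM J)
  (mu : M -> R) (W3 : M -> 'M[R]_6)
  (HWdec : forall q, W q = (mu q)%:M + W3 q) (HW3 : type_three S J W3)
  (L := L_form phiM mu W3)
  (T := (fun q X Y Z => restrict3 iota Tb q X Y Z + L q X Y Z) : form3 M)
  (s : R) :
  [/\ SU3_manifold phiM /\ characteristic_connection T phiM,
      forall phis : forall p, spinor Sb p, spinor_field phis ->
        let phisM := (fun q => phis (iota q)) : forall q, spinor S q in
        (forall (q : M) (X : tangent q),
           snabla_tor T s X phisM = 2^-1 *: cmul S (endo W X) (phisM q)) ->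
        forall (q : M) (X : tangent q),
          snabla_tor Tb s (tmap iota X) phis
          = - s *: form2_mul (L q X) (phisM q)
    & forall phis : forall p, spinor Sb p, spinor_field phis ->
        let phisM := (fun q => phis (iota q)) : forall q, spinor S q in
        (forall (p : Mb) (v : tangent p), snabla_tor Tb s v phis = 0) ->
        forall (q : M) (X : tangent q),
          snabla_tor T s X phisM
          = - s *: form2_mul
                     (fun Y Z => restrict3 iota Tb q X Y Z - T q X Y Z)
                     (phisM q)
            + 2^-1 *: cmul S (endo W X) (phisM q)].
Proof.
have [HSb Hvol [sphi phi1]] := HG2.
have [HT3 _ _ _ Hpar] := HTb.
have eb : euclidean (@smooth_vf R 7 Mb) (metric Sb) by case: HSb.
have bb : is_spinor_bundle Sb by case: HSb.
have ms : smooth_map iota by case: Hiota.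
have eS : euclidean (@smooth_vf R 6 M) (metric S) by exact: induced_euclidean.
have bS : is_spinor_bundle S by exact: induced_bundle.
have sphiM : spinor_field phiM.
  by move=> q; apply: (@smooth_along_pull R 6 7 M Mb iota _ _ q phi); exact: sphi.
have oS : is_orientation (positive S) by exact: induced_orientation.
have spin : spin_manifold S.
  by split; [exact: eS | exact: oS | exact: Hnab | exact: bS | exact: Hsnab].
have [Jsym W3tr W3J] := HW3.
have Wsm p X Y : smooth_vf p X -> smooth_vf p Y ->
    smooth_fun p (fun q => metric S (endo W (X q)) (Y q)).
  exact: weingarten_smooth.
have HL : is_form3 L by exact: (L_form3 eS bS sphiM HWdec Wsm W3tr).
have HR := restrict_form3 Hiota HT3.
have HT : is_form3 T.
  exact: is_form3D HR HL.
have gauss : forall phis : forall p, spinor Sb p, spinor_field phis ->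
    forall (q : M) (X : tangent q), @snab q X (fun r => phis (iota r)) =
    snabla (tmap iota X) phis + 2^-1 *: cmul S (endo W X) (phis (iota q) : spinor S q).
  by move=> phis sphis q X; apply: (spinor_gauss HSb Hiota HV Hsnab Hvol HW); exact: sphis.
have restr : forall q (X : tangent q) (x : spinor Sb (iota q)),
    form2_mul (Tb (iota q) (tmap iota X)) x =
    form2_mul (S := S) (restrict3 iota Tb q X) (x : spinor S q).
  move=> q X x; have [t1 t12 t23 _] := HT3.
  apply: (form2_mul_restrict _ _ HSb Hiota HV).
  - exact: form3_linear2.
  - by move=> Y Z; exact: t23.
  - by move=> Y; rewrite t12 HVT oppr0.
have form2T : forall q (X : tangent q) (x : spinor S q), form2_mul (T q X) x =
    form2_mul (restrict3 iota Tb q X) x + form2_mul (L q X) x.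
  move=> q X x; rewrite -[form2_mul (restrict3 _ _ _ _) _]scale1r -form2_mul_linear.
  congr (form2_mul _ _); apply/funext => Y; apply/funext => Z.
  by rewrite /T mul1r.
(* [sum_torsion] with [j] the multiplication by [V]. The constant is half of its [- 4], since the
   full double sum counts every pair twice. *)
have form2L : forall q (X : tangent q),
    form2_mul (L q X) (phiM q) = - 2 *: cmul S (endo W X) (phiM q).
  move=> q X; have [e oe] := exists_orthonormal eS q.
  have [b bs] := spinor_basis bS q.
  have [_ l12 l23 _] := HL.
  rewrite (form2_mulE eS bS (phiM q) oe (fun Y => @form3_linear2 _ _ _ _ HL q X Y) (l23 q X)).
  have [_ _ [_ mr] _ _] := spinor_clifford eb bb (iota q).
  have jl : linear (fun x : spinor S q => cmul Sb (V q) x) by exact: mr.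
  have js x y : sprod S (cmul Sb (V q) x) y = - sprod S x (cmul Sb (V q) y).
    exact: (mul_skew (spinor_clifford eb bb (iota q))).
  have jj (x : spinor S q) : cmul Sb (V q) (cmul Sb (V q) x) = - x by exact: normal_sq.
  have jm (Y : tangent q) x : cmul Sb (V q) (cmul S Y x) = - cmul S Y (cmul Sb (V q) x).
    transitivity (cmul Sb (V q) (cmul Sb (V q) (cmul Sb (tmap iota Y) x))) => //.
    by rewrite (normal_anticomm HSb HV Y x) (linN (mr _)).
  have Jphi (Y : tangent q) : cmul S (endo J Y) (phiM q) = cmul Sb (V q) (cmul S Y (phiM q)).
    by rewrite HJ; exact: (induced_volume HSb Hiota HV Hvol).
  have J3 (Y : tangent q) : endo W3 (endo J Y) = - endo J (endo W3 Y).
    by rewrite /endo -!mulmxA W3J mulmxN opprK.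
  have st := sum_torsion (spinor_clifford eS bS q) bs oe
    (fun Y => @orthonormal_row_expand _ _ _ _ eS q e Y oe) jl js jj jm (phi1 _)
    (@endo_linear _ _ J q) Jphi (@endo_linear _ _ W3 q) (Jsym q) J3 (mu q) X.
  rewrite (endo_decomp HWdec).
  transitivity (2^-1 *: (- 4 *: cmul S (mu q *: X + endo W3 X) (phiM q)) : spinor S q).
    by congr (_ *: _); rewrite -st.
  by rewrite scalerA; congr (_ *: _); lra.
split; first split.
- split; [exact: spin | split; [exact: sphiM | by move=> q; exact: phi1]].
- split.
  + exact: HT.
  (* [2 * 4^-1] is the coefficient [2 s] of [nabla_tor] at [s = 1/4]. *)
  + have [H _ _] := Hnab; exact: (add_torsion_connection eS HT (2 * 4^-1) H).
  + have [_ H _] := Hnab; exact: (add_torsion_metric eS HT (2 * 4^-1) H).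
  + move=> p X Y f sX sY sf; have [_ _ H] := Hnab.
    rewrite [LHS](add_torsion_torsion eS HT (2 * 4^-1) H sX sY sf).
    by rewrite mulrA -natrM mulfV ?pnatr_eq0// scale1r.
  (* A quarter of [form2L] is [- 1/2 W(v) . phi], the opposite of the Gauss term; the rest is the
     ambient equation for [phi]. *)
  + move=> q v; rewrite /snabla_tor form2T form2L.
    have := Hpar (iota q) (tmap iota v); rewrite /snabla_tor restr => Hp.
    rewrite [snabla _ _](gauss phi sphi q v) scalerDr addrACA Hp add0r scalerA.
    rewrite -scalerDl (_ : _ + _ = 0) ?scale0r//; lra.
(* The Gauss term cancels the Killing term [1/2 W(X)]; of the torsion [T] the part [L] is left
   over. *)
- move=> phis sphis phisM Hk q X.
  have := Hk q X; rewrite /snabla_tor form2T restr.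
  rewrite [X in X + _](gauss phis sphis q X) scalerDr addrACA => /eqP.
  rewrite eq_sym -subr_eq opprD addrA => /eqP <-.
  by rewrite subrr add0r scaleNr.
- move=> phis sphis phisM Hk q X.
  have Dk := Hk (iota q) (tmap iota X); rewrite /snabla_tor restr in Dk.
  rewrite /snabla_tor form2T [@snabla _ _ _ S _ _ _](gauss phis sphis q X).
  rewrite scalerDr addrACA Dk add0r addrC; congr (_ + _).
  (* The difference of the restricted [Tb] and [T] is [- L], so the right side of the goal contains
     [s] times the action of [L]. *)
  rewrite (_ : form2_mul (fun Y Z : tangent q => restrict3 iota Tb q X Y Z - T q X Y Z)
      (phisM q) = - form2_mul (L q X) (phisM q)).
    by rewrite scaleNr scalerN opprK.
  have := form2_mul_linear (-1) (T q X) (restrict3 iota Tb q X) (phisM q).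
  rewrite form2T scaleN1r opprD addrAC addNr add0r => <-.
  by congr (form2_mul _ _); apply/funext => Y; apply/funext => Z; rewrite mulN1r addrC.
Qed.
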